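(* Let $1<p<\infty$. Let $\mu,\nu$ be Borel probability measures on $\mathbb{R}^d$, with $\mu$ of compact support. If $$d-D_p\mu<\dim_{\mathsf F}(\nu)\quad\text{when } p\in(1,2],$$ $$(p-1)(d-D_p\mu)<\dim_{\mathsf F}(\nu)\quad\text{when } p\in(2,+\infty),$$ then $\mu*\nu$ is absolutely continuous with respect to Lebesgue measure on $\mathbb{R}^d$, with an $L^p$ density. In particular, this is the case if $D_p\mu=d$ and $\dim_{\mathsf F}\nu>0$.
   Context: For $q>0$, $q\neq1$, and a compactly supported Borel probability measure $\mu$ on $\mathbb{R}^d$, the (lower) $L^q$ dimension is $D_q(\mu)=\liminf_{n\to\infty}\frac{\log S_{n,q}\mu}{(1-q)n}$, where $S_{n,q}\mu=\sum_{I\in\mathcal{D}_n}\mu(I)^q$, $\mathcal{D}_n$ is the partition of $\mathbb{R}^d$ into dyadic cubes of side length $2^{-n}$, and logarithms are to base 2. The Fourier transform is $\widehat{\nu}(\xi)=\int e^{i\pi\langle x,\xi\rangle}\,d\nu(x)$, and the Fourier dimension of $\nu$ is $\dim_{\mathsf F}\nu=\sup\{\sigma\ge0:\ |\widehat{\nu}(\xi)|=O_{\nu,\sigma}(|\xi|^{-\sigma/2})\}$. *)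

(* Defs.v *)
From HB Require Import structures.
From mathcomp Require Import all_boot all_order all_algebra.
From mathcomp Require Import all_classical all_reals all_analysis.
From mathcomp Require Import measurable_realfun complex.

Set Implicit Arguments.
Unset Strict Implicit.
Unset Printing Implicit Defensive.

Import Order.TTheory GRing.Theory Num.Theory.
Import numFieldNormedType.Exports.

Local Open Scope classical_set_scope.
Local Open Scope ring_scope.

(* R^d is 'rV[R]_d with its library topology (the one of the sup norm) and the
   Borel sigma-algebra of that topology. *)
Section borel_rV.
Variables (R : realType) (d : nat).

HB.instance Definition _ :=
  @isMeasurable.Build (sigma_display (@open 'rV[R]_d)) 'rV[R]_d
    <<s @open 'rV[R]_d >> (@sigma_algebra0 _ setT (@open 'rV[R]_d))
    (@sigma_algebraC _ (@open 'rV[R]_d))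
    (@sigma_algebra_bigcup _ setT (@open 'rV[R]_d)).

End borel_rV.

Lemma measurable_coord (R : realType) (d : nat) (i : 'I_d) :
  measurable_fun [set: 'rV[R]_d] (fun x : 'rV[R]_d => x 0 i).
Proof.
apply: (measurability _ (RGenOpens.measurableE R)) => _ [_ [a [b ->]] <-].
rewrite setTI; apply: sub_sigma_algebra; apply: open_comp.
  by move=> x _; exact: coord_continuous.
exact: interval_open.
Qed.

Lemma measurable_fun_rV (R : realType) (d : nat) dT (T : measurableType dT)
    (f : T -> 'rV[R]_d) :
  (forall i, measurable_fun [set: T] (fun t => f t 0 i)) ->
  measurable_fun [set: T] f.
Proof.
move=> mf; apply: (@measurability _ _ T 'rV[R]_d setT f (@open 'rV[R]_d) erefl).
move=> _ [U oU <-].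
rewrite setTI.
pose q (k : 'rV[rat]_d * nat) : 'rV[R]_d := map_mx ratr k.1.
pose B k := ball (q k) (k.2.+1%:R^-1 : R).
have -> : f @^-1` U =
    \bigcup_(k in [set k | B k `<=` U]) (f @^-1` B k).
  apply/seteqP; split => [t Ut|t [k kU Bk]]; last exact: kU.
  have /nbhs_ballP[e /= e0 eU] : nbhs (f t) U by apply: open_nbhs_nbhs.
  have [n nE] : exists n : nat, n.+1%:R^-1 < e / 2 :> R.
    exists (Num.bound (e / 2)^-1).
    rewrite invf_plt ?posrE// ?divr_gt0// (lt_trans (archi_boundP _))//.
      by rewrite invr_ge0 divr_ge0// ltW.
    by rewrite ltr_nat.
  have n0 : 0 < n.+1%:R^-1 :> R by rewrite invr_gt0.
  have /choice[r rP] i : exists r : rat, ball (f t 0 i) (n.+1%:R^-1 : R) (ratr r).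
    have /rat_in_itvoo[r] : f t 0 i - n.+1%:R^-1 < f t 0 i + n.+1%:R^-1.
      by rewrite ltrD2l gtrN.
    rewrite in_itv/= => /andP[r1 r2]; exists r.
    by rewrite /ball/= ltr_distlC r1.
  have fq : ball (q (\row_i r i, n)) (n.+1%:R^-1 : R) (f t).
    by apply: ball_sym; split => // i j; rewrite !mxE ord1; exact: rP.
  exists (\row_i r i, n) => //= x Bx; apply: eU.
  rewrite (splitr e); apply: (@ball_triangle _ _ (q (\row_i r i, n))).
    by apply: ball_sym; apply: le_ball fq; exact: ltW.
  by apply: le_ball Bx; exact: ltW.
rewrite bigcup_mkcond; apply: countable_bigcupT_measurable => [|k].
  exact: countableP.
case: ifPn => // _.
have k0 : 0 < k.2.+1%:R^-1 :> R by rewrite invr_gt0.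
have -> : f @^-1` B k = \bigcap_(i in [set: 'I_d])
    ((fun t => f t 0 i) @^-1` ball (q k 0 i) (k.2.+1%:R^-1 : R)).
  apply/seteqP; split => [t [_ Bt] i _|t Bt]; first exact: Bt.
  by split => // i j; rewrite ord1; exact: Bt.
apply: fin_bigcap_measurable => // i _.
by rewrite -[X in measurable X]setTI; apply: mf => //; exact: measurable_ball.
Qed.

Section lebesgue_rV.
Variable R : realType.

Definition cons_rV (d : nat) (z : 'rV[R]_d * R) : 'rV[R]_d.+1 :=
  \row_i oapp (z.1 0) z.2 (unlift ord0 i).

Lemma measurable_cons_rV (d : nat) : measurable_fun setT (@cons_rV d).
Proof.
apply: measurable_fun_rV => i; rewrite /cons_rV.
under eq_fun do rewrite mxE.
case: unliftP => [j|] _ /=; last exact: measurable_snd.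
exact: (measurableT_comp (measurable_coord j) measurable_fst).
Qed.

(* d-fold product of the Lebesgue measure on R, carried to 'rV[R]_d; its value
   on boxes is lebesgue_rV_box below. *)
Fixpoint lebesgue_rV (d : nat) : {measure set 'rV[R]_d -> \bar R} :=
  if d is d'.+1 then
    measure_function_pushforward__canonical__measure_function_Measure
      (lebesgue_rV d' \x (@lebesgue_measure R))%E (@measurable_cons_rV d')
  else dirac (0 : 'rV[R]_0).

Lemma lebesgue_rV_box (d : nat) (a b : 'I_d -> R) :
  (forall i, a i <= b i) ->
  lebesgue_rV d [set x | forall i, x 0 i \in `[a i, b i[] =
  (\prod_(i < d) (b i - a i))%:E.
Proof.
elim: d a b => [|d IHd] a b ab.
  rewrite big_ord0/= diracE (_ : _ \in _)//.
  by rewrite inE/= => -[].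
rewrite big_ord_recl/= /pushforward.
have -> : @cons_rV d @^-1` [set x | forall i, x 0 i \in `[a i, b i[] =
    [set x : 'rV[R]_d | forall i,
      x 0 i \in `[a (lift ord0 i), b (lift ord0 i)[] `*`
    `[a ord0, b ord0[.
  apply/seteqP; split => [z /= zab|z /= [z1 z2] i].
    split => [i|]; [have := zab (lift ord0 i)|have := zab ord0].
      by rewrite mxE liftK.
    by rewrite mxE unlift_none.
  by rewrite mxE; case: unliftP => [j ->|->]; [exact: z1|exact: z2].
rewrite product_measure1E//=; last first.
  rewrite (_ : [set x | _] = \bigcap_(i in [set: 'I_d])
    ((fun x : 'rV[R]_d => x 0 i) @^-1`
      `[a (lift ord0 i), b (lift ord0 i)[)); last first.
    by apply/seteqP; split => [x xab i _|x xab i]; exact: xab.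
  apply: fin_bigcap_measurable => // i _.
  by rewrite -[X in measurable X]setTI; exact: measurable_coord.
rewrite IHd// lebesgue_measure_itv/= lte_fin.
have := ab ord0; rewrite le_eqVlt => /predU1P[->|->].
  by rewrite ltxx subrr mul0r mule0.
by rewrite -EFinB -EFinM mulrC.
Qed.

End lebesgue_rV.


Section definitions.
Variables (R : realType) (d : nat).
Implicit Types (mu nu : probability 'rV[R]_d R) (x y xi : 'rV[R]_d).

Lemma measurable_add_rV :
  measurable_fun setT (fun z : 'rV[R]_d * 'rV[R]_d => z.1 + z.2).
Proof.
apply: measurable_fun_rV => i; under eq_fun do rewrite mxE.
by apply: measurable_funD; apply: (measurableT_comp (measurable_coord i)).
Qed.

Definition convolution mu nu : set 'rV[R]_d -> \bar R :=
  pushforward (mu \x nu)%E (fun z => z.1 + z.2).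

HB.instance Definition _ mu nu := Measure.copy (convolution mu nu)
  (measure_function_pushforward__canonical__measure_function_Measure
    (mu \x nu)%E measurable_add_rV).

Definition supp mu : set 'rV[R]_d :=
  [set x | forall U, open_nbhs x U -> (0 < mu U)%E].

(* half-open, so that the cubes of level n partition R^d *)
Definition dyadic_cube (n : nat) (k : 'rV[int]_d) : set 'rV[R]_d :=
  [set x | forall i, x 0 i \in
     `[(k 0 i)%:~R / 2 ^+ n, ((k 0 i)%:~R + 1) / 2 ^+ n[].

Definition dyadic_cubes (n : nat) : set (set 'rV[R]_d) :=
  range (dyadic_cube n).

Definition Lq_sum (q : R) mu (n : nat) : \bar R :=
  (\esum_(I in dyadic_cubes n) mu I `^ q)%E.

Definition log2e (t : \bar R) : \bar R := (lne t * (ln 2)^-1%:E)%E.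

(* extended-real valued; the junk term n = 0 does not affect the liminf *)
Definition Lq_dim (q : R) mu : \bar R :=
  limn_einf (fun n =>
    log2e (Lq_sum q mu n) * ((1 - q) * n%:R)^-1%:E)%E.

Definition dotmul x y : R := \sum_(i < d) x 0 i * y 0 i.

(* the library norm on 'rV[R]_d is the sup norm *)
Definition enorm x : R := Num.sqrt (dotmul x x).

Definition expi (t : R) : R[i] := Complex (cos t) (sin t).

(* integral of a complex-valued function, real and imaginary parts apart *)
Definition cintegral nu (f : 'rV[R]_d -> R[i]) : R[i] :=
  Complex (\int[nu]_x complex.Re (f x)) (\int[nu]_x complex.Im (f x)).

Definition fourier nu xi : R[i] :=
  cintegral nu (fun x => expi (pi * dotmul x xi)).

(* |nu^(xi)| = O(|xi|^(-s/2)). The estimate is asked for all xi != 0: near the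
   origin it is automatic since |nu^| <= 1, so this is the same as asking it
   for large |xi|. *)
Definition fourier_decay nu (s : R) : Prop :=
  exists C : R, forall xi, xi != 0 ->
    Normc.normc (fourier nu xi) <= C * enorm xi `^ (- (s / 2)).

Definition fourier_dim nu : \bar R :=
  ereal_sup [set s%:E | s in [set s : R | 0 <= s /\ fourier_decay nu s]].

(* m is absolutely continuous with a density in L^p; lebesgue_rV is sigma-finite,
   so a nonnegative version of the density can be taken *)
Definition ac_Lp_density (p : R) (m : set 'rV[R]_d -> \bar R) : Prop :=
  m `<< lebesgue_rV R d /\
  exists f : 'rV[R]_d -> R,
    [/\ f \in Lfun (lebesgue_rV R d) p%:E, (forall x, 0 <= f x) &
      forall A, measurable A ->
        m A = (\int[lebesgue_rV R d]_(x in A) (f x)%:E)%E].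

End definitions.

(* Main.v *)
Require Import Defs.
From HB Require Import structures.
From mathcomp Require Import all_boot all_order all_algebra.
From mathcomp Require Import all_classical all_reals all_analysis.
From mathcomp Require Import measurable_realfun complex.
From mathcomp Require Import ring lra.

Set Implicit Arguments.
Unset Strict Implicit.
Unset Printing Implicit Defensive.

Import Order.TTheory GRing.Theory Num.Theory.
Import numFieldNormedType.Exports.

Local Open Scope classical_set_scope.
Local Open Scope ring_scope.

(* Let [K_n] be a combination of Gaussians of variances about [4^-n] whose
   Fourier multiplier is [1 - (1 - e^(-c 4^-n |xi|^2))^k]; put
   [F_n = K_n * mu * nu] and [D_n = F_(n+1) - F_n]. The multiplier of [D_n] lives
   at frequencies about [2^n] and vanishes to order [2k] at the origin, so the
   decay of the transform of [nu] contributes a factor [2^(-n sigma)] to the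
   square of the multiplier, for every [sigma < dim_F nu].

   Split the dyadic cubes of level [n] into finitely many classes on which the
   mu-measure of a cube is comparable to some [a], and let [g] be the restriction
   of [mu] to a class. By Plancherel,
   the square of the L^2 norm of the piece of [D_n] coming from [g] is at most a
   constant times [2^(n(d - sigma)) a g(R^d)]; its L^1 norm is at most a constant
   times [g(R^d)], its sup norm at most a constant times [2^(nd) a]. Interpolating
   L^2 with L^1 (for [p <= 2]) or with L^oo (for [p >= 2]) bounds its L^p norm,
   and Chebyshev's inequality bounds [g(R^d) a^(p-1)] by the L^p sum of [mu]. The
   hypothesis on the dimensions is what makes [|D_n|_p] decay geometrically.

   Hence [F_n] converges almost everywhere under an L^p majorant, to some [f], and
   testing against Lipschitz functions shows that [mu * nu] has density [f] on
   open sets; its positive part is then a density on all Borel sets. *)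

(** * Lebesgue measure on R^d *)

(** Gaussians are chosen because a product of two of them is again a Gaussian, up to a constant:
    Plancherel for a finite combination of them is then Fubini and a double sum. The price is that
    the difference of two Gaussian multipliers vanishes only to order 2 at the origin, so that its
    square absorbs [|xi|^(-sigma)] only for [sigma <= 4]. The alternating combination of
    [k >= sigma] Gaussians removes this restriction, but its kernel has no sign, hence the positive
    part at the end.

    The splitting is needed because the L^2 bound sees the largest mass [a] of a cube, whereas the
    L^p sum weighs each cube by its own mass to the power [p - 1]. The thresholds are
    [2^(-n eps j)]: masses within a class agree up to [2^(n eps)], a loss that the strict inequality
    between the dimensions pays for. The number of classes does not depend on [n], since cubes
    lighter than [2^(-n s)] are harmless even if they carry the whole mass.

    The resulting condition is [expo < (p - 1) s] for some [s < D_p mu]; after division by [p - 1]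
    its left-hand side is [d - sigma] or [d - sigma / (p - 1)], whence the two cases of the
    theorem. *)

Section lebesgue_rV_theory.
Variable R : realType.

(* A copy of [lebesgue_rV], on which sigma-finiteness can be declared without
   unfolding the recursive definition. *)
Definition leb (d : nat) : set 'rV[R]_d -> \bar R := lebesgue_rV R d.

HB.instance Definition _ d := Measure.on (@leb d).

Definition box (d : nat) (M : nat) : set 'rV[R]_d :=
  [set x | forall i, x 0 i \in `[- M%:R, M%:R[].

Lemma measurable_box d M : measurable (@box d M).
Proof.
rewrite (_ : box _ = \bigcap_(i in [set: 'I_d])
    ((fun x : 'rV[R]_d => x 0 i) @^-1` `[- M%:R, M%:R[)).
  apply: fin_bigcap_measurable => // i _.
  by rewrite -[X in measurable X]setTI; exact: measurable_coord.
by apply/seteqP; split => [x xab i _|x xab i]; exact: xab.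
Qed.

Lemma leb_box d M : leb (@box d M) = ((M%:R + M%:R) ^+ d)%:E.
Proof.
rewrite /leb /box lebesgue_rV_box; last by move=> i; rewrite ge0_cp.
by rewrite prodr_const card_ord opprK.
Qed.

Lemma bigcup_box d : \bigcup_M @box d M = setT.
Proof.
apply/seteqP; split => // x _.
exists (Num.bound (\sum_i `|x 0 i|)) => //= i.
have h : `|x 0 i| < (Num.bound (\sum_i `|x 0 i|))%:R.
  apply: le_lt_trans (archi_boundP _); last exact: sumr_ge0.
  by rewrite (bigD1 i)//= lerDl sumr_ge0.
by rewrite in_itv/=; move: h; rewrite ltr_norml => /andP[/ltW -> ->].
Qed.

Lemma leb_sigma_finite d : sigma_finite setT (@leb d).
Proof.
exists (@box d); first by rewrite bigcup_box.
by move=> M; split; [exact: measurable_box|rewrite leb_box ltry].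
Qed.

HB.instance Definition _ d :=
  @Measure_isSigmaFinite.Build _ _ _ (@leb d) (@leb_sigma_finite d).

Definition leb1 : {sigma_finite_measure set (measurableTypeR R) -> \bar R} :=
  @lebesgue_measure R.

Let measurable_cons d :
  measurable_fun [set: ('rV[R]_d * measurableTypeR R)%type] (@cons_rV R d).
Proof. exact: measurable_cons_rV. Qed.

(** Unfolded once, [leb d.+1] is the image of a product measure under [cons_rV]; with Tonelli this
    gives induction on the dimension for integrals. *)
Lemma ge0_integral_lebS d (f : 'rV[R]_d.+1 -> \bar R) :
  measurable_fun setT f -> (forall x, (0 <= f x)%E) ->
  (\int[@leb d.+1]_x f x = \int[@leb d]_x \int[leb1]_y f (cons_rV (x, y)))%E.
Proof.
move=> mf f0.
have mfc := measurableT_comp mf (@measurable_cons d).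
transitivity (\int[pushforward (@leb d \x leb1)%E (@cons_rV R d)]_x f x)%E => //.
have -> := @ge0_integral_pushforward _ _ _ _ _ _ (@measurable_cons d)
  (@leb d \x leb1)%E _ _ measurableT mf (fun x _ => f0 x).
rewrite preimage_setT.
exact: (@fubini_tonelli1 _ _ _ _ _ (@leb d) leb1 _ mfc (fun x => f0 _)).
Qed.

Lemma integral_lebS d (f : 'rV[R]_d.+1 -> \bar R) :
  (@leb d.+1).-integrable setT f ->
  (\int[@leb d.+1]_x f x = \int[@leb d]_x \int[leb1]_y f (cons_rV (x, y)))%E.
Proof.
move=> intf; have mf := measurable_int _ intf.
have mfc := measurableT_comp mf (@measurable_cons d).
have intfc : (@leb d \x leb1)%E.-integrable setT (f \o @cons_rV R d).
  apply/integrableP; split => //.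
  move/integrableP : intf => [_]; rewrite ge0_integral_lebS//.
    have -> // := @fubini_tonelli1 _ _ _ _ _ (@leb d) leb1
      (abse \o (f \o @cons_rV R d)) _ (fun x => abse_ge0 _).
    exact: measurableT_comp.
  exact: measurableT_comp.
transitivity (\int[pushforward (@leb d \x leb1)%E (@cons_rV R d)]_x f x)%E => //.
have -> := @integral_pushforward _ _ _ _ _ _ (@measurable_cons d)
  (@leb d \x leb1)%E setT _ mf _ measurableT.
  by rewrite preimage_setT; apply/esym; exact: (integral12_prod_meas1 intfc).
by rewrite preimage_setT.
Qed.

Lemma ge0_integral_leb0 (f : 'rV[R]_0 -> \bar R) :
  measurable_fun setT f -> (\int[@leb 0]_x f x = f 0%R)%E.
Proof. by move=> mf; rewrite integral_dirac// diracT mul1e. Qed.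

End lebesgue_rV_theory.

Lemma EFin_Rintegral d (T : measurableType d) (R : realType)
    (m : {measure set T -> \bar R}) D (f : T -> R) :
  measurable D -> m.-integrable D (EFin \o f) ->
  (\int[m]_(x in D) f x)%:E = (\int[m]_(x in D) (f x)%:E)%E.
Proof. by move=> mD intf; rewrite fineK// integrable_fin_num. Qed.

(** * Gaussian integrals *)

Section gauss1.
Variable R : realType.
Notation mu := (@lebesgue_measure R).

Lemma expR_sq_normal_pdf (a m x : R) : 0 < a ->
  expR (- (a * (x - m) ^+ 2)) =
  Num.sqrt (pi / a) * normal_pdf m (Num.sqrt (2 * a)^-1) x.
Proof.
move=> a0; have s0 : Num.sqrt (2 * a)^-1 != 0 :> R.
  by rewrite gt_eqF// sqrtr_gt0 invr_gt0 mulr_gt0.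
rewrite normal_pdfE// /normal_peak /normal_fun sqr_sqrtr; last first.
  by rewrite invr_ge0 mulr_ge0// ltW.
have -> : (2 * a)^-1 * pi *+ 2 = pi / a :> R.
  by field; rewrite gt_eqF.
rewrite mulVKf; last by rewrite gt_eqF// sqrtr_gt0 divr_gt0// pi_gt0.
by congr expR; field; rewrite gt_eqF.
Qed.

Lemma integral_expR_sq_shift (a m : R) : 0 < a ->
  (\int[mu]_x (expR (- (a * (x - m) ^+ 2)))%:E = (Num.sqrt (pi / a))%:E)%E.
Proof.
move=> a0; under eq_integral do rewrite expR_sq_normal_pdf// EFinM.
rewrite integralZl//; last exact: integrable_normal_pdf.
by rewrite integral_normal_pdf mule1.
Qed.

Lemma integral_expR_sq (a : R) : 0 < a ->
  (\int[mu]_x (expR (- (a * x ^+ 2)))%:E = (Num.sqrt (pi / a))%:E)%E.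
Proof.
by move=> /(integral_expR_sq_shift 0); under eq_integral do rewrite subr0.
Qed.

Lemma integrable_expR_sq (a : R) : 0 < a ->
  mu.-integrable setT (fun x => (expR (- (a * x ^+ 2)))%:E).
Proof.
move=> a0; under eq_fun do rewrite -[X in X ^+ 2]subr0 expR_sq_normal_pdf// EFinM.
exact/integrableZl/integrable_normal_pdf.
Qed.

Lemma ler_norm_expR (x : R) : `|x| <= expR (x ^+ 2 / 2).
Proof.
apply: le_trans (expR_ge1Dx _).
by have := sqr_ge0 (`|x| - 1); rewrite sqrrB1 real_normK ?num_real//; lra.
Qed.

(** The factor [|x|] costs half of the exponent: apply [ler_norm_expR] to [Num.sqrt a * x]. *)
Lemma norm_expR_le (a x : R) : 0 < a ->
  `|x| * expR (- (a * x ^+ 2)) <= (Num.sqrt a)^-1 * expR (- (a / 2 * x ^+ 2)).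
Proof.
move=> a0; have sa : 0 < Num.sqrt a by rewrite sqrtr_gt0.
rewrite ler_pdivlMl// mulrA -[X in X * `|x|](ger0_norm (ltW sa)) -normrM.
apply: le_trans (ler_wpM2r (expR_ge0 _) (ler_norm_expR _)) _.
rewrite -expRD ler_expR exprMn sqr_sqrtr; last exact: ltW.
by rewrite le_eqVlt; apply/orP; left; apply/eqP; field.
Qed.

Lemma integrable_bounded_expR_sq (a : R) (f : R -> R) C : 0 < a ->
  measurable_fun setT f -> (forall x, `|f x| <= C) ->
  mu.-integrable setT (fun x => (expR (- (a * x ^+ 2)) * f x)%:E).
Proof.
move=> a0 mf fC.
apply: (le_integrable measurableT _ _ (integrableZr measurableT C (integrable_expR_sq a0))).
  apply/measurable_EFinP/measurable_funM => //.
  by have /measurable_int/measurable_EFinP := integrable_expR_sq a0.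
move=> x _ /=; rewrite lee_fin normrM [leRHS]normrM ler_wpM2l//.
exact: le_trans (fC x) (ler_norm _).
Qed.

(** This function dominates the [w]-derivative of the oscillating integrand below, which allows
    differentiation under the integral sign. *)
Lemma integrable_norm_expR_sq (a : R) : 0 < a ->
  mu.-integrable setT (fun x => (`|x| * expR (- (a * x ^+ 2)))%:E).
Proof.
move=> a0; have a20 : 0 < a / 2 by rewrite divr_gt0.
apply: (le_integrable measurableT _ _
  (integrableZl measurableT (Num.sqrt a)^-1 (integrable_expR_sq a20))).
  apply/measurable_EFinP/measurable_funM; first exact: normr_measurable.
  by have /measurable_int/measurable_EFinP := integrable_expR_sq a0.
move=> x _ /=; rewrite lee_fin (ger0_norm (mulr_ge0 _ (expR_ge0 _)))//.
exact: le_trans (norm_expR_le _ a0) (ler_norm _).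
Qed.

Lemma m_cos : measurable_fun setT (@cos R).
Proof. by apply: continuous_measurable_fun; exact: continuous_cos. Qed.

Lemma m_sin : measurable_fun setT (@sin R).
Proof. by apply: continuous_measurable_fun; exact: continuous_sin. Qed.

Section fourier.
Variables (a phi : R).
Hypothesis a0 : 0 < a.

Let f w x := expR (- (a * x ^+ 2)) * cos (w * x + phi).
Let g w x := expR (- (a * x ^+ 2)) * sin (w * x + phi).

Let m_affine w : measurable_fun setT (fun x : R => w * x + phi).
Proof. by apply: measurable_funD => //; apply: measurable_funM. Qed.

Let intf w : mu.-integrable setT (EFin \o f w).
Proof.
apply: (@integrable_bounded_expR_sq _ _ 1) => //.
  exact: (measurableT_comp m_cos (m_affine w)).
by move=> x; rewrite ler_norml cos_geN1 cos_le1.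
Qed.

Let intxg w : mu.-integrable setT (fun x => (x * g w x)%:E).
Proof.
apply: (le_integrable measurableT _ _ (integrable_norm_expR_sq a0)).
  apply/measurable_EFinP/measurable_funM => //; apply: measurable_funM.
    by have /measurable_int/measurable_EFinP := integrable_expR_sq a0.
  exact: (measurableT_comp m_sin (m_affine w)).
move=> x _ /=; rewrite lee_fin /g mulrA normrM (normrM x) (normrM `|x|) normr_id.
by rewrite ler_piMr// ler_norml sin_geN1 sin_le1.
Qed.

Let F w := \int[mu]_x f w x.

(* Found by instance resolution in [dF]. *)
Let dcos (x w : R) : is_derive w 1 (f ^~ x) (- (x * g w x)).
Proof.
rewrite /f /g; apply: trigger_derive.
rewrite /GRing.scale/=; ring.
Qed.

(* [F' = - int x g], which integration by parts ([ibp]) turns into the equation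
   [F' = - w F / (2 a)]. *)
Let dF w : is_derive w (1 : R) (F : R -> R^o) (- \int[mu]_x (x * g w x)).
Proof.
have w1 : (`]w - 1, w + 1[%classic : set R) w by rewrite /= in_itv/= ltrBlDr !ltrDl ltr01.
have d1 x y : partial1of2 f x y = - (y * g x y).
  by rewrite partial1of2E; apply: derive_val.
have der x y : derivable (f ^~ y) x 1 by apply: ex_derive.
have ub x y : `|partial1of2 f x y| <= `|y| * expR (- (a * y ^+ 2)).
  rewrite d1 normrN /g mulrA normrM normrM (ger0_norm (expR_ge0 _)).
  by rewrite ler_piMr// ?mulr_ge0// ?expR_ge0// ler_norml sin_geN1 sin_le1.
have G0 y : 0 <= `|y| * expR (- (a * y ^+ 2)) by rewrite mulr_ge0// expR_ge0.
have H1 := @derivable_under_integral R _ _ mu f setT measurableT w (w - 1) (w + 1) w1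
  (fun x _ => intf x) (fun x y _ _ => der x y) _ G0 (integrable_norm_expR_sq a0)
  (fun x y _ _ => ub x y).
have H2 := @differentiation_under_integral R _ _ mu f setT measurableT w (w - 1) (w + 1) w1
  (fun x _ => intf x) (fun x y _ _ => der x y) _ G0 (integrable_norm_expR_sq a0)
  (fun x y _ _ => ub x y).
apply: DeriveDef => //; rewrite -derive1E H2.
under eq_Rintegral do rewrite d1 -mulN1r.
by rewrite (RintegralZl _ measurableT (intxg w)) mulN1r.
Qed.

Let dg w x : is_derive x (1 : R) (g w : R -> R^o) (- (2 * a) * (x * g w x) + w * f w x).
Proof.
rewrite /f /g; apply: trigger_derive.
rewrite /GRing.scale/=; ring.
Qed.

Let h w x := - (2 * a) * (x * g w x) + w * f w x.

Let inth w : mu.-integrable setT (EFin \o h w).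
Proof.
rewrite (_ : _ \o _ = (fun x => (- (2 * a))%:E * (x * g w x)%:E) \+
  (fun x => w%:E * (f w x)%:E))%E; last by apply/funext => x; rewrite /= -!EFinM.
by apply: integrableD => //; [exact/integrableZl/intxg|exact/integrableZl/intf].
Qed.

Let cvg_g w (u : R^nat) : (u = (fun n => n.+1%:R) \/ u = (fun n => - n.+1%:R)) ->
  g w (u n) @[n --> \oo] --> (0 : R).
Proof.
move=> hu; have un n : u n ^+ 2 = n.+1%:R ^+ 2 by case: hu => ->; rewrite ?sqrrN.
apply: norm_cvg0.
apply: (@squeeze_cvgr _ _ _ _ (cst 0) (fun n => (a * n.+1%:R)^-1)).
- apply: nearW => n; rewrite normr_ge0/= /g normrM un.
  apply: (@le_trans _ _ (expR (- (a * n.+1%:R ^+ 2)))).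
    rewrite (ger0_norm (expR_ge0 _)) ler_piMr ?expR_ge0//.
    by rewrite ler_norml sin_geN1 sin_le1.
  rewrite expRN lef_pV2 ?posrE ?expR_gt0 ?mulr_gt0//.
  apply: le_trans (expR_ge1Dx _); rewrite -[leLHS]add0r lerD//.
  by rewrite ler_pM2l// expr2 ler_peMl// ler1n.
- exact: cvg_cst.
- have -> : (fun n => (a * n.+1%:R)^-1) = (fun n => a^-1 * n.+1%:R^-1).
    by apply/funext => n; rewrite invfM.
  by rewrite -(mulr0 a^-1); apply: cvgM; [exact: cvg_cst|exact: cvg_harmonic].
Qed.

Let I n : set R := `[- n.+1%:R, n.+1%:R]%classic.

Let integral_h_itv w n :
  (\int[mu]_(x in I n) (h w x)%:E =
  (g w (n.+1%:R)%R)%:E - (g w (- n.+1%:R)%R)%:E)%E.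
Proof.
have cg x : {for x, continuous (g w)}.
  by apply: differentiable_continuous; apply/derivable1_diffP; apply: ex_derive.
apply: continuous_FTC2.
- by rewrite gtrN.
- apply: continuous_subspaceT => x.
  suff : derivable (h w) x 1 by move/derivable1_diffP/differentiable_continuous.
  by rewrite /h; apply: ex_derive.
- split.
  + by move=> x _; apply: ex_derive.
  + exact/cvg_at_right_filter/cg.
  + exact/cvg_at_left_filter/cg.
- by move=> x _; rewrite derive1E; apply: derive_val.
Qed.

(** Since [h w] is the derivative of [g w], its integral over [I n] is a difference of boundary
    values, which tends to 0 by [cvg_g]; dominated convergence passes to the whole line. *)
Let integral_h w : (\int[mu]_x (h w x)%:E = 0)%E.
Proof.
have c1 : (\int[mu]_x (((EFin \o h w) \_ (I n)) x) @[n --> \oo] -->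
    \int[mu]_x (h w x)%:E)%E.
  apply: (@dominated_cvg _ _ _ mu setT measurableT _ _ (abse \o (EFin \o h w))).
  - move=> n; apply/(measurable_restrictT _ _).1 => //.
      exact: measurable_itv.
    by apply: measurable_funTS; exact: measurable_int (inth w).
  - move=> x _; apply: cvg_near_cst.
    near=> n; rewrite patchE mem_set//= /I /= in_itv/= -ler_norml.
    apply: le_trans (ltW (archi_boundP (normr_ge0 x))) _.
    rewrite ler_nat ltnW// ltnS.
    by near: n; exact: nbhs_infty_ge.
  - by move=> x _ /=.
  - exact/integrable_abse/inth.
  - move=> n x _; rewrite patchE; case: ifPn => // _.
    by rewrite abse0 abse_ge0.
have c2 : (\int[mu]_x (((EFin \o h w) \_ (I n)) x) @[n --> \oo] --> 0)%E.
  under eq_cvg do rewrite -integral_mkcond integral_h_itv -EFinB.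
  apply: cvg_EFin; first exact: nearW.
  rewrite /comp/= -[X in _ --> X]subr0; apply: cvgB.
    exact: (@cvg_g _ (fun n => n.+1%:R) (or_introl erefl)).
  exact: (@cvg_g _ (fun n => - n.+1%:R) (or_intror erefl)).
by have := cvg_unique _ c1 c2; apply.
Unshelve. all: by end_near. Qed.

Let ibp w : 2 * a * \int[mu]_x (x * g w x) = w * F w.
Proof.
have := integral_h w; under eq_integral do rewrite EFinD !EFinM.
rewrite integralD//; [|exact/integrableZl/intxg|exact/integrableZl/intf].
rewrite !integralZl//; [|exact: intf|exact: intxg].
rewrite -(EFin_Rintegral measurableT (intxg w)) -(EFin_Rintegral measurableT (intf w)).
rewrite -!EFinM -EFinD => -[/eqP]; rewrite mulNr addrC subr_eq0 => /eqP.
by rewrite -/(F w) => ->.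
Qed.

(** By [dF] and [ibp], [F] solves a linear equation, and its product with [expR (v ^+ 2 / (4 * a))]
    has derivative 0. The phase [phi] is kept general because in dimension [d] the other coordinates
    enter through it. *)
Lemma Rintegral_expR_sq_cos w :
  F w = cos phi * Num.sqrt (pi / a) * expR (- (w ^+ 2 / (4 * a))).
Proof.
pose K v := F v * expR (v ^+ 2 / (4 * a)).
have dK v : is_derive v (1 : R) (K : R -> R^o) 0.
  have dFv := dF v.
  have dE : is_derive v (1 : R) (fun v => expR (v ^+ 2 / (4 * a)) : R^o)
      (v / (2 * a) * expR (v ^+ 2 / (4 * a))).
    by apply: trigger_derive; rewrite /GRing.scale/=; field; rewrite gt_eqF.
  apply: (is_derive_eq (is_deriveM dFv dE)); rewrite /GRing.scale/=.
  have -> : (\int[mu]_x (x * g v x))%R = v * F v / (2 * a).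
    by rewrite -ibp; field; rewrite gt_eqF.
  by field; rewrite gt_eqF.
have := is_derive_0_is_cst w 0 dK; rewrite /K expr0n/= mul0r expR0 mulr1.
have -> : F 0 = cos phi * Num.sqrt (pi / a).
  rewrite /F /f; under eq_Rintegral do rewrite mul0r add0r mulrC.
  rewrite RintegralZl//; last exact: integrable_expR_sq.
  by rewrite /Rintegral integral_expR_sq.
by move=> <-; rewrite -mulrA -expRD subrr expR0 mulr1.
Qed.

End fourier.
End gauss1.

(** * Gaussians in dimension d *)

Section gaussian.
Variables (R : realType).

Definition tl (d : nat) (w : 'rV[R]_d.+1) : 'rV[R]_d := \row_i w 0 (lift ord0 i).

Lemma dotmul_cons d (x : 'rV[R]_d) (y : R) (w : 'rV[R]_d.+1) :
  dotmul (cons_rV (x, y)) w = y * w 0 ord0 + dotmul x (tl w).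
Proof.
rewrite /dotmul big_ord_recl !mxE unlift_none/=; congr (_ + _).
by apply: eq_bigr => i _; rewrite !mxE liftK.
Qed.

Lemma tl_cons d (x : 'rV[R]_d) (y : R) : tl (cons_rV (x, y)) = x.
Proof. by apply/rowP => i; rewrite !mxE liftK. Qed.

Lemma cons_sub d (x : 'rV[R]_d) (y : R) (w : 'rV[R]_d.+1) :
  cons_rV (x, y) - w = cons_rV (x - tl w, y - w 0 ord0).
Proof.
by apply/rowP => i; rewrite !mxE; case: unliftP => [j ->|->]; rewrite /= ?mxE.
Qed.

Lemma cons0 d (x : 'rV[R]_d) (y : R) : cons_rV (x, y) 0 ord0 = y.
Proof. by rewrite mxE unlift_none. Qed.

Lemma dotmulC d (x y : 'rV[R]_d) : dotmul x y = dotmul y x.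
Proof. by apply: eq_bigr => i _; rewrite mulrC. Qed.

Lemma dotmulBl d (x y z : 'rV[R]_d) : dotmul (x - y) z = dotmul x z - dotmul y z.
Proof. by rewrite /dotmul -sumrB; apply: eq_bigr => i _; rewrite !mxE mulrBl. Qed.

Lemma dotmulDl d (x y z : 'rV[R]_d) : dotmul (x + y) z = dotmul x z + dotmul y z.
Proof. by rewrite /dotmul -big_split; apply: eq_bigr => i _; rewrite !mxE mulrDl. Qed.

Lemma dotmulZl d (a : R) (y z : 'rV[R]_d) : dotmul (a *: y) z = a * dotmul y z.
Proof. by rewrite /dotmul mulr_sumr; apply: eq_bigr => i _; rewrite !mxE mulrA. Qed.

Lemma dotmulZr d (a : R) (y z : 'rV[R]_d) : dotmul y (a *: z) = a * dotmul y z.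
Proof. by rewrite dotmulC dotmulZl dotmulC. Qed.

Lemma dotmul_ge0 d (x : 'rV[R]_d) : 0 <= dotmul x x.
Proof. by apply: sumr_ge0 => i _; rewrite -expr2 sqr_ge0. Qed.

Section measurability.
Context dT (T : measurableType dT) (d : nat).
Implicit Types f g : T -> 'rV[R]_d.

Lemma measurable_rV_coord f i : measurable_fun setT f ->
  measurable_fun setT (fun t => f t 0 i).
Proof. by move=> mf; exact: (measurableT_comp (measurable_coord i) mf). Qed.

Lemma measurable_rVB f g : measurable_fun setT f -> measurable_fun setT g ->
  measurable_fun setT (fun t => f t - g t).
Proof.
move=> mf mg; apply: measurable_fun_rV => i; under eq_fun do rewrite !mxE.
by apply: measurable_funB; exact: measurable_rV_coord.
Qed.

Lemma measurable_dotmul f g : measurable_fun setT f -> measurable_fun setT g ->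
  measurable_fun setT (fun t => dotmul (f t) (g t)).
Proof.
move=> mf mg; apply: measurable_sum => i.
by apply: measurable_funM; exact: measurable_rV_coord.
Qed.

End measurability.

Lemma measurable_expR_dot dT (T : measurableType dT) d (a : R)
    (f : T -> 'rV[R]_d) : measurable_fun setT f ->
  measurable_fun setT (fun t => expR (- (a * dotmul (f t) (f t)))).
Proof.
move=> mf; apply: measurableT_comp => //; apply: measurableT_comp => //.
by apply: measurable_funM => //; exact: measurable_dotmul.
Qed.

Lemma integral_expR_dot d (a : R) (w : 'rV[R]_d) : 0 < a ->
  (\int[@leb R d]_x (expR (- (a * dotmul (x - w) (x - w))))%:E =
   (Num.sqrt (pi / a) ^+ d)%:E)%E.
Proof.
move=> a0; have mE k (v : 'rV[R]_k) : measurable_fun setT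
    (fun x : 'rV[R]_k => (expR (- (a * dotmul (x - v) (x - v))))%:E).
  by apply/measurable_EFinP/measurable_expR_dot/measurable_rVB.
elim: d w => [|d IHd] w.
  by rewrite ge0_integral_leb0// /dotmul big_ord0 mulr0 oppr0 expR0.
rewrite ge0_integral_lebS; [|exact: mE|by move=> x; rewrite lee_fin expR_ge0].
transitivity (\int[leb (d:=d)]_x ((Num.sqrt (pi / a))%:E *
   (expR (- (a * dotmul (x - tl w) (x - tl w))))%:E))%E.
  apply: eq_integral => x _.
  under eq_integral => y _.
    rewrite cons_sub dotmul_cons cons0 tl_cons -expr2 mulrDr opprD expRD EFinM.
    over.
  rewrite ge0_integralZr//=; first by congr (_ * _)%E; exact: integral_expR_sq_shift.
  apply/measurable_EFinP; apply: measurableT_comp => //.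
  apply: measurableT_comp => //; apply: measurable_funM => //.
  by apply: measurable_funX => //; apply: measurable_funB.
rewrite ge0_integralZl; [|by []|exact: mE|by move=> x _; rewrite lee_fin expR_ge0|].
  by rewrite IHd -EFinM -exprS.
by rewrite lee_fin sqrtr_ge0.
Qed.

Lemma integrable_expR_dot d (a : R) : 0 < a ->
  (@leb R d).-integrable setT (fun x => (expR (- (a * dotmul x x)))%:E).
Proof.
move=> a0; apply/integrableP; split.
  exact/measurable_EFinP/measurable_expR_dot.
have := integral_expR_dot (0 : 'rV[R]_d) a0; under eq_integral do rewrite subr0.
under [X in _ -> (X < _)%E]eq_integral do rewrite gee0_abs ?lee_fin ?expR_ge0//.
by move=> ->; rewrite ltry.
Qed.

Lemma integrable_bounded_expR_dot d (a : R) (f : 'rV[R]_d -> R) C : 0 < a ->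
  measurable_fun setT f -> (forall x, `|f x| <= C) ->
  (@leb R d).-integrable setT (fun x => (expR (- (a * dotmul x x)) * f x)%:E).
Proof.
move=> a0 mf fC.
apply: (le_integrable measurableT _ _
  (integrableZr measurableT C (integrable_expR_dot d a0))).
  by apply/measurable_EFinP/measurable_funM => //; exact: measurable_expR_dot.
move=> x _ /=; rewrite lee_fin normrM [leRHS]normrM ler_wpM2l//.
exact: le_trans (fC x) (ler_norm _).
Qed.

Lemma m_cos_dotmul dT (T : measurableType dT) d (f g : T -> 'rV[R]_d) phi :
  measurable_fun setT f -> measurable_fun setT g ->
  measurable_fun setT (fun t => cos (dotmul (f t) (g t) + phi)).
Proof.
move=> mf mg; apply: (measurableT_comp (@m_cos R)).
by apply: measurable_funD => //; exact: measurable_dotmul.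
Qed.

Lemma integrable_expR_cos_dot d (a phi : R) (w : 'rV[R]_d) : 0 < a ->
  (@leb R d).-integrable setT
    (fun x => (expR (- (a * dotmul x x)) * cos (dotmul w x + phi))%:E).
Proof.
move=> a0; apply: (@integrable_bounded_expR_dot _ _ _ 1) => //.
  exact: m_cos_dotmul.
by move=> x; rewrite ler_norml cos_geN1 cos_le1.
Qed.

(** Induction on the dimension: the first coordinate is integrated with the scalar product of the
    remaining ones absorbed into the phase. *)
Lemma integral_expR_cos_dot d (a phi : R) (w : 'rV[R]_d) : 0 < a ->
  (\int[@leb R d]_x (expR (- (a * dotmul x x)) * cos (dotmul w x + phi))%:E =
   (cos phi * Num.sqrt (pi / a) ^+ d * expR (- (dotmul w w / (4 * a))))%:E)%E.
Proof.
move=> a0; elim: d phi w => [|d IHd] phi w.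
  rewrite ge0_integral_leb0//; last first.
    exact: (measurable_int _ (integrable_expR_cos_dot _ _ a0)).
  by rewrite /dotmul !big_ord0 mulr0 mul0r oppr0 expR0 add0r mul1r !mulr1.
rewrite integral_lebS//; last exact: integrable_expR_cos_dot.
pose c := Num.sqrt (pi / a) * expR (- ((w 0 ord0) ^+ 2 / (4 * a))).
transitivity (\int[leb (d:=d)]_x (c%:E *
   (expR (- (a * dotmul x x)) * cos (dotmul (tl w) x + phi))%:E))%E.
  apply: eq_integral => x _.
  under eq_integral => y _.
    rewrite dotmul_cons cons0 tl_cons -expr2 mulrDr opprD expRD.
    rewrite dotmulC dotmul_cons dotmulC [y * _]mulrC -addrA -mulrA mulrCA EFinM.
    over.
  have iy : (leb1 R).-integrable setT (fun y =>
      (expR (- (a * y ^+ 2)) * cos (w 0 ord0 * y + (dotmul (tl w) x + phi)))%:E).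
    apply: (@integrable_bounded_expR_sq R a _ 1) => //.
      apply: (measurableT_comp (@m_cos R)).
      by apply: measurable_funD => //; apply: measurable_funM.
    by move=> y; rewrite ler_norml cos_geN1 cos_le1.
  rewrite integralZl//= -(EFin_Rintegral measurableT iy) Rintegral_expR_sq_cos//.
  by rewrite -!EFinM; congr EFin; rewrite /c; ring.
rewrite integralZl//; last exact: integrable_expR_cos_dot.
rewrite IHd -EFinM; congr EFin.
have -> : dotmul w w = (w 0 ord0) ^+ 2 + dotmul (tl w) (tl w).
  rewrite /dotmul big_ord_recl expr2; congr (_ + _).
  by apply: eq_bigr => i _; rewrite !mxE.
by rewrite [(_ + dotmul _ _) / _]mulrDl opprD expRD exprS /c; ring.
Qed.

(* The density of the centred normal law of covariance [t I]; [gmult t] is its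
   Fourier transform, for the kernel [e^(i pi <x, xi>)]. *)
Definition gk d (t : R) (x : 'rV[R]_d) : R :=
  (Num.sqrt (2 * pi * t))^-1 ^+ d * expR (- ((2 * t)^-1 * dotmul x x)).

Lemma gk_ge0 d t (x : 'rV[R]_d) : 0 <= gk t x.
Proof. by rewrite mulr_ge0 ?expR_ge0// exprn_ge0// invr_ge0 sqrtr_ge0. Qed.

Lemma dotmulN d (x : 'rV[R]_d) : dotmul (- x) (- x) = dotmul x x.
Proof. by apply: eq_bigr => i _; rewrite !mxE mulrNN. Qed.

Lemma gkN d t (x : 'rV[R]_d) : gk t (- x) = gk t x.
Proof. by rewrite /gk dotmulN. Qed.

Lemma gkBC d t (x y : 'rV[R]_d) : gk t (x - y) = gk t (y - x).
Proof. by rewrite -gkN opprB. Qed.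

Lemma gk_le d t (x : 'rV[R]_d) : 0 < t -> gk t x <= (Num.sqrt (2 * pi * t))^-1 ^+ d.
Proof.
move=> t0; rewrite ler_piMr// ?exprn_ge0 ?invr_ge0 ?sqrtr_ge0//.
rewrite -[leRHS]expR0 ler_expR oppr_le0 mulr_ge0 ?dotmul_ge0// invr_ge0.
by rewrite mulr_ge0// ltW.
Qed.

Lemma measurable_gk dT (T : measurableType dT) d t (f : T -> 'rV[R]_d) :
  measurable_fun setT f -> measurable_fun setT (fun x => gk t (f x)).
Proof. by move=> mf; apply: measurable_funM => //; exact: measurable_expR_dot. Qed.

Lemma integral_gk d t (w : 'rV[R]_d) : 0 < t ->
  (\int[@leb R d]_x (gk t (x - w))%:E = 1)%E.
Proof.
move=> t0; under eq_integral do rewrite EFinM.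
rewrite ge0_integralZl; [|by []| | |]; last 3 first.
- exact/measurable_EFinP/measurable_expR_dot/measurable_rVB.
- by move=> x _; rewrite lee_fin expR_ge0.
- by rewrite lee_fin exprn_ge0// invr_ge0 sqrtr_ge0.
rewrite integral_expR_dot ?invr_gt0 ?mulr_gt0//.
rewrite -EFinM invrK (_ : pi * _ = 2 * pi * t) ?exprVn ?mulVf//; last by ring.
by rewrite expf_neq0// gt_eqF// sqrtr_gt0 !mulr_gt0// pi_gt0.
Qed.

Lemma integral_gkr d t (w : 'rV[R]_d) : 0 < t ->
  (\int[@leb R d]_x (gk t (w - x))%:E = 1)%E.
Proof. by move=> t0; under eq_integral do rewrite gkBC; exact: integral_gk. Qed.

Definition gmult d (t : R) (x : 'rV[R]_d) : R := expR (- (pi ^+ 2 / 2 * t * dotmul x x)).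

(** Gaussian Fourier inversion. For the kernel [e^(i pi <x, xi>)] the inversion formula carries
    [2^-d]; this is the source of the factor [2 ^+ d] in the Plancherel identities. *)
Lemma integral_gmult_cos d t (w : 'rV[R]_d) : 0 < t ->
  (\int[@leb R d]_x (gmult t x * cos (pi * dotmul w x))%:E = (2 ^+ d * gk t w)%:E)%E.
Proof.
move=> t0; have a0 : 0 < pi ^+ 2 / 2 * t :> R by rewrite !mulr_gt0// ?exprn_gt0// pi_gt0.
have := integral_expR_cos_dot 0 (pi *: w) a0; rewrite cos0 mul1r.
under eq_integral do rewrite dotmulZl addr0.
move=> -> {a0}; congr EFin; rewrite /gk dotmulZl dotmulZr.
have := @pi_gt0 R; move: (@pi R) => P p0.
rewrite [RHS]mulrA -[in RHS]exprMn; congr (_ ^+ _ * expR _); last first.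
  by field; rewrite !gt_eqF.
apply: (@mulIf _ (Num.sqrt (2 * P * t))).
  by rewrite gt_eqF// sqrtr_gt0 !mulr_gt0.
rewrite mulfVK ?gt_eqF ?sqrtr_gt0 ?mulr_gt0// -sqrtrM; last first.
  by rewrite divr_ge0 ?mulr_ge0 ?exprn_ge0 ?ltW.
have -> : P / (P ^+ 2 / 2 * t) * (2 * P * t) = 2 ^+ 2 :> R.
  by field; rewrite !gt_eqF.
by rewrite sqrtr_sqr ger0_norm.
Qed.

(** Completing the square in [x] splits off a factor free of [x]; integrating the other one gives
    the semigroup law [integral_gk_gk]. *)
Lemma gk_mul d (s t : R) (u v x : 'rV[R]_d) : 0 < s -> 0 < t ->
  gk s (x - u) * gk t (x - v) =
  gk (s + t) (u - v) * gk (s * t / (s + t)) (x - (s + t)^-1 *: (t *: u + s *: v)).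
Proof.
move=> s0 t0; have st0 : 0 < s + t by rewrite addr_gt0.
rewrite /gk; have := @pi_gt0 R; move: (@pi R) => P p0.
rewrite mulrACA [RHS]mulrACA -!exprMn -!expRD -!invfM -!sqrtrM; last 2 first.
- by rewrite !mulr_ge0// ltW.
- by rewrite !mulr_ge0// ltW.
congr (_ * expR _).
  by congr ((Num.sqrt _)^-1 ^+ _); field; rewrite gt_eqF.
rewrite /dotmul -!opprD !mulr_sumr -!big_split/=; congr (- _).
by apply: eq_bigr => i _; rewrite !mxE; field; rewrite !gt_eqF.
Qed.

Lemma integral_gk_gk d (s t : R) (u v : 'rV[R]_d) : 0 < s -> 0 < t ->
  (\int[@leb R d]_x (gk s (x - u) * gk t (x - v))%:E = (gk (s + t) (u - v))%:E)%E.
Proof.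
move=> s0 t0; under eq_integral do rewrite gk_mul// EFinM.
rewrite ge0_integralZl; [|by []| | |]; last 3 first.
- exact/measurable_EFinP/measurable_gk/measurable_rVB.
- by move=> x _; rewrite lee_fin gk_ge0.
- by rewrite lee_fin gk_ge0.
by rewrite integral_gk ?mule1// divr_gt0 ?mulr_gt0 ?addr_gt0.
Qed.

(* Two centres at distance [O(sqrt t)] are interchangeable up to a constant,
   once the variance is doubled. *)
Lemma gk_compare d (t A : R) (w z z' : 'rV[R]_d) : 0 < t ->
  dotmul (z - z') (z - z') <= 2 * A * t ->
  gk t (w - z) <= Num.sqrt 2 ^+ d * expR A * gk (2 * t) (w - z').
Proof.
move=> t0 zz; rewrite /gk.
have -> : Num.sqrt (2 * pi * (2 * t)) = Num.sqrt 2 * Num.sqrt (2 * pi * t) :> R.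
  by rewrite -sqrtrM//; congr Num.sqrt; ring.
have s2 : Num.sqrt 2 != 0 :> R by rewrite gt_eqF// sqrtr_gt0.
set q := (Num.sqrt (2 * pi * t))^-1 ^+ d.
have -> : (Num.sqrt 2 * Num.sqrt (2 * pi * t))^-1 ^+ d = (Num.sqrt 2 ^+ d)^-1 * q.
  by rewrite invfM exprMn exprVn.
have -> : Num.sqrt 2 ^+ d * expR A * ((Num.sqrt 2 ^+ d)^-1 * q *
    expR (- ((2 * (2 * t))^-1 * dotmul (w - z') (w - z')))) =
  q * (expR A * expR (- ((2 * (2 * t))^-1 * dotmul (w - z') (w - z')))).
  have : Num.sqrt 2 ^+ d != 0 :> R by rewrite expf_neq0.
  by move: (Num.sqrt 2 ^+ d) => b b0; field.
rewrite ler_wpM2l//; first by rewrite exprn_ge0// invr_ge0 sqrtr_ge0.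
rewrite -expRD ler_expR.
have h : dotmul (w - z') (w - z') <= 2 * dotmul (w - z) (w - z) + 2 * dotmul (z - z') (z - z').
  rewrite /dotmul !mulr_sumr -big_split/=; apply: ler_sum => i _; rewrite !mxE.
  by have := sqr_ge0 (w 0 i - z 0 i - (z 0 i - z' 0 i)); nra.
have : (4 * t)^-1 * dotmul (w - z') (w - z') <=
  (4 * t)^-1 * (2 * dotmul (w - z) (w - z) + 2 * (2 * A * t)).
  rewrite ler_pM2l ?invr_gt0 ?mulr_gt0//; apply: le_trans h _.
  by rewrite lerD2l ler_pM2l.
have -> : (4 * t)^-1 * (2 * dotmul (w - z) (w - z) + 2 * (2 * A * t)) =
  (2 * t)^-1 * dotmul (w - z) (w - z) + A.
  by field; rewrite gt_eqF.
have -> : (2 * (2 * t))^-1 = (4 * t)^-1 :> R by congr (_^-1); ring.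
lra.
Qed.

Lemma norm_sqr_le_dotmul d (x : 'rV[R]_d) : `|x| ^+ 2 <= dotmul x x.
Proof.
suff : `|x| <= Num.sqrt (dotmul x x).
  by rewrite -(ler_pXn2r (_ : (0 < 2)%N)) ?nnegrE ?sqrtr_ge0// sqr_sqrtr ?dotmul_ge0.
rewrite -[`|x|]/(mx_norm x).
have [->|/mx_norm_neq0[[i j] ->]] := eqVneq (mx_norm x) 0; first exact: sqrtr_ge0.
rewrite /= ord1.
rewrite -sqrtr_sqr ler_wsqrtr// /dotmul (bigD1 j)//= expr2 lerDl.
by apply: sumr_ge0 => k _; rewrite -expr2 sqr_ge0.
Qed.

(** The factor [|x|] is paid for by doubling the variance and leaves the order [Num.sqrt t] of a
    first absolute moment; this drives the convergence of Gaussian averages of Lipschitz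
    functions. *)
Lemma norm_gk_le d (t : R) (x : 'rV[R]_d) : 0 < t ->
  `|x| * gk t x <= Num.sqrt (2 * t) * Num.sqrt 2 ^+ d * gk (2 * t) x.
Proof.
move=> t0; rewrite /gk.
have -> : Num.sqrt (2 * pi * (2 * t)) = Num.sqrt 2 * Num.sqrt (2 * pi * t) :> R.
  by rewrite -sqrtrM//; congr Num.sqrt; ring.
have t20 : 0 < 2 * t by rewrite mulr_gt0.
have st : 0 < Num.sqrt (2 * t) by rewrite sqrtr_gt0.
have s2 : Num.sqrt 2 != 0 :> R by rewrite gt_eqF// sqrtr_gt0.
set q := (Num.sqrt (2 * pi * t))^-1 ^+ d.
have -> : (Num.sqrt 2 * Num.sqrt (2 * pi * t))^-1 ^+ d = (Num.sqrt 2 ^+ d)^-1 * q.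
  by rewrite invfM exprMn exprVn.
have -> : Num.sqrt (2 * t) * Num.sqrt 2 ^+ d *
    ((Num.sqrt 2 ^+ d)^-1 * q * expR (- ((2 * (2 * t))^-1 * dotmul x x))) =
  q * (Num.sqrt (2 * t) * expR (- ((2 * (2 * t))^-1 * dotmul x x))).
  have : Num.sqrt 2 ^+ d != 0 :> R by rewrite expf_neq0.
  by move: (Num.sqrt 2 ^+ d) => b b0; field.
rewrite mulrCA ler_wpM2l//; first by rewrite exprn_ge0// invr_ge0 sqrtr_ge0.
apply: (@le_trans _ _ (Num.sqrt (2 * t) * expR ((2 * (2 * t))^-1 * dotmul x x) *
    expR (- ((2 * t)^-1 * dotmul x x)))); last first.
  rewrite -mulrA ler_pM2l// -expRD ler_expR le_eqVlt; apply/orP; left.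
  by apply/eqP; field; rewrite gt_eqF.
rewrite ler_wpM2r ?expR_ge0// -ler_pdivrMl//.
have := ler_norm_expR ((Num.sqrt (2 * t))^-1 * `|x|).
rewrite ger0_norm; last by rewrite mulr_ge0// invr_ge0 ltW.
move=> /le_trans; apply; rewrite ler_expR exprMn exprVn sqr_sqrtr; last exact: ltW.
have -> : (2 * t)^-1 * `|x| ^+ 2 / 2 = (2 * (2 * t))^-1 * `|x| ^+ 2.
  by field; rewrite gt_eqF.
rewrite ler_pM2l ?invr_gt0 ?mulr_gt0//.
exact: norm_sqr_le_dotmul.
Qed.

End gaussian.

Lemma integrableRZl dT (T : measurableType dT) (R : realType)
    (m : {measure set T -> \bar R}) D (f : T -> R) k : measurable D ->
  m.-integrable D (EFin \o f) -> m.-integrable D (EFin \o (fun x => k * f x)).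
Proof.
by move=> mD intf; rewrite /comp; under eq_fun do rewrite EFinM; exact: integrableZl.
Qed.

(** * Plancherel identity for Gaussian regularizations *)

Section energy.
Context (R : realType) (d : nat) dT (T : measurableType dT)
  (m : {sigma_finite_measure set T -> \bar R}) (X : T -> 'rV[R]_d).
Hypotheses (mfin : (m setT < +oo)%E) (mX : measurable_fun setT X).
Let V := 'rV[R]_d.

Lemma integrable_bounded (f : T -> R) C : measurable_fun setT f ->
  (forall x, `|f x| <= C) -> m.-integrable setT (EFin \o f).
Proof.
move=> mf fC; apply: measurable_bounded_integrable => //.
exists C; split; first exact: num_real.
by move=> y Cy x _; exact: le_trans (fC x) (ltW Cy).
Qed.

(* For the law of [X] under [m]: [hk t] is its convolution with [gk t], [fc] and
   [fs] are the real and imaginary parts of its Fourier transform. *)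
Definition hk (t : R) (x : V) : R := \int[m]_o gk t (x - X o).
Definition fc (xi : V) : R := \int[m]_o cos (pi * dotmul (X o) xi).
Definition fs (xi : V) : R := \int[m]_o sin (pi * dotmul (X o) xi).
Definition fpow (xi : V) : R := fc xi ^+ 2 + fs xi ^+ 2.

Lemma fpow_ge0 xi : 0 <= fpow xi.
Proof. by rewrite addr_ge0// sqr_ge0. Qed.

Let m_gk t x : measurable_fun setT (fun o => gk t (x - X o)).
Proof. by apply: measurable_gk; apply: measurable_rVB. Qed.

Lemma gk_norm_le t (x : V) : 0 < t -> `|gk t x| <= (Num.sqrt (2 * pi * t))^-1 ^+ d.
Proof. by move=> t0; rewrite ger0_norm ?gk_ge0// gk_le. Qed.

Let i_gk t x : 0 < t -> m.-integrable setT (fun o => (gk t (x - X o))%:E).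
Proof. by move=> t0; apply: integrable_bounded (m_gk t x) (fun o => gk_norm_le _ t0). Qed.

Lemma hkE t x : 0 < t -> (hk t x)%:E = (\int[m]_o (gk t (x - X o))%:E)%E.
Proof. by move=> t0; exact: (EFin_Rintegral measurableT (i_gk x t0)). Qed.

Lemma hk_ge0 t x : 0 <= hk t x.
Proof. by apply: Rintegral_ge0 => o _; exact: gk_ge0. Qed.

Let m_gk2 t : measurable_fun setT (fun z : V * T => gk t (z.1 - X z.2)).
Proof.
by apply: measurable_gk; apply: measurable_rVB => //; exact: (measurableT_comp mX).
Qed.

Lemma measurable_hk t : 0 < t -> measurable_fun setT (hk t).
Proof.
move=> t0; apply/measurable_EFinP; rewrite (_ : _ \o _ =
  (fun x => \int[m]_o (gk t (x - X o))%:E)%E); last first.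
  by apply/funext => x; rewrite /= hkE.
apply: (measurable_fun_fubini_tonelli_F (fun z : V * T => (gk t (z.1 - X z.2))%:E)).
  by apply/measurable_EFinP; exact: m_gk2.
by move=> z; rewrite lee_fin gk_ge0.
Qed.

Lemma integral_hk t : 0 < t -> (\int[@leb R d]_x (hk t x)%:E = m setT)%E.
Proof.
move=> t0; under eq_integral do rewrite hkE//.
rewrite (@fubini_tonelli _ _ _ _ _ (@leb R d) m
  (fun z : V * T => (gk t (z.1 - X z.2))%:E)).
- rewrite -[RHS]mul1e -integral_cst//.
  by apply: eq_integral => o _ /=; exact: integral_gk.
- by apply/measurable_EFinP; exact: m_gk2.
- by move=> z; rewrite lee_fin gk_ge0.
Qed.

(** When [x] is integrated first, the semigroup law leaves the Gaussian energy of the law of [X]. *)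
Lemma integral_hk_hk s t : 0 < s -> 0 < t ->
  (\int[@leb R d]_x (hk s x * hk t x)%:E =
   \int[m]_o \int[m]_o' (gk (s + t) (X o - X o'))%:E)%E.
Proof.
move=> s0 t0.
transitivity (\int[@leb R d]_x \int[m]_o (gk s (x - X o) * hk t x)%:E)%E.
  apply: eq_integral => x _; under [RHS]eq_integral do rewrite EFinM.
  rewrite ge0_integralZr ?lee_fin ?hk_ge0//; last 2 first.
  - by apply/measurable_EFinP; exact: m_gk.
  - by move=> o _; rewrite lee_fin gk_ge0.
  by rewrite EFinM hkE.
rewrite (@fubini_tonelli _ _ _ _ _ (@leb R d) m
  (fun z : V * T => (gk s (z.1 - X z.2) * hk t z.1)%:E)); last 2 first.
- apply/measurable_EFinP/measurable_funM; first exact: m_gk2.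
  exact: (measurableT_comp (measurable_hk t0)).
- by move=> z; rewrite lee_fin mulr_ge0 ?gk_ge0 ?hk_ge0.
apply: eq_integral => o _ /=.
transitivity (\int[@leb R d]_x \int[m]_o' (gk s (x - X o) * gk t (x - X o'))%:E)%E.
  apply: eq_integral => x _; under [RHS]eq_integral do rewrite EFinM.
  rewrite ge0_integralZl ?lee_fin ?gk_ge0//; last 2 first.
  - by apply/measurable_EFinP; exact: m_gk.
  - by move=> o' _; rewrite lee_fin gk_ge0.
  by rewrite EFinM hkE.
rewrite (@fubini_tonelli _ _ _ _ _ (@leb R d) m
  (fun z : V * T => (gk s (z.1 - X o) * gk t (z.1 - X z.2))%:E)); last 2 first.
- apply/measurable_EFinP/measurable_funM; last exact: m_gk2.
  by apply: measurable_gk; apply: measurable_rVB.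
- by move=> z; rewrite lee_fin mulr_ge0 ?gk_ge0.
by apply: eq_integral => o' _ /=; exact: integral_gk_gk.
Qed.

Lemma gmult_ge0 t (xi : V) : 0 <= gmult t xi.
Proof. exact: expR_ge0. Qed.

Lemma gmultD s t (xi : V) : gmult (s + t) xi = gmult s xi * gmult t xi.
Proof. by rewrite /gmult -expRD; congr expR; ring. Qed.

Lemma measurable_gmult t : measurable_fun setT (@gmult R d t).
Proof. exact: measurable_expR_dot. Qed.

Lemma integrable_gmult t (f : V -> R) C : 0 < t -> measurable_fun setT f ->
  (forall x, `|f x| <= C) ->
  (@leb R d).-integrable setT (fun xi => (gmult t xi * f xi)%:E).
Proof.
move=> t0 mf fC; apply: (integrable_bounded_expR_dot _ mf fC).
by rewrite !mulr_gt0// ?exprn_gt0// pi_gt0.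
Qed.

Lemma integral_gmult_swap t (f : T * V -> R) C : 0 < t ->
  measurable_fun setT f -> (forall z, `|f z| <= C) ->
  (\int[m]_o \int[@leb R d]_xi (gmult t xi * f (o, xi))%:E =
   \int[@leb R d]_xi (gmult t xi * \int[m]_o f (o, xi))%:E)%E.
Proof.
move=> t0 mf fC.
have mg : measurable_fun setT (fun z : T * V => gmult t z.2 * f z).
  by apply: measurable_funM => //; exact: (measurableT_comp (measurable_gmult t)).
rewrite (@Fubini _ _ _ _ _ m (@leb R d) (fun z : T * V => (gmult t z.2 * f z)%:E)).
  apply: eq_integral => xi _ /=; under eq_integral do rewrite EFinM.
  have ifx : m.-integrable setT (fun o => (f (o, xi))%:E).
    by apply: integrable_bounded (fun o => fC _); exact: (measurableT_comp mf).
  by rewrite integralZl// EFinM -(EFin_Rintegral measurableT ifx).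
apply/integrable21ltyP; first exact/measurable_EFinP.
apply: (@le_lt_trans _ _ (\int[@leb R d]_xi ((gmult t xi * C)%:E * m setT))%E).
  apply: ge0_le_integral => //=.
  - by move=> xi _; apply: integral_ge0.
  - apply: (measurable_fun_fubini_tonelli_G
      (fun z : T * V => `|(gmult t z.2 * f z)%:E|%E)) => //.
    by apply: measurableT_comp => //; exact/measurable_EFinP.
  - apply: emeasurable_funM => //; apply/measurable_EFinP/measurable_funM => //.
    exact: measurable_gmult.
  - move=> xi _; rewrite -integral_cst//; apply: ge0_le_integral => //=.
    + apply/measurable_EFinP; apply: measurableT_comp => //.
      by apply: measurable_funM => //; exact: (measurableT_comp mf).
    + by move=> o _; rewrite lee_fin normrM ger0_norm ?gmult_ge0// ler_wpM2l ?gmult_ge0.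
have mE : m setT = (fine (m setT))%:E.
  by rewrite fineK// ge0_fin_numE.
rewrite mE; under eq_integral do rewrite -EFinM -mulrA.
have iC := @integrable_gmult t (fun=> C * fine (m setT)) _ t0 (measurable_cst _)
  (fun=> lexx _).
by rewrite -(EFin_Rintegral measurableT iC) ltry.
Qed.

Let m_dot : measurable_fun setT (fun z : T * V => pi * dotmul (X z.1) z.2).
Proof.
apply: measurable_funM => //; apply: measurable_dotmul => //.
exact: (measurableT_comp mX).
Qed.

Let m_cos2 : measurable_fun setT (fun z : T * V => cos (pi * dotmul (X z.1) z.2)).
Proof. exact: (measurableT_comp (@m_cos R) m_dot). Qed.

Let m_sin2 : measurable_fun setT (fun z : T * V => sin (pi * dotmul (X z.1) z.2)).
Proof. exact: (measurableT_comp (@m_sin R) m_dot). Qed.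

Let m_dot1 xi : measurable_fun setT (fun o => pi * dotmul (X o) xi).
Proof. by apply: measurable_funM => //; exact: measurable_dotmul. Qed.

Lemma normr_cos_le1 (x : R) : `|cos x| <= 1.
Proof. by rewrite ler_norml cos_geN1 cos_le1. Qed.

Lemma normr_sin_le1 (x : R) : `|sin x| <= 1.
Proof. by rewrite ler_norml sin_geN1 sin_le1. Qed.

Let i_cos xi : m.-integrable setT (fun o => (cos (pi * dotmul (X o) xi))%:E).
Proof.
apply: (@integrable_bounded _ 1) (fun o => normr_cos_le1 _).
exact: (measurableT_comp (@m_cos R) (m_dot1 xi)).
Qed.

Let i_sin xi : m.-integrable setT (fun o => (sin (pi * dotmul (X o) xi))%:E).
Proof.
apply: (@integrable_bounded _ 1) (fun o => normr_sin_le1 _).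
exact: (measurableT_comp (@m_sin R) (m_dot1 xi)).
Qed.

Let mE : m setT = (fine (m setT))%:E.
Proof. by rewrite fineK// ge0_fin_numE. Qed.

Lemma measurable_Rintegral_bounded dU (U : measurableType dU) (f : T * U -> R) C :
  measurable_fun setT f -> (forall z, `|f z| <= C) ->
  measurable_fun setT (fun u => \int[m]_o f (o, u)).
Proof.
move=> mf fC.
have if1 u : m.-integrable setT (fun o => (f (o, u))%:E).
  by apply: integrable_bounded (fun o => fC _); exact: (measurableT_comp mf).
(* Adding [C] makes the integrand nonnegative, so that Tonelli yields measurability; the constant is
   then subtracted. *)
rewrite (_ : (fun u => _) = (fun u => fine (\int[m]_o (f (o, u) + C)%:E) - C * fine (m setT))); last first.
  apply/funext => u.
  have iC : m.-integrable setT (fun _ => C%:E).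
    exact: (@integrable_bounded (cst C) `|C|).
  under eq_integral do rewrite EFinD.
  rewrite integralD// -(EFin_Rintegral measurableT (if1 u)).
  by rewrite integral_cst//= mE -EFinM -EFinD /= addrK.
apply: measurable_funB => //; apply: measurableT_comp => //.
apply: (measurable_fun_fubini_tonelli_G (fun z => (f z + C)%:E)).
  by apply/measurable_EFinP/measurable_funD.
move=> z; rewrite lee_fin -lerBlDr sub0r.
by have := fC z; rewrite ler_norml => /andP[].
Qed.

Lemma normr_Rintegral_le (f : T -> R) C : measurable_fun setT f ->
  (forall x, `|f x| <= C) -> `|\int[m]_o f o| <= C * fine (m setT).
Proof.
move=> mf fC; have intf := integrable_bounded mf fC.
apply: le_trans (le_normr_Rintegral measurableT intf) _.
rewrite -lee_fin EFinM -mE (EFin_Rintegral measurableT); last exact: integrable_norm.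
rewrite -integral_cst//; apply: ge0_le_integral => //=.
- exact/measurable_EFinP/measurableT_comp.
- by move=> o _; rewrite lee_fin.
Qed.

Lemma measurable_fc : measurable_fun setT fc.
Proof. exact: measurable_Rintegral_bounded m_cos2 (fun z => normr_cos_le1 _). Qed.

Lemma measurable_fs : measurable_fun setT fs.
Proof. exact: measurable_Rintegral_bounded m_sin2 (fun z => normr_sin_le1 _). Qed.

Lemma measurable_fpow : measurable_fun setT fpow.
Proof.
apply: measurable_funD; apply: measurable_funX; first exact: measurable_fc.
exact: measurable_fs.
Qed.

Lemma fc_le xi : `|fc xi| <= fine (m setT).
Proof.
rewrite -[leRHS]mul1r; apply: normr_Rintegral_le (fun o => normr_cos_le1 _).
exact: (measurableT_comp (@m_cos R) (m_dot1 xi)).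
Qed.

Lemma fs_le xi : `|fs xi| <= fine (m setT).
Proof.
rewrite -[leRHS]mul1r; apply: normr_Rintegral_le (fun o => normr_sin_le1 _).
exact: (measurableT_comp (@m_sin R) (m_dot1 xi)).
Qed.

Lemma fpow_le xi : fpow xi <= 2 * fine (m setT) ^+ 2.
Proof.
have sq (x : R) : `|x| <= fine (m setT) -> x ^+ 2 <= fine (m setT) ^+ 2.
  by move=> h; rewrite -(real_normK (num_real x)) ler_pXn2r ?nnegrE// (le_trans _ h).
by have := sq _ (fc_le xi); have := sq _ (fs_le xi); rewrite /fpow; lra.
Qed.

(** Gaussian inversion is inserted under the integral over [o]; the addition formula for the cosine
    separates [w] from [X o]. *)
Let fourier_step t w : 0 < t ->
  ((2 ^+ d)%:E * \int[m]_o (gk t (w - X o))%:E =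
   \int[@leb R d]_xi (gmult t xi * (cos (pi * dotmul w xi) * fc xi +
     sin (pi * dotmul w xi) * fs xi))%:E)%E.
Proof.
move=> t0.
pose f (z : T * V) := cos (pi * dotmul (w - X z.1) z.2).
have mf : measurable_fun setT f.
  apply: (measurableT_comp (@m_cos R)); apply: measurable_funM => //.
  apply: measurable_dotmul => //; apply: measurable_rVB => //.
  exact: (measurableT_comp mX).
transitivity (\int[@leb R d]_xi (gmult t xi * \int[m]_o f (o, xi))%:E)%E; last first.
  apply: eq_integral => xi _; congr (_ * _)%:E; rewrite /f/=.
  under eq_Rintegral do rewrite dotmulBl mulrBr cosB.
  rewrite RintegralD//; last 2 first.
  - exact: integrableRZl (i_cos xi).
  - exact: integrableRZl (i_sin xi).
  by rewrite !RintegralZl//; [exact: i_sin|exact: i_cos].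
rewrite -(integral_gmult_swap t0 mf (fun z => normr_cos_le1 _)).
under [RHS]eq_integral do rewrite /f/= integral_gmult_cos// EFinM.
rewrite ge0_integralZl; [by []|by []| | |].
- by apply/measurable_EFinP; exact: m_gk.
- by move=> o _; rewrite lee_fin gk_ge0.
- by rewrite lee_fin exprn_ge0.
Qed.

(** Integrating [fourier_step] over [w = X o] turns the products with [fc] and [fs] into squares. *)
Lemma integral_gk_fpow t : 0 < t ->
  ((2 ^+ d)%:E * \int[m]_o \int[m]_o' (gk t (X o - X o'))%:E =
   \int[@leb R d]_xi (gmult t xi * fpow xi)%:E)%E.
Proof.
move=> t0.
pose f (z : T * V) := cos (pi * dotmul (X z.1) z.2) * fc z.2 +
   sin (pi * dotmul (X z.1) z.2) * fs z.2.
have mf : measurable_fun setT f.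
  by apply: measurable_funD; apply: measurable_funM => //;
    [exact: (measurableT_comp measurable_fc)|exact: (measurableT_comp measurable_fs)].
have fC z : `|f z| <= fine (m setT) + fine (m setT).
  rewrite (le_trans (ler_normD _ _))// !normrM lerD//.
    by rewrite -[leRHS]mul1r ler_pM// ?normr_cos_le1// fc_le.
  by rewrite -[leRHS]mul1r ler_pM// ?normr_sin_le1// fs_le.
rewrite -ge0_integralZl; last 4 first.
- by [].
- apply: (measurable_fun_fubini_tonelli_F (fun z : T * T => (gk t (X z.1 - X z.2))%:E)).
    by apply/measurable_EFinP/measurable_gk/measurable_rVB;
      exact: (measurableT_comp mX).
  by move=> z; rewrite lee_fin gk_ge0.
- by move=> o _; apply: integral_ge0 => o' _; rewrite lee_fin gk_ge0.
- by rewrite lee_fin exprn_ge0.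
under eq_integral do rewrite fourier_step//.
rewrite (integral_gmult_swap t0 mf fC).
apply: eq_integral => xi _; congr (_ * _)%:E; rewrite /f/=.
under eq_Rintegral do rewrite mulrC [X in _ + X]mulrC.
rewrite RintegralD//; last 2 first.
- exact: integrableRZl (i_cos xi).
- exact: integrableRZl (i_sin xi).
by rewrite !RintegralZl//; [exact: i_sin|exact: i_cos].
Qed.

Section combination.
Variables (I : finType) (c t : I -> R).
Hypothesis t0 : forall i, 0 < t i.

Definition hks (x : V) : R := \sum_i c i * hk (t i) x.
Definition gmults (xi : V) : R := \sum_i c i * gmult (t i) xi.

Lemma measurable_hks : measurable_fun setT hks.
Proof. by apply: measurable_sum => i; apply: measurable_funM => //; exact: measurable_hk. Qed.

Lemma measurable_gmults : measurable_fun setT gmults.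
Proof. by apply: measurable_sum => i; apply: measurable_funM => //; exact: measurable_gmult. Qed.

Let ig i j :
  (@leb R d).-integrable setT (fun xi => (gmult (t i + t j) xi * fpow xi)%:E).
Proof.
apply: (@integrable_gmult _ _ (2 * fine (m setT) ^+ 2)); first exact: addr_gt0.
  exact: measurable_fpow.
by move=> x; rewrite ger0_norm ?fpow_ge0// fpow_le.
Qed.

Let integrable_hk_hk i j :
  (@leb R d).-integrable setT (fun x => (hk (t i) x * hk (t j) x)%:E).
Proof.
have h0 x : 0 <= hk (t i) x * hk (t j) x by rewrite mulr_ge0 ?hk_ge0.
apply/integrableP; split.
  by apply/measurable_EFinP/measurable_funM; exact: measurable_hk.
under eq_integral do rewrite gee0_abs ?lee_fin//.
rewrite integral_hk_hk//.
(* Finiteness is read on the Fourier side, where the Gaussian weight is integrable and [fpow] is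
   bounded. *)
have : ((2 ^+ d)%:E * \int[m]_o \int[m]_o' (gk (t i + t j) (X o - X o'))%:E < +oo)%E.
  rewrite integral_gk_fpow ?addr_gt0//.
  by rewrite -(EFin_Rintegral measurableT (ig i j)) ltry.
have P0 : (0 < (2 ^+ d : R)%:E)%E by rewrite lte_fin exprn_gt0.
case: (integral _ _ _) => [r _|+|_]; [by rewrite ltry| |by []].
by rewrite gt0_muley// ltxx.
Qed.

(** Both squares expand into double sums over [I]. The terms match by [integral_gk_fpow], because
    [gmultD] splits the multiplier of [t i + t j] into a product. *)
Lemma integral_hks_sqr :
  ((2 ^+ d)%:E * \int[@leb R d]_x (hks x ^+ 2)%:E =
   \int[@leb R d]_xi (gmults xi ^+ 2 * fpow xi)%:E)%E.
Proof.
pose a i j := \int[@leb R d]_x (hk (t i) x * hk (t j) x).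
pose b i j := \int[@leb R d]_xi (gmult (t i + t j) xi * fpow xi).
have aE i j : (\int[@leb R d]_x (hk (t i) x * hk (t j) x)%:E = (a i j)%:E)%E.
  by rewrite -(EFin_Rintegral measurableT (integrable_hk_hk i j)).
have bE i j : (\int[@leb R d]_xi (gmult (t i + t j) xi * fpow xi)%:E = (b i j)%:E)%E.
  by rewrite -(EFin_Rintegral measurableT (ig i j)).
have ab i j : 2 ^+ d * a i j = b i j.
  apply: EFin_inj; rewrite EFinM -aE -bE integral_hk_hk// integral_gk_fpow//.
  exact: addr_gt0.
have double_sum (F : I -> I -> V -> R) (A : I -> I -> R) :
    (forall i j, (@leb R d).-integrable setT (EFin \o F i j)) ->
    (forall i j, (\int[@leb R d]_x (F i j x)%:E = (A i j)%:E)%E) ->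
    (\int[@leb R d]_x (\sum_i \sum_j (c i * c j) * F i j x)%:E =
     (\sum_i \sum_j (c i * c j) * A i j)%:E)%E.
  move=> intF FA.
  transitivity (\int[@leb R d]_x (\sum_i \sum_j (c i * c j)%:E * (F i j x)%:E)%E)%E.
    apply: eq_integral => x _; rewrite -sumEFin; apply: eq_bigr => i _.
    by rewrite -sumEFin.
  rewrite integral_sum//=; last first.
    by move=> i; apply: integrable_sum => // j _; apply: integrableZl => //; exact: intF.
  rewrite -sumEFin; apply: eq_bigr => i _; rewrite integral_sum//=; last first.
    by move=> j; apply: integrableZl => //; exact: intF.
  rewrite -sumEFin; apply: eq_bigr => j _.
  by rewrite integralZl//; [rewrite FA|exact: intF].
transitivity ((2 ^+ d * (\sum_i \sum_j (c i * c j) * a i j))%:E)%E.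
  rewrite EFinM -(double_sum _ _ integrable_hk_hk aE); congr (_ * _)%E.
  apply: eq_integral => x _; rewrite /hks expr2 mulr_suml; congr EFin.
  apply: eq_bigr => i _; rewrite mulr_sumr.
  by apply: eq_bigr => j _; rewrite mulrACA.
transitivity ((\sum_i \sum_j (c i * c j) * b i j)%:E)%E.
  congr EFin; rewrite mulr_sumr; apply: eq_bigr => i _; rewrite mulr_sumr.
  by apply: eq_bigr => j _; rewrite -ab mulrCA.
rewrite -(double_sum _ _ ig bE).
apply: eq_integral => x _; rewrite /gmults expr2 mulr_suml mulr_suml; congr EFin.
apply: eq_bigr => i _; rewrite mulr_sumr mulr_suml.
by apply: eq_bigr => j _; rewrite gmultD; ring.
Qed.

End combination.
End energy.

(** Cubes are indexed by integer vectors, whereas measures are additive along [nat]: [pickle]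
    transports the index. The default [i0] is never read, since every code that is summed comes from
    an element of [K]. *)
Lemma measure_countable_bigcup dT (T : measurableType dT) (R : realType)
    (m : {measure set T -> \bar R}) (I : countType) (K : set I) (F : I -> set T)
    (i0 : I) : (forall i, measurable (F i)) -> trivIset setT F ->
  m (\bigcup_(i in K) F i) =
  (\sum_(j <oo | j \in pickle @` K) m (F (odflt i0 (@pickle_inv I j))))%E.
Proof.
move=> mF tF; set G := fun j => F (odflt i0 (@pickle_inv I j)).
have -> : \bigcup_(i in K) F i = \bigcup_(j in pickle @` K) G j.
  by rewrite bigcup_image; apply: eq_bigcupr => i _; rewrite /G pickleK_inv.
rewrite measure_bigcup//; first by move=> j _; exact: mF.
move=> j j' /= [i Ki <-] [i' Ki' <-]; rewrite /G !pickleK_inv/= => ii'.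
by congr pickle; exact: tF.
Qed.

Lemma measurable_countable_bigcup dT (T : measurableType dT) (I : countType)
    (K : set I) (F : I -> set T) : (forall i, measurable (F i)) ->
  measurable (\bigcup_(i in K) F i).
Proof.
move=> mF; rewrite bigcup_mkcond; apply: countable_bigcupT_measurable => [|i].
  exact: countableP.
by case: ifP.
Qed.

(** * Dyadic cubes *)

Section dyadic.
Variables (R : realType) (d : nat).
Let V := 'rV[R]_d.
Notation cube := (@dyadic_cube R d).

Definition cell (n : nat) (x : V) : 'rV[int]_d := \row_i Num.floor (x 0 i * 2 ^+ n).

Lemma cubeP n k x : cube n k x <-> cell n x = k.
Proof.
have e (l : 'rV[int]_d) i :
    x 0 i \in `[(l 0 i)%:~R / 2 ^+ n, ((l 0 i)%:~R + 1) / 2 ^+ n[ =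
    (Num.floor (x 0 i * 2 ^+ n) == l 0 i).
  rewrite in_itv/= ler_pdivrMr ?exprn_gt0// ltr_pdivlMr ?exprn_gt0//.
  by rewrite floor_eq intrD.
split=> [h|<- i]; last by rewrite e mxE.
by apply/rowP => i; rewrite mxE; apply/eqP; rewrite -e; exact: h.
Qed.

Lemma cube_cell n x : cube n (cell n x) x.
Proof. exact/cubeP. Qed.

Lemma measurable_cube n k : measurable (cube n k).
Proof.
rewrite (_ : cube n k = \bigcap_(i in [set: 'I_d]) ((fun x : V => x 0 i) @^-1`
    `[(k 0 i)%:~R / 2 ^+ n, ((k 0 i)%:~R + 1) / 2 ^+ n[)).
  apply: fin_bigcap_measurable => // i _.
  by rewrite -[X in measurable X]setTI; exact: measurable_coord.
by apply/seteqP; split => [x xab i _|x xab i]; exact: xab.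
Qed.

Lemma trivIset_cube n : trivIset setT (cube n).
Proof. by move=> i j _ _ [x [/cubeP <- /cubeP <-]]. Qed.

(** A cube contains its lower corner, hence determines its index; sums over the set of cubes thus
    become sums over indices. *)
Lemma cube_inj n : injective (cube n).
Proof.
move=> k l kl; pose x : V := \row_i ((k 0 i)%:~R / 2 ^+ n).
have kx : cube n k x.
  move=> i; rewrite mxE in_itv/= lexx ltr_pM2r ?invr_gt0 ?exprn_gt0//.
  by rewrite ltrDl ltr01.
by have := kx; rewrite kl => /cubeP <-; apply/esym/cubeP.
Qed.

Lemma leb_cube n k : leb (cube n k) = ((2 ^- n) ^+ d)%:E.
Proof.
rewrite /leb/cube lebesgue_rV_box; last first.
  by move=> i; rewrite ler_pM2r ?invr_gt0 ?exprn_gt0// lerDl.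
under eq_bigr do rewrite -mulrBl addrAC subrr add0r mul1r.
by rewrite prodr_const card_ord.
Qed.

Lemma cell_dotmul n (z z' : V) : cell n z = cell n z' ->
  dotmul (z - z') (z - z') <= d%:R * (4 ^- n).
Proof.
move=> zz'; rewrite /dotmul.
apply: (@le_trans _ _ (\sum_(i < d) 4 ^- n)); last first.
  by rewrite sumr_const card_ord mulr_natl.
apply: ler_sum => i _; rewrite !mxE -expr2.
have -> : 4 ^- n = (2 ^- n) ^+ 2 :> R.
  by rewrite exprVn -exprM mulnC exprM expr2 -natrM.
rewrite -(real_normK (num_real _)) ler_pXn2r// ?nnegrE ?invr_ge0 ?exprn_ge0//.
have /(_ i) := cube_cell n z; have /(_ i) := cube_cell n z'; rewrite -zz'.
rewrite !in_itv/= mulrDl mul1r => /andP[h1 h2] /andP[h3 h4].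
by rewrite ler_norml; apply/andP; split; lra.
Qed.

(** Its indicator is symmetric in the two points, so it can be read as the cube of either one when
    integrals are exchanged. *)
Definition diag (n : nat) : set (V * V) := [set z | cell n z.1 = cell n z.2].

Lemma measurable_diag n : measurable (diag n).
Proof.
rewrite (_ : diag n = \bigcup_k (cube n k `*` cube n k)).
  by apply: measurable_countable_bigcup => k; apply: measurableX; exact: measurable_cube.
apply/seteqP; split => [[z z']/= zz'|[z z'] [k _ []]/= /cubeP zk /cubeP z'k].
  by exists (cell n z) => //; split; apply/cubeP.
by rewrite /diag/= zk z'k.
Qed.

(* [gk t (w - z)] is at most a constant times the mean of [gk (2 * t) (w - z')] over
   the points [z'] of the cube of [z]; exchanging the integrals in [z] and [z']
   leaves the mass of a cube. *)
Lemma integral_gk_le (g : {sigma_finite_measure set V -> \bar R}) n (a t A : R) (w : V) :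
  0 <= a -> 0 < t -> d%:R * 4 ^- n <= 2 * A * t ->
  (forall k, (g (cube n k) <= a%:E)%E) ->
  (\int[g]_z (gk t (w - z))%:E <= (Num.sqrt 2 ^+ d * expR A * (2 ^+ n) ^+ d * a)%:E)%E.
Proof.
move=> a0 t0 At ga; set C := Num.sqrt 2 ^+ d * expR A.
have C0 : 0 <= C by rewrite mulr_ge0 ?expR_ge0// exprn_ge0// sqrtr_ge0.
have t20 : 0 < 2 * t by rewrite mulr_gt0.
have m1 : measurable_fun setT (fun z : V * V => \1_(diag n) z : R).
  by apply: measurable_indic; exact: measurable_diag.
have m2 : measurable_fun setT (fun z : V * V => gk (2 * t) (w - z.2)).
  by apply: measurable_gk; apply: measurable_rVB.
have indE z z' : \1_(diag n) (z, z') = \1_(cube n (cell n z)) z' :> R.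
  rewrite !indicE (_ : ((z, z') \in diag n) = (z' \in cube n (cell n z)))//.
  apply/idP/idP; rewrite !inE; last by move=> /cubeP/esym.
  by rewrite /diag/= => ->; exact: cube_cell.
have indE' z z' : \1_(diag n) (z, z') = \1_(cube n (cell n z')) z :> R.
  rewrite !indicE (_ : ((z, z') \in diag n) = (z \in cube n (cell n z')))//.
  apply/idP/idP; rewrite !inE; last by move=> /cubeP.
  by rewrite /diag/= => <-; exact: cube_cell.
have h0 z : (0 <= (\1_(diag n) z * gk (2 * t) (w - z.2))%:E)%E.
  by rewrite lee_fin mulr_ge0// gk_ge0.
have m3 z : measurable_fun setT (fun z' => \1_(diag n) (z, z') * gk (2 * t) (w - z')).
  apply/measurable_funM; first exact: (measurableT_comp m1).
  by apply: measurable_gk; apply: measurable_rVB.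
have step1 z : (((2 ^- n) ^+ d * gk t (w - z))%:E <=
    C%:E * \int[@leb R d]_z' (\1_(diag n) (z, z') * gk (2 * t) (w - z'))%:E)%E.
  rewrite -ge0_integralZl; last 4 first.
  - by [].
  - by apply/measurable_EFinP; exact: m3.
  - by move=> z' _; rewrite lee_fin mulr_ge0// gk_ge0.
  - by rewrite lee_fin.
  rewrite EFinM -(leb_cube n (cell n z)) muleC.
  rewrite -(setIT (cube n _)) -integral_indic//; last exact: measurable_cube.
  rewrite -ge0_integralZl; last 4 first.
  - by [].
  - by apply/measurable_EFinP; apply: measurable_indic; exact: measurable_cube.
  - by [].
  - by rewrite lee_fin gk_ge0.
  apply: ge0_le_integral => //.
  - by move=> z' _; rewrite lee_fin mulr_ge0// gk_ge0.
  - apply/measurable_EFinP/measurable_funM => //.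
    by apply: measurable_indic; exact: measurable_cube.
  - by apply/measurable_EFinP/measurable_funM.
  - move=> z' _; rewrite lee_fin indE indicE.
    have [|] := boolP (z' \in _); last by rewrite mulr0 mul0r mulr0.
    rewrite inE => /cubeP/esym/cell_dotmul zz'.
    by rewrite mul1r mulr1; apply: gk_compare => //; exact: le_trans zz' At.
have mF : measurable_fun setT (fun z => \int[@leb R d]_z'
    (\1_(diag n) (z, z') * gk (2 * t) (w - z'))%:E)%E.
  apply: (measurable_fun_fubini_tonelli_F (fun z : V * V =>
    (\1_(diag n) z * gk (2 * t) (w - z.2))%:E)) => //.
  exact/measurable_EFinP/measurable_funM.
have F0 z : (0 <= \int[@leb R d]_z' (\1_(diag n) (z, z') * gk (2 * t) (w - z'))%:E)%E.
  by apply: integral_ge0 => z' _; rewrite lee_fin mulr_ge0// gk_ge0.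
have q0 : 0 <= (2 ^- n) ^+ d :> R by rewrite exprn_ge0// invr_ge0 exprn_ge0.
have mgk : measurable_fun setT (fun z : V => (gk t (w - z))%:E).
  by apply/measurable_EFinP/measurable_gk/measurable_rVB.
have step2 : (((2 ^- n) ^+ d)%:E * \int[g]_z (gk t (w - z))%:E <= (C * a)%:E)%E.
  rewrite -ge0_integralZl; last 4 first.
  - by [].
  - exact: mgk.
  - by move=> z _; rewrite lee_fin gk_ge0.
  - by rewrite lee_fin.
  apply: (@le_trans _ _ (\int[g]_z (C%:E * \int[@leb R d]_z'
      (\1_(diag n) (z, z') * gk (2 * t) (w - z'))%:E))%E).
    apply: ge0_le_integral => //.
    - by move=> z _; rewrite -EFinM lee_fin mulr_ge0// gk_ge0.
    - exact: measurable_funeM.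
    - exact: measurable_funeM.
    - by move=> z _; rewrite -EFinM; exact: step1.
  rewrite ge0_integralZl; [|by []|exact: mF|by move=> z _|by rewrite lee_fin].
  rewrite [leRHS]EFinM lee_wpmul2l ?lee_fin//.
  rewrite (@fubini_tonelli _ _ _ _ _ g (@leb R d) (fun z : V * V =>
    (\1_(diag n) z * gk (2 * t) (w - z.2))%:E))//; last first.
    exact/measurable_EFinP/measurable_funM.
  apply: (@le_trans _ _ (\int[@leb R d]_z' (a%:E * (gk (2 * t) (w - z'))%:E))%E).
    apply: ge0_le_integral => //.
    - by move=> z' _; apply: integral_ge0 => z _; rewrite lee_fin mulr_ge0// gk_ge0.
    - apply: (measurable_fun_fubini_tonelli_G (fun z : V * V =>
        (\1_(diag n) z * gk (2 * t) (w - z.2))%:E)) => //.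
      exact/measurable_EFinP/measurable_funM.
    - by apply: measurable_funeM; apply/measurable_EFinP/measurable_gk/measurable_rVB.
    - move=> z' _ /=; under eq_integral do rewrite EFinM indE'.
      rewrite ge0_integralZr; last 4 first.
      - by [].
      - by apply/measurable_EFinP; apply: measurable_indic; exact: measurable_cube.
      - by move=> z _; rewrite lee_fin.
      - by rewrite lee_fin gk_ge0.
      rewrite integral_indic//; last exact: measurable_cube.
      by rewrite setIT; apply: lee_wpmul2r; [rewrite lee_fin gk_ge0|exact: ga].
  rewrite ge0_integralZl; last 4 first.
  - by [].
  - by apply/measurable_EFinP/measurable_gk/measurable_rVB.
  - by move=> z' _; rewrite lee_fin gk_ge0.
  - by rewrite lee_fin.
  by rewrite integral_gkr// mule1.
have -> : (\int[g]_z (gk t (w - z))%:E = ((2 ^+ n) ^+ d)%:E *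
    (((2 ^- n) ^+ d)%:E * \int[g]_z (gk t (w - z))%:E))%E.
  by rewrite muleA -EFinM exprVn divff ?mul1e.
by rewrite [C * _]mulrC -mulrA [leRHS]EFinM lee_wpmul2l// lee_fin.
Qed.

End dyadic.

Section Lq_sum_bound.
Variables (R : realType) (d : nat) (mu : probability 'rV[R]_d R).

(** A cube of mass [r > b] satisfies [b^(p-1) r <= r^p]; the heavy cubes are disjoint, and their
    terms form a part of the L^p sum. *)
Lemma Lq_sum_chebyshev (p b : R) n : 1 < p -> 0 <= b ->
  ((b `^ (p - 1))%:E * mu (\bigcup_(k in [set k | b%:E < mu (dyadic_cube n k)]%E)
     dyadic_cube n k) <= Lq_sum p mu n)%E.
Proof.
move=> p1 b0; set K := [set k | _].
rewrite (measure_countable_bigcup _ _ (0 : 'rV[int]_d) (measurable_cube n) (@trivIset_cube R d n)).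
pose F j := @dyadic_cube R d n (odflt 0 (pickle_inv j)).
rewrite -nneseriesZl ?lee_fin ?powR_ge0//.
pose S : \bar R := (\sum_(j <oo | j \in pickle @` K) mu (F j) `^ p)%E.
apply: (@le_trans _ _ S).
  apply: lee_nneseries => [j _|j]; first by rewrite mule_ge0 ?lee_fin ?powR_ge0.
  rewrite inE => -[k Kk <-]; rewrite /F pickleK_inv/=.
  have muE : mu (dyadic_cube n k) = (fine (mu (dyadic_cube n k)))%:E.
    by rewrite fineK//; apply: fin_num_measure; exact: measurable_cube.
  have : (0 <= mu (dyadic_cube n k))%E by [].
  move: Kk; rewrite /K/= muE; move: (fine _) => r; rewrite lee_fin lte_fin => br r0.
  rewrite -EFinM lee_fin.
  rewrite -(mulr_powRB1 r0 (lt_trans ltr01 p1)) mulrC ler_wpM2l//.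
  by apply: ge0_ler_powR; rewrite ?nnegrE ?subr_ge0// ltW.
rewrite /S nneseries_esum; last by move=> j _; exact: poweR_ge0.
rewrite (_ : [set x | x \in pickle @` K] = pickle @` K); last first.
  by apply/seteqP; split => j /=; rewrite inE.
rewrite esum_image; last by move=> i j _ _; exact: (pcan_inj pickleK_inv).
rewrite /Lq_sum /dyadic_cubes esum_image; last by move=> i j _ _; exact: cube_inj.
under eq_esum do rewrite /F pickleK_inv/=.
rewrite esum_mkcond; apply: le_esum => k _; case: ifP => // _; exact: poweR_ge0.
Qed.

End Lq_sum_bound.

(** * Interpolation between Lebesgue norms *)

Section interpolation.
Context (R : realType) dT (T : measurableType dT) (m : {measure set T -> \bar R}).
Variables (h : T -> R) (p : R).
Hypothesis mh : measurable_fun setT h.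

Let m_pow q : measurable_fun setT (fun x => (`|h x| `^ q)%:E).
Proof.
apply/measurable_EFinP; apply: (measurableT_comp (measurable_powR q)).
exact: measurableT_comp.
Qed.

(** Cut at the height [L]: below it [|h|^p <= L^(p-1) |h|], above it [|h|^p <= L^(p-2) h^2] because
    [p - 2 <= 0]. The height is left free, to be optimized for each piece. *)
Lemma integral_powR_le_12 (L b1 b2 : R) : 1 < p -> p <= 2 -> 0 < L ->
  (\int[m]_x `|h x|%:E <= b1%:E)%E -> (\int[m]_x (h x ^+ 2)%:E <= b2%:E)%E ->
  (\int[m]_x (`|h x| `^ p)%:E <= (L `^ (p - 1) * b1 + L `^ (p - 2) * b2)%:E)%E.
Proof.
move=> p1 p2 L0 hb1 hb2.
have mh1 : measurable_fun setT (fun x => (L `^ (p - 1))%:E * `|h x|%:E)%E.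
  by apply: measurable_funeM; apply/measurable_EFinP; exact: measurableT_comp.
have mh2 : measurable_fun setT (fun x => (L `^ (p - 2))%:E * (h x ^+ 2)%:E)%E.
  by apply: measurable_funeM; apply/measurable_EFinP; exact: measurable_funX.
apply: (@le_trans _ _ (\int[m]_x ((L `^ (p - 1))%:E * `|h x|%:E +
    (L `^ (p - 2))%:E * (h x ^+ 2)%:E))%E).
  apply: ge0_le_integral => //.
  - exact: emeasurable_funD.
  move=> x _; rewrite -!EFinM -EFinD lee_fin.
  have [hL|Lh] := leP `|h x| L.
    rewrite -[leLHS]addr0 lerD//; last by rewrite mulr_ge0 ?powR_ge0 ?sqr_ge0.
    rewrite -(@mulr_powRB1 _ `|h x| p)// ?(lt_trans ltr01)// mulrC ler_wpM2r//.
    by apply: ge0_ler_powR; rewrite ?nnegrE ?subr_ge0// ltW.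
  have h0 : 0 < `|h x| := lt_trans L0 Lh.
  rewrite -[leLHS]add0r lerD//; first by rewrite mulr_ge0 ?powR_ge0.
  have -> : `|h x| `^ p = `|h x| `^ (p - 2) * h x ^+ 2.
    rewrite -(real_normK (num_real (h x))) -powR_mulrn// -powRD ?subrK//.
    by rewrite (gt_eqF h0) implybT.
  rewrite ler_wpM2r ?sqr_ge0//.
  have -> : p - 2 = - (2 - p) by rewrite opprB.
  rewrite !powRN lef_pV2 ?posrE ?powR_gt0//.
  by apply: ge0_ler_powR; rewrite ?nnegrE ?subr_ge0// ltW.
rewrite ge0_integralD//; last 2 first.
- by move=> x _; rewrite mule_ge0 ?lee_fin ?powR_ge0.
- by move=> x _; rewrite mule_ge0 ?lee_fin ?powR_ge0 ?sqr_ge0.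
rewrite EFinD !EFinM; apply: leeD.
  rewrite ge0_integralZl; last 4 first.
  - by [].
  - by apply/measurable_EFinP; exact: measurableT_comp.
  - by move=> x _; rewrite lee_fin.
  - by rewrite lee_fin powR_ge0.
  by apply: lee_wpmul2l; rewrite ?lee_fin ?powR_ge0.
rewrite ge0_integralZl; last 4 first.
- by [].
- by apply/measurable_EFinP; exact: measurable_funX.
- by move=> x _; rewrite lee_fin sqr_ge0.
- by rewrite lee_fin powR_ge0.
by apply: lee_wpmul2l; rewrite ?lee_fin ?powR_ge0.
Qed.

Lemma integral_powR_le_2y (M b2 : R) : 2 <= p ->
  (forall x, `|h x| <= M) -> (\int[m]_x (h x ^+ 2)%:E <= b2%:E)%E ->
  (\int[m]_x (`|h x| `^ p)%:E <= (M `^ (p - 2) * b2)%:E)%E.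
Proof.
move=> p2 hM hb2.
apply: (@le_trans _ _ (\int[m]_x ((M `^ (p - 2))%:E * (h x ^+ 2)%:E))%E).
  apply: ge0_le_integral => //.
  - by apply: measurable_funeM; apply/measurable_EFinP; exact: measurable_funX.
  move=> x _; rewrite -EFinM lee_fin.
  have [->|h0] := eqVneq (h x) 0.
    rewrite normr0 powR0 ?mulr_ge0 ?powR_ge0 ?sqr_ge0// gt_eqF//.
    exact: lt_le_trans p2.
  have -> : `|h x| `^ p = `|h x| `^ (p - 2) * h x ^+ 2.
    rewrite -(real_normK (num_real (h x))) -powR_mulrn// -powRD ?subrK//.
    by rewrite normr_eq0 h0 implybT.
  rewrite ler_wpM2r ?sqr_ge0//.
  by apply: ge0_ler_powR; rewrite ?nnegrE ?subr_ge0// (le_trans _ (hM x)).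
rewrite ge0_integralZl; last 4 first.
- by [].
- by apply/measurable_EFinP; exact: measurable_funX.
- by move=> x _; rewrite lee_fin sqr_ge0.
- by rewrite lee_fin powR_ge0.
by rewrite EFinM; apply: lee_wpmul2l; rewrite ?lee_fin ?powR_ge0.
Qed.

End interpolation.

(** * Convolutions with a measure of positive Fourier dimension *)

Section product_fourier.
Context (R : realType) (d : nat).
Let V := 'rV[R]_d.
Variables (g : {finite_measure set V -> \bar R}) (nu : probability V R).

(** The smoothed densities and transforms were set up for a map [X] on a measure space so that a
    convolution is the case of addition on a product, and a single measure the case of the
    identity. *)
Definition addX (z : V * V) : V := z.1 + z.2.

Lemma measurable_addX : measurable_fun setT addX.
Proof. exact: measurable_add_rV. Qed.

(* The law of [addX] under [prodm] is the convolution of [g] and [nu]. *)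
Definition prodm : set (V * V)%type -> \bar R := (g \x nu)%E.

HB.instance Definition _ := Measure.on prodm.

Let prodmT : prodm setT = g setT.
Proof.
by rewrite -setXTT /prodm product_measure1E// [X in (_ * X)%E]probability_setT mule1.
Qed.

Let prodm_fin : fin_num_fun prodm.
Proof.
move=> B mB; rewrite ge0_fin_numE//.
apply: (@le_lt_trans _ _ (prodm setT)); first by rewrite le_measure ?inE.
by rewrite prodmT -ge0_fin_numE// fin_num_measure.
Qed.

HB.instance Definition _ := Measure_isFinite.Build _ _ _ prodm prodm_fin.

Let gnu : {sigma_finite_measure set (V * V)%type -> \bar R} := prodm.

Lemma prod_finite : (gnu setT < +oo)%E.
Proof. by rewrite -ge0_fin_numE//; exact: (@fin_num_measure _ _ _ prodm). Qed.

Let gfin : (g setT < +oo)%E.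
Proof. by rewrite -ge0_fin_numE// fin_num_measure. Qed.

Let nufin : (nu setT < +oo)%E.
Proof. by rewrite probability_setT ltry. Qed.

Lemma Rintegral_prod (f : V * V -> R) C : measurable_fun setT f ->
  (forall z, `|f z| <= C) ->
  \int[gnu]_z f z = \int[g]_x \int[nu]_y f (x, y).
Proof.
move=> mf fC; have intf := integrable_bounded prod_finite mf fC.
apply: EFin_inj; rewrite (EFin_Rintegral measurableT intf).
rewrite -(integral12_prod_meas1 intf).
have ify x : nu.-integrable setT (fun y => (f (x, y))%:E).
  by apply: (integrable_bounded nufin _ (fun y => fC _)); exact: (measurableT_comp mf).
have -> : fubini_F nu (EFin \o f) = EFin \o (fun x => \int[nu]_y f (x, y)).
  by apply/funext => x; rewrite /fubini_F /= (EFin_Rintegral measurableT (ify x)).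
rewrite -EFin_Rintegral//.
apply: (@integrable_bounded _ _ _ g gfin _ (C * fine (nu setT))).
  apply/measurable_EFinP; have := measurable_fubini_F intf.
  apply: eq_measurable_fun => x _.
  by rewrite /fubini_F /= (EFin_Rintegral measurableT (ify x)).
move=> x; apply: normr_Rintegral_le => //; exact: (measurableT_comp mf).
Qed.

Let mdot (xi : V) : measurable_fun setT (fun x : V => pi * dotmul x xi).
Proof. by apply: measurable_funM => //; exact: measurable_dotmul. Qed.

Let intcos (m : {sigma_finite_measure set V -> \bar R}) xi : (m setT < +oo)%E ->
  m.-integrable setT (fun y => (cos (pi * dotmul y xi))%:E).
Proof.
move=> mfin; apply: (integrable_bounded mfin _ (fun o => normr_cos_le1 _)).
exact: (measurableT_comp (@m_cos R) (mdot xi)).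
Qed.

Let intsin (m : {sigma_finite_measure set V -> \bar R}) xi : (m setT < +oo)%E ->
  m.-integrable setT (fun y => (sin (pi * dotmul y xi))%:E).
Proof.
move=> mfin; apply: (integrable_bounded mfin _ (fun o => normr_sin_le1 _)).
exact: (measurableT_comp (@m_sin R) (mdot xi)).
Qed.

Let madd xi : measurable_fun setT (fun z : V * V => pi * dotmul (addX z) xi).
Proof.
apply: measurable_funM => //; apply: measurable_dotmul => //; exact: measurable_addX.
Qed.

(** Together with [fs_prod], the real and imaginary parts of the rule that convolution multiplies
    Fourier transforms; squared moduli then multiply as well. *)
Lemma fc_prod xi : fc gnu addX xi = fc g id xi * fc nu id xi - fs g id xi * fs nu id xi.
Proof.
rewrite {1}/fc (Rintegral_prod _ (fun z => normr_cos_le1 _)); last first.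
  exact: (measurableT_comp (@m_cos R) (madd xi)).
transitivity (\int[g]_x (fc nu id xi * cos (pi * dotmul x xi) -
    fs nu id xi * sin (pi * dotmul x xi))).
  apply: eq_Rintegral => x _; rewrite /addX/=.
  under eq_Rintegral do rewrite dotmulDl mulrDr cosD.
  rewrite RintegralB//; [|exact: integrableRZl (intcos _ _)|exact: integrableRZl (intsin _ _)].
  rewrite !RintegralZl//; [|exact: intsin|exact: intcos].
  by rewrite mulrC [X in _ - X]mulrC.
rewrite RintegralB//; [|exact: integrableRZl (intcos _ _)|exact: integrableRZl (intsin _ _)].
rewrite !RintegralZl//; [|exact: intsin|exact: intcos].
by rewrite mulrC [X in _ - X]mulrC.
Qed.

Lemma fs_prod xi : fs gnu addX xi = fs g id xi * fc nu id xi + fc g id xi * fs nu id xi.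
Proof.
rewrite {1}/fs (Rintegral_prod _ (fun z => normr_sin_le1 _)); last first.
  exact: (measurableT_comp (@m_sin R) (madd xi)).
transitivity (\int[g]_x (fc nu id xi * sin (pi * dotmul x xi) +
    fs nu id xi * cos (pi * dotmul x xi))).
  apply: eq_Rintegral => x _; rewrite /addX/=.
  under eq_Rintegral do rewrite dotmulDl mulrDr sinD.
  rewrite RintegralD//; [|exact: integrableRZl (intcos _ _)|exact: integrableRZl (intsin _ _)].
  rewrite !RintegralZl//; [|exact: intsin|exact: intcos].
  by rewrite mulrC [X in _ + X]mulrC.
rewrite RintegralD//; [|exact: integrableRZl (intsin _ _)|exact: integrableRZl (intcos _ _)].
rewrite !RintegralZl//; [|exact: intcos|exact: intsin].
by rewrite mulrC [X in _ + X]mulrC.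
Qed.

Lemma fpow_prod xi : fpow gnu addX xi = fpow nu id xi * fpow g id xi.
Proof. by rewrite /fpow fc_prod fs_prod; ring. Qed.

Section estimates.
Variables (n : nat) (a A : R).
Hypotheses (a0 : 0 <= a) (ga : forall k, (g (dyadic_cube n k) <= a%:E)%E).

(** Up to constants this is [2^(n d) a], the density of a mass [a] spread over a cube of side
    [2^-n]. *)
Definition Csup := Num.sqrt 2 ^+ d * expR A * (2 ^+ n) ^+ d * a.

(** For fixed [y] the smoothed translate of [g] is bounded by [integral_gk_le]; averaging over the
    probability [nu] keeps the bound. *)
Lemma hk_le t x : 0 < t -> d%:R * 4 ^- n <= 2 * A * t -> hk gnu addX t x <= Csup.
Proof.
move=> t0 At; rewrite -lee_fin hkE//; [|exact: prod_finite|exact: measurable_addX].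
have mgk : measurable_fun setT (fun z : V * V => (gk t (x - addX z))%:E).
  apply/measurable_EFinP; apply: measurable_gk; apply: measurable_rVB => //.
  exact: measurable_addX.
rewrite (fubini_tonelli2 (fun z : V * V => (gk t (x - addX z))%:E))//; last first.
  by move=> z; rewrite lee_fin gk_ge0.
apply: (@le_trans _ _ (\int[nu]_y (cst Csup%:E y))%E); last first.
  by rewrite integral_cst//= [X in (_ * X)%E]probability_setT mule1.
apply: ge0_le_integral => //.
- by move=> y _; apply: integral_ge0 => z _; rewrite lee_fin gk_ge0.
- apply: (measurable_fun_fubini_tonelli_G (fun z : V * V => (gk t (x - addX z))%:E)) => //.
  by move=> z; rewrite lee_fin gk_ge0.
move=> y _; rewrite /fubini_G/=.
under eq_integral do rewrite /addX/= opprD addrA addrAC.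
exact: integral_gk_le.
Qed.

Section comb.
Variables (I : finType) (c t : I -> R).
Hypothesis t0 : forall i, 0 < t i.

Let h := hks gnu addX c t.

Lemma integral_abs_hks_le :
  (\int[@leb R d]_x `|h x|%:E <= ((\sum_i `|c i|) * fine (g setT))%:E)%E.
Proof.
have mh i : measurable_fun setT (hk gnu addX (t i)).
  by apply: measurable_hk => //; [exact: prod_finite|exact: measurable_addX].
apply: (@le_trans _ _ (\int[@leb R d]_x (\sum_i (`|c i|%:E * (hk gnu addX (t i) x)%:E))%E)%E).
  apply: ge0_le_integral => //.
  - apply/measurable_EFinP; apply: measurableT_comp => //.
    by apply: measurable_hks => //; [exact: prod_finite|exact: measurable_addX].
  - by apply: emeasurable_sum => i; apply: measurable_funeM; exact/measurable_EFinP.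
  move=> x _; rewrite sumEFin lee_fin (le_trans (ler_norm_sum _ _ _))//.
  by apply: ler_sum => i _; rewrite normrM (ger0_norm (hk_ge0 _ _ _ _)).
rewrite ge0_integral_sum//; last 2 first.
- by move=> i; apply: measurable_funeM; exact/measurable_EFinP.
- by move=> i x _; rewrite mule_ge0 ?lee_fin ?hk_ge0.
rewrite mulr_suml -sumEFin; apply: lee_sum => i _.
rewrite ge0_integralZl; last 4 first.
- by [].
- exact/measurable_EFinP.
- by move=> x _; rewrite lee_fin hk_ge0.
- by rewrite lee_fin.
rewrite integral_hk//; [|exact: prod_finite|exact: measurable_addX].
rewrite [X in (_ * X <= _)%E]prodmT EFinM fineK//.
exact: fin_num_measure.
Qed.

Lemma abs_hks_le x : (forall i, d%:R * 4 ^- n <= 2 * A * t i) ->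
  `|h x| <= (\sum_i `|c i|) * Csup.
Proof.
move=> At; rewrite (le_trans (ler_norm_sum _ _ _))// mulr_suml.
apply: ler_sum => i _; rewrite normrM (ger0_norm (hk_ge0 _ _ _ _)).
by rewrite ler_wpM2l// hk_le.
Qed.

(** Plancherel is used twice. Forwards, for the convolution, it lets [hB] replace the multiplier and
    the transform of [nu] by one Gaussian; backwards, for [g] alone, it turns the rest into a
    Gaussian energy, at most [Csup] times the mass of [g]. *)
Lemma integral_hks_sqr_le B t' : 0 <= B -> 0 < t' -> d%:R * 4 ^- n <= 2 * A * t' ->
  (forall xi, gmults c t xi ^+ 2 * fpow nu id xi <= B * gmult t' xi) ->
  (\int[@leb R d]_x (h x ^+ 2)%:E <= (B * Csup * fine (g setT))%:E)%E.
Proof.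
move=> B0 t'0 At' hB.
have P0 : 0 < 2 ^+ d :> R by rewrite exprn_gt0.
rewrite -(@lee_pmul2l _ (2 ^+ d)%:E)// ?lte_fin//.
rewrite integral_hks_sqr//; [|exact: prod_finite|exact: measurable_addX].
have mfp := measurable_fpow gfin (@measurable_id _ V setT).
apply: (@le_trans _ _ (\int[@leb R d]_xi (B%:E * (gmult t' xi * fpow g id xi)%:E))%E).
  apply: ge0_le_integral => //.
  - by move=> xi _; rewrite lee_fin mulr_ge0 ?sqr_ge0 ?fpow_ge0.
  - apply/measurable_EFinP/measurable_funM.
      by apply: measurable_funX; exact: measurable_gmults.
    by apply: measurable_fpow; [exact: prod_finite|exact: measurable_addX].
  - apply: measurable_funeM; apply/measurable_EFinP/measurable_funM => //.
    exact: measurable_gmult.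
  move=> xi _; rewrite -EFinM lee_fin fpow_prod !mulrA ler_wpM2r ?fpow_ge0//.
rewrite ge0_integralZl; last 4 first.
- by [].
- by apply/measurable_EFinP/measurable_funM => //; exact: measurable_gmult.
- by move=> xi _; rewrite lee_fin mulr_ge0 ?gmult_ge0 ?fpow_ge0.
- by rewrite lee_fin.
rewrite -(integral_gk_fpow gfin (@measurable_id _ V setT) t'0) muleCA.
apply: lee_wpmul2l; first by rewrite lee_fin ltW.
rewrite -mulrA EFinM; apply: lee_wpmul2l; first by rewrite lee_fin.
apply: (@le_trans _ _ (\int[g]_o (cst Csup%:E o))%E); last first.
  by rewrite integral_cst//= [leRHS]EFinM fineK// fin_num_measure.
apply: ge0_le_integral => //.
- by move=> o _; apply: integral_ge0 => z _; rewrite lee_fin gk_ge0.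
- apply: (measurable_fun_fubini_tonelli_F (fun z : V * V => (gk t' (z.1 - z.2))%:E)).
    by apply/measurable_EFinP; apply: measurable_gk; apply: measurable_rVB.
  by move=> z; rewrite lee_fin gk_ge0.
by move=> o _; exact: integral_gk_le.
Qed.

End comb.
End estimates.
End product_fourier.

(** * The frequency multiplier of the kernel differences *)

Section multiplier.
Context (R : realType).

Lemma binomial_tail (k : nat) (y : R) :
  \sum_(j < k) (-1) ^+ j * 'C(k, j.+1)%:R * y ^+ j.+1 = 1 - (1 - y) ^+ k.
Proof.
have -> : (1 - y) ^+ k =
    1 + \sum_(j < k) (-1) ^+ j.+1 * 'C(k, j.+1)%:R * y ^+ j.+1.
  rewrite exprBn big_ord_recl; congr (_ + _).
    by rewrite bin0 subn0 !expr0 expr1n !mul1r mulr1n.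
  by apply: eq_bigr => j _; rewrite /bump/= expr1n mulr1 -mulr_natr mulrAC.
rewrite opprD addrA subrr add0r -sumrN; apply: eq_bigr => j _.
by rewrite [(-1) ^+ j.+1]exprS mulN1r !mulNr opprK.
Qed.

Lemma bernoulli_pow (k : nat) (z : R) : 0 <= z <= 1 -> 1 - (1 - z) ^+ k <= k%:R * z.
Proof.
move=> /andP[z0 z1]; elim: k => [|k IH]; first by rewrite expr0 subrr mul0r.
rewrite exprS -natr1 mulrDl mul1r.
have h : (1 - z) ^+ k <= 1 by rewrite exprn_ile1 ?subr_ge0// gerBl.
have := ler_wpM2l z0 h; lra.
Qed.

(** For [x <= 1], [1 - e^(-x) <= x] makes the square at most [x^(2k)], which absorbs [x^(-s)]; the
    constant 2 suffices since [e^(-x/8) >= 7/8]. For [x > 1], [x^(-s) <= 1] and Bernoulli bounds the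
    difference by [k e^(-x/4)], whence [k^2]. *)
Lemma multiplier_bound (k : nat) (s x : R) : (0 < k)%N -> 0 < x -> 0 <= s ->
  s <= (2 * k)%:R ->
  ((1 - expR (- x)) ^+ k - (1 - expR (- (x / 4))) ^+ k) ^+ 2 * x `^ (- s) <=
  (2 + k%:R ^+ 2) * expR (- (x / 8)).
Proof.
move=> k0 x0 s0 sk.
set y := expR (- x); set z := expR (- (x / 4)).
have z01 : 0 <= z <= 1.
  by rewrite expR_ge0/= -expR0 ler_expR oppr_le0 divr_ge0// ltW.
have yz : y <= z by rewrite ler_expR lerN2; lra.
have y0 : 0 <= y := expR_ge0 _.
have z1 : z <= 1 by case/andP: z01.
set u := (1 - y) ^+ k; set v := (1 - z) ^+ k.
have v0 : 0 <= v by rewrite exprn_ge0// subr_ge0.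
have vu : v <= u.
  rewrite ler_pXn2r// ?nnegrE ?subr_ge0//; last exact: le_trans yz z1.
  by rewrite lerD2l lerN2.
have u1 : u <= 1 by rewrite exprn_ile1 ?subr_ge0 ?(le_trans yz)// gerBl.
have x8 : 1 - x / 8 <= expR (- (x / 8)) by exact: expR_ge1Dx.
have k2 : 0 <= k%:R ^+ 2 :> R by rewrite sqr_ge0.
have [xle1|xgt1] := leP x 1.
  have ux : u <= x ^+ k.
    rewrite ler_pXn2r// ?nnegrE ?subr_ge0 ?(le_trans yz)//; last exact: ltW.
    by have := expR_ge1Dx (- x); rewrite -/y; lra.
  have uv : (u - v) ^+ 2 <= x ^+ (2 * k).
    rewrite mulnC exprM ler_pXn2r// ?nnegrE ?subr_ge0//.
      by apply: le_trans ux; rewrite gerBl.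
    by rewrite exprn_ge0// ltW.
  apply: (@le_trans _ _ (x ^+ (2 * k) * x `^ (- s))).
    by rewrite ler_wpM2r ?powR_ge0.
  rewrite -powR_mulrn ?(ltW x0)// -powRD; last by rewrite (gt_eqF x0) implybT.
  apply: (@le_trans _ _ 1); last by nra.
  rewrite -[leRHS](powRr0 x); apply: ger_powR; first by rewrite x0.
  by rewrite subr_ge0.
have xs1 : x `^ (- s) <= 1.
  by rewrite -[leRHS](powRr0 x); apply: ler_powR; [exact: ltW|rewrite oppr_le0].
have uvz : u - v <= k%:R * z.
  by apply: le_trans (bernoulli_pow k z01); rewrite lerB.
have uv2 : (u - v) ^+ 2 <= k%:R ^+ 2 * expR (- (x / 8)).
  apply: (@le_trans _ _ ((k%:R * z) ^+ 2)).
    by rewrite ler_pXn2r// ?nnegrE ?subr_ge0 ?mulr_ge0 ?expR_ge0.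
  rewrite exprMn ler_wpM2l// -expRM_natl ler_expR; lra.
apply: (@le_trans _ _ ((u - v) ^+ 2)); first by rewrite ler_piMr ?sqr_ge0.
have := expR_ge0 (- (x / 8)); nra.
Qed.

End multiplier.

Section kernel.
Context (R : realType) (d k : nat).
Let V := 'rV[R]_d.

(* [\sum_j kc j * gk (kt tau j)] has multiplier [1 - (1 - gmult tau)^k], and
   [dc], [dt] describe the difference of these kernels at scales [tau / 4] and
   [tau]. *)
Definition kc (j : 'I_k) : R := (-1) ^+ j * 'C(k, j.+1)%:R.
Definition kt (tau : R) (j : 'I_k) : R := j.+1%:R * tau.
Definition dc (q : 'I_k * bool) : R := if q.2 then kc q.1 else - kc q.1.
Definition dt (tau : R) (q : 'I_k * bool) : R := kt (if q.2 then tau / 4 else tau) q.1.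

Lemma sum_dc (F : R -> R) tau :
  \sum_q dc q * F (dt tau q) =
  (\sum_j kc j * F (kt (tau / 4) j)) - \sum_j kc j * F (kt tau j).
Proof.
rewrite -sumrB -(pair_bigA _ (fun j b => dc (j, b) * F (dt tau (j, b))))/=.
by apply: eq_bigr => j _; rewrite big_bool /dc /dt/= mulNr.
Qed.

(** A multiple of the variance becomes a power of the multiplier, so the combination is a polynomial
    in [gmult tau xi], evaluated by [binomial_tail]. *)
Lemma gmults_kernel tau (xi : V) :
  gmults kc (kt tau) xi = 1 - (1 - gmult tau xi) ^+ k.
Proof.
rewrite -binomial_tail; apply: eq_bigr => j _; congr (_ * _).
by rewrite /gmult -expRM_natl; congr expR; rewrite /kt; ring.
Qed.

Lemma gmults_diff tau (xi : V) :
  gmults dc (dt tau) xi = (1 - gmult tau xi) ^+ k - (1 - gmult (tau / 4) xi) ^+ k.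
Proof.
rewrite /gmults (sum_dc (fun t => gmult t xi)).
have := gmults_kernel (tau / 4) xi; have := gmults_kernel tau xi.
rewrite /gmults => -> ->; lra.
Qed.

Lemma kt_gt0 tau j : 0 < tau -> 0 < kt tau j.
Proof. by move=> t0; rewrite mulr_gt0. Qed.

Lemma dt_gt0 tau q : 0 < tau -> 0 < dt tau q.
Proof. by move=> t0; apply: kt_gt0; case: q.2; rewrite ?divr_gt0. Qed.

Lemma dt_ge tau q : 0 < tau -> tau / 8 <= dt tau q.
Proof.
move=> t0; rewrite /dt /kt.
have j1 : 1 <= q.1.+1%:R :> R by rewrite ler1n.
by case: q.2; nra.
Qed.

Section decay.
Variables (nu : probability V R) (sigma : R).
Hypotheses (s0 : 0 <= sigma) (k0 : (0 < k)%N) (sk : sigma <= k%:R)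
  (hdec : fourier_decay nu sigma).

Lemma fpow_normc xi : fpow nu id xi = Normc.normc (fourier nu xi) ^+ 2.
Proof. by rewrite /Normc.normc/= sqr_sqrtr// addr_ge0 ?sqr_ge0. Qed.

(** The squared decay is [|xi|^(-sigma)]. In the dimensionless variable [x = (pi^2 / 2) tau |xi|^2]
    it is a constant times [tau^(sigma/2) x^(-sigma/2)]: the first factor is the gain, the second is
    absorbed by [multiplier_bound]. *)
Lemma gmults_decay : exists2 B, 0 <= B & forall tau xi, 0 < tau ->
  gmults dc (dt tau) xi ^+ 2 * fpow nu id xi <=
  B * tau `^ (sigma / 2) * gmult (tau / 8) xi.
Proof.
have [C0 hC0] := hdec.
pose c0 : R := pi ^+ 2 / 2.
have c0p : 0 < c0 by rewrite divr_gt0 ?exprn_gt0 ?pi_gt0.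
have B0 : 0 <= C0 ^+ 2 * c0 `^ (sigma / 2) * (2 + k%:R ^+ 2).
  by rewrite mulr_ge0 ?addr_ge0 ?sqr_ge0// mulr_ge0 ?sqr_ge0 ?powR_ge0.
exists (C0 ^+ 2 * c0 `^ (sigma / 2) * (2 + k%:R ^+ 2)) => //.
move=> tau xi t0.
(* The decay says nothing at the origin, but there the two powers in [gmults_diff] coincide. *)
have [->|xi0] := eqVneq xi 0.
  have g0 t : gmult t (0 : V) = 1.
    rewrite /gmult; have -> : dotmul (0 : V) 0 = 0.
      by rewrite /dotmul big1// => i _; rewrite mxE mul0r.
    by rewrite mulr0 oppr0 expR0.
  rewrite gmults_diff !g0 subrr expr0n mul0r.
  by rewrite mulr1 mulr_ge0// powR_ge0.
pose D := dotmul xi xi.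
have D0 : 0 < D.
  rewrite lt_neqAle dotmul_ge0 andbT eq_sym; apply: contra xi0 => /eqP.
  move=> /psumr_eq0P h; apply/eqP/rowP => i; rewrite mxE; apply/eqP.
  by rewrite -sqrf_eq0 expr2 h// => j _; rewrite -expr2 sqr_ge0.
pose x := c0 * tau * D.
have x0 : 0 < x by rewrite mulr_gt0// mulr_gt0.
have fp : fpow nu id xi <= C0 ^+ 2 * D `^ (- (sigma / 2)).
  rewrite fpow_normc; have := hC0 _ xi0.
  have -> : enorm xi `^ (- (sigma / 2)) = D `^ (- (sigma / 4)).
    by rewrite /enorm -powR12_sqrt ?ltW// -powRrM; congr (_ `^ _); field.
  have -> : D `^ (- (sigma / 2)) = (D `^ (- (sigma / 4))) ^+ 2.
    by rewrite -powR_mulrn ?powR_ge0// -powRrM; congr (_ `^ _); field.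
  rewrite -exprMn => h; rewrite ler_pXn2r// nnegrE ?sqrtr_ge0//.
  exact: le_trans (sqrtr_ge0 _) h.
have Dx : D `^ (- (sigma / 2)) = (c0 * tau) `^ (sigma / 2) * x `^ (- (sigma / 2)).
  have ct0 : 0 < c0 * tau by rewrite mulr_gt0.
  have -> : x `^ (- (sigma / 2)) = (c0 * tau) `^ (- (sigma / 2)) * D `^ (- (sigma / 2)).
    by rewrite -powRM// ltW.
  by rewrite mulrA -powRD ?subrr ?powRr0 ?mul1r// (gt_eqF ct0) implybT.
have s20 : 0 <= sigma / 2 by rewrite divr_ge0.
have s2k : sigma / 2 <= (2 * k)%:R by have := ler0n R k; move: s0 sk; rewrite natrM; lra.
have := multiplier_bound k0 x0 s20 s2k.
have -> : expR (- x) = gmult tau xi by rewrite /gmult /x /c0 /D.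
have -> : expR (- (x / 4)) = gmult (tau / 4) xi.
  by congr expR; rewrite /x /c0 /D; field.
have -> : expR (- (x / 8)) = gmult (tau / 8) xi.
  by congr expR; rewrite /x /c0 /D; field.
rewrite -gmults_diff => hb.
apply: (@le_trans _ _ (gmults dc (dt tau) xi ^+ 2 * (C0 ^+ 2 * D `^ (- (sigma / 2))))).
  by rewrite ler_wpM2l ?sqr_ge0.
rewrite Dx powRM ?(ltW c0p) ?(ltW t0)//.
set P := c0 `^ _; set Q := tau `^ _.
have PQ : 0 <= C0 ^+ 2 * P * Q.
  by rewrite mulr_ge0 ?powR_ge0// mulr_ge0 ?powR_ge0// sqr_ge0.
have := ler_wpM2l PQ hb; set m2 := gmults _ _ _ ^+ 2; set X := x `^ _.
have -> : C0 ^+ 2 * P * Q * (m2 * X) = m2 * (C0 ^+ 2 * (P * Q * X)) by ring.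
move=> /le_trans; apply; rewrite le_eqVlt; apply/orP; left; apply/eqP; ring.
Qed.

End decay.
End kernel.

(** * Splitting a measure by the masses of its cubes *)

Lemma powR_sum_le (R : realType) (I : finType) (x : I -> R) (p : R) : 0 < p ->
  `|\sum_i x i| `^ p <= #|I|%:R `^ p * \sum_i `|x i| `^ p.
Proof.
move=> p0; set S := \sum_i `|x i| `^ p.
have pn : p != 0 by rewrite gt_eqF.
have S0 : 0 <= S by apply: sumr_ge0 => i _; exact: powR_ge0.
(* A crude substitute for convexity: every term is at most [S^(1/p)], and there are [#|I|] of
   them. *)
have xS i : `|x i| <= S `^ p^-1.
  rewrite -[leLHS](powRr1 (normr_ge0 (x i))) -(divff pn) powRrM.
  apply: ge0_ler_powR; rewrite ?nnegrE ?powR_ge0 ?invr_ge0 ?(ltW p0)//.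
  by rewrite /S (bigD1 i)//= lerDl sumr_ge0// => j _; exact: powR_ge0.
apply: (@le_trans _ _ ((#|I|%:R * S `^ p^-1) `^ p)).
  apply: ge0_ler_powR; rewrite ?nnegrE ?mulr_ge0 ?powR_ge0 ?(ltW p0)//.
  rewrite (le_trans (ler_norm_sum _ _ _))//.
  by rewrite mulr_natl -sumr_const; apply: ler_sum => i _; exact: xS.
by rewrite powRM ?powR_ge0// -powRrM mulVf// powRr1.
Qed.

Lemma integral_mrestr dT (T : measurableType dT) (R : realType)
    (m : {measure set T -> \bar R}) (D : set T) (mD : measurable D)
    (f : T -> \bar R) : measurable_fun setT f -> (forall x, (0 <= f x)%E) ->
  (\int[mrestr m mD]_x f x = \int[m]_(x in D) f x)%E.
Proof.
move=> mf f0.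
rewrite (@ge0_negligible_integral _ _ _ (mrestr m mD) setT (~` D))//; last 2 first.
- exact: measurableC.
- by rewrite /= /mrestr setICl measure0.
rewrite setTD setCK; apply: eq_measure_integral => A mA AD.
by rewrite /= /mrestr setIidl.
Qed.

Section level_sets.
Variables (R : realType) (d : nat) (mu : probability 'rV[R]_d R).
Variables (n K : nat) (th : nat -> R).
Let V := 'rV[R]_d.

(* The level of a cube of index [k] is the first [j] such that its measure exceeds
   [th j.+1], or [K] if there is none among [j < K]. *)
Definition lev (k : 'rV[int]_d) : nat :=
  find (fun j => (th j.+1)%:E < mu (dyadic_cube n k))%E (iota 0 K).

Definition levset (j : nat) : set V := \bigcup_(k in [set k | lev k = j]) dyadic_cube n k.

Lemma measurable_levset j : measurable (levset j).
Proof. by apply: measurable_countable_bigcup => k; exact: measurable_cube. Qed.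

Lemma lev_le k : (lev k <= K)%N.
Proof. by rewrite /lev -[leqRHS](size_iota 0) find_size. Qed.

(** With [lev_ge], a cube of level [j < K] has mass between [th j.+1] and [th j], while at the last
    level only the upper bound remains. The condition [th 0 = 1] there makes level 0 cover the
    heaviest cubes, [mu] being a probability. *)
Lemma lev_gt k : (lev k < K)%N -> ((th (lev k).+1)%:E < mu (dyadic_cube n k))%E.
Proof.
rewrite /lev -[X in (_ < X)%N](size_iota 0) -has_find => h.
by have := nth_find 0%N h; rewrite nth_iota// -[X in (_ < X)%N](size_iota 0 K) -has_find.
Qed.

Lemma lev_ge k : th 0 = 1 -> (mu (dyadic_cube n k) <= (th (lev k))%:E)%E.
Proof.
move=> th0; case E : (lev k) => [|j].
  by rewrite th0; apply: probability_le1; exact: measurable_cube.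
rewrite leNgt; apply/negP => h.
have jl : (j < lev k)%N by rewrite E.
have := before_find 0%N jl; rewrite nth_iota ?add0n ?h//.
by rewrite (leq_trans jl)// lev_le.
Qed.

Definition restr_lev (j : nat) := mrestr mu (measurable_levset j).

HB.instance Definition _ j := FiniteMeasure.on (restr_lev j).

Lemma restr_lev_cube j k : th 0 = 1 ->
  0 <= th j -> (restr_lev j (dyadic_cube n k) <= (th j)%:E)%E.
Proof.
move=> th0 thj; rewrite /restr_lev /mrestr.
have [<-|kj] := eqVneq (lev k) j.
  apply: le_trans (lev_ge k th0); rewrite le_measure ?inE//.
  - by apply: measurableI; [exact: measurable_cube|exact: measurable_levset].
  - exact: measurable_cube.
rewrite (_ : _ `&` _ = set0) ?measure0//.
rewrite -subset0 => x [/cubeP xk [l /= lj /cubeP xl]].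
by move: kj; rewrite -lj -xk -xl eqxx.
Qed.

Lemma integral_levsets (f : V -> \bar R) : measurable_fun setT f ->
  (forall x, (0 <= f x)%E) ->
  (\int[mu]_x f x = \sum_(j < K.+1) \int[restr_lev j]_x f x)%E.
Proof.
move=> mf f0.
transitivity (\sum_(j < K.+1) \int[mu]_(x in levset j) f x)%E; last first.
  by apply: eq_bigr => j _; rewrite /restr_lev integral_mrestr.
rewrite -(big_mkord xpredT (fun j => \int[mu]_(x in levset j) f x)%E).
rewrite -ge0_integral_bigsetU//=.
- congr (integral _ _ _); rewrite -bigcup_seq; apply/seteqP; split => // x _.
  exists (lev (cell n x)); first by rewrite /= mem_index_iota ltnS lev_le.
  by exists (cell n x) => //; exact: cube_cell.
- by move=> j; exact: measurable_levset.
- exact: (iota_uniq 0 K.+1).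
- move=> i j _ _ [x [[k /= <- /cubeP <-] [l /= <- /cubeP <-]]] //.
- exact: measurable_funTS.
Qed.

Lemma hks_levsets (nu : probability V R) (I : finType) (c t : I -> R) x :
  (forall i, 0 < t i) ->
  hks (prodm mu nu) (@addX R d) c t x =
  \sum_(j < K.+1) hks (prodm (restr_lev j) nu) (@addX R d) c t x.
Proof.
move=> t0; rewrite /hks exchange_big/=; apply: eq_bigr => i _.
rewrite -mulr_sumr; congr (_ * _).
apply: EFin_inj; rewrite -sumEFin hkE//; [|exact: prod_finite|exact: measurable_addX].
have mgk : measurable_fun setT (fun z : V * V => (gk (t i) (x - addX z))%:E).
  apply/measurable_EFinP; apply: measurable_gk; apply: measurable_rVB => //.
  exact: measurable_addX.
have gk0 z : (0 <= (gk (t i) (x - addX z))%:E)%E by rewrite lee_fin gk_ge0.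
under eq_bigr => j _.
  rewrite hkE//; [|exact: prod_finite|exact: measurable_addX].
  rewrite (fubini_tonelli1 (fun z : V * V => (gk (t i) (x - addX z))%:E))//.
  over.
rewrite (fubini_tonelli1 (fun z : V * V => (gk (t i) (x - addX z))%:E))//.
apply: integral_levsets.
  exact: (measurable_fun_fubini_tonelli_F (fun z : V * V => (gk (t i) (x - addX z))%:E)).
by move=> z; apply: integral_ge0.
Qed.

End level_sets.

Lemma powR2D (R : realType) (x y : R) : 2 `^ (x + y) = 2 `^ x * 2 `^ y :> R.
Proof. by rewrite powRD// pnatr_eq0 implybT. Qed.

(** * Geometric decay in L^p *)

Section piece.
Context (R : realType) (d k : nat).
Let V := 'rV[R]_d.
Variables (nu : probability V R) (sigma p : R).
Hypotheses (s0 : 0 <= sigma) (k0 : (0 < k)%N) (sk : sigma <= k%:R)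
  (hdec : fourier_decay nu sigma) (p1 : 1 < p).

(** The exponent of [2^n] left in the bound on a piece once [g(R^d) a^(p-1)] is taken out: from
    [L^(p-1)] with [L = 2^(n(d-sigma)) a] when [p <= 2], from [(2^(nd) a)^(p-2) L] when [p > 2]. *)
Definition expo : R :=
  if p <= 2 then (p - 1) * (d%:R - sigma) else (p - 1) * d%:R - sigma.

Let tau (n : nat) : R := 4 ^- n.

Let tau0 n : 0 < tau n. Proof. by rewrite invr_gt0 exprn_gt0. Qed.

Let tauE n : tau n `^ (sigma / 2) = 2 `^ (- (n%:R * sigma)).
Proof.
have -> : tau n = 2 `^ (- (2 * n%:R)).
  rewrite powRN -natrM powR_mulrn// /tau; congr (_^-1).
  by rewrite exprM expr2 -natrM.
by rewrite -powRrM; congr (_ `^ _); field.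
Qed.

Let pow2E n : (2 ^+ n) ^+ d = 2 `^ (n%:R * d%:R) :> R.
Proof. by rewrite -exprM -powR_mulrn// natrM. Qed.

Lemma piece_bound : exists2 C, 0 <= C & forall n (g : {finite_measure set V -> \bar R}) a,
  0 < a -> (forall l, g (dyadic_cube n l) <= a%:E)%E ->
  (\int[@leb R d]_x (`|hks (prodm g nu) (@addX R d) (@dc R k) (dt (4 ^- n)) x| `^ p)%:E
   <= (C * fine (g setT) * a `^ (p - 1) * 2 `^ (n%:R * expo))%:E)%E.
Proof.
have [B0 B00 hB0] := gmults_decay s0 k0 sk hdec.
(* All variances in use are at least [4^-n / 8], and [2 * A / 8 = d] is exactly what the squared
   diameter [d 4^-n] of a cube requires. *)
pose A : R := 4 * d%:R.
pose K : R := Num.sqrt 2 ^+ d * expR A.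
have K0 : 0 <= K by rewrite mulr_ge0 ?expR_ge0// exprn_ge0// sqrtr_ge0.
pose S1 : R := \sum_(q : 'I_k * bool) `|dc R q|.
have S10 : 0 <= S1 by apply: sumr_ge0.
pose C : R := if p <= 2 then S1 + B0 * K else (S1 * K) `^ (p - 2) * (B0 * K).
exists C.
  rewrite /C; case: ifP => _; first by rewrite addr_ge0// mulr_ge0.
  by rewrite mulr_ge0 ?powR_ge0// mulr_ge0.
move=> n g a a0 ga; set h := hks _ _ _ _.
have t0 (q : 'I_k * bool) : 0 < dt (tau n) q by apply: dt_gt0.
have At t : tau n / 8 <= t -> d%:R * 4 ^- n <= 2 * A * t.
  rewrite /A /tau => ht; have := ler_wpM2l (ler0n R d) ht; lra.
have mh : measurable_fun setT h.
  by apply: measurable_hks => //; [exact: prod_finite|exact: measurable_addX].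
have G0 : 0 <= fine (g setT) by rewrite fine_ge0.
have ht80 : 0 < tau n / 8 by rewrite divr_gt0.
have b1 := integral_abs_hks_le g nu (@dc R k) t0.
have b2 := integral_hks_sqr_le (ltW a0) ga t0
  (mulr_ge0 B00 (powR_ge0 (tau n) (sigma / 2))) ht80 (At _ (lexx _)) (fun xi => hB0 (tau n) xi (tau0 n)).
have bM x := abs_hks_le nu (ltW a0) ga (@dc R k) t0 x
  (fun q => At _ (dt_ge q (tau0 n))).
(* The height at which the L^1 and L^2 bounds of [h] balance. *)
pose L : R := 2 `^ (n%:R * (d%:R - sigma)) * a.
have L0 : 0 < L by rewrite mulr_gt0// powR_gt0.
have BE : B0 * tau n `^ (sigma / 2) * Csup d n a A * fine (g setT) = B0 * K * L * fine (g setT).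
  rewrite tauE /Csup pow2E /L mulrBr powR2D.
  rewrite /K; ring.
rewrite BE in b2.
rewrite /C /expo; case: ifPn => [p2|].
  apply: le_trans (integral_powR_le_12 mh p1 p2 L0 b1 b2) _.
  rewrite lee_fin le_eqVlt; apply/orP; left; apply/eqP.
  have -> : L `^ (p - 2) * (B0 * K * L * fine (g setT)) =
      (B0 * K * fine (g setT)) * (L * L `^ (p - 1 - 1)).
    by rewrite (_ : p - 1 - 1 = p - 2); [ring|ring].
  rewrite mulr_powRB1 ?ltW// ?subr_gt0//.
  have -> : L `^ (p - 1) = 2 `^ (n%:R * ((p - 1) * (d%:R - sigma))) * a `^ (p - 1).
    by rewrite /L powRM ?powR_ge0 ?ltW// -powRrM; congr (_ `^ _ * _); ring.
  by rewrite -/S1; ring.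
rewrite -ltNge => p2.
apply: le_trans (integral_powR_le_2y mh (ltW p2) bM b2) _.
rewrite lee_fin le_eqVlt; apply/orP; left; apply/eqP; rewrite -/S1.
have -> : S1 * Csup d n a A = (S1 * K) * (2 `^ (n%:R * d%:R) * a).
  by rewrite /Csup pow2E /K; ring.
rewrite powRM ?mulr_ge0 ?powR_ge0 ?(ltW a0)// (powRM _ (powR_ge0 _ _) (ltW a0)) -powRrM.
rewrite -(@mulr_powRB1 _ a (p - 1)) ?(ltW a0) ?subr_gt0//.
rewrite (_ : p - 1 - 1 = p - 2); last by ring.
have -> : 2 `^ (n%:R * ((p - 1) * d%:R - sigma)) =
    2 `^ (n%:R * d%:R * (p - 2)) * 2 `^ (n%:R * (d%:R - sigma)) :> R.
  by rewrite -powR2D; congr (_ `^ _); ring.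
by rewrite /L; ring.
Qed.

End piece.

Section delta.
Context (R : realType) (d k : nat).
Let V := 'rV[R]_d.
Variables (mu nu : probability V R) (sigma p s : R).
Hypotheses (s0 : 0 <= sigma) (k0 : (0 < k)%N) (sk : sigma <= k%:R)
  (hdec : fourier_decay nu sigma) (p1 : 1 < p).
Hypothesis gap : expo d sigma p < (p - 1) * s.

(** For [j < K], Chebyshev at the threshold [th j.+1], smaller than [th j] by [2^(n eps)], costs
    [2^(n eps (p-1))]. For [j = K] the mass is only bounded by 1, but [th K <= 2^(-n s)] already
    gives enough. *)
Lemma level_mass n K (eps : R) (th : nat -> R) (j : nat) :
  (forall i, th i = 2 `^ (- (n%:R * eps * i%:R))) -> 0 <= eps -> s <= eps * K%:R -> (j <= K)%N ->
  (Lq_sum p mu n <= (2 `^ (- (n%:R * ((p - 1) * s))))%:E)%E ->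
  fine (restr_lev mu n K th j setT) * th j `^ (p - 1) <=
    2 `^ (n%:R * ((p - 1) * (eps - s))).
Proof.
move=> thE eps0 sK jK hS.
have p10 : 0 <= p - 1 by rewrite subr_ge0 ltW.
have mE : fine (restr_lev mu n K th j setT) = fine (mu (levset mu n K th j)).
  by rewrite /restr_lev /mrestr setTI.
have mfin B : measurable B -> mu B = (fine (mu B))%:E.
  by move=> mB; rewrite fineK// fin_num_measure.
rewrite mE thE -powRrM.
have [jK'|/negPf jK'] := boolP (j < K)%N; last first.
  have -> : j = K by apply/eqP; rewrite eqn_leq jK leqNgt jK'.
  rewrite -[leRHS]mul1r; apply: ler_pM; rewrite ?powR_ge0 ?fine_ge0//.
    rewrite -lee_fin -mfin; last exact: measurable_levset.
    by apply: probability_le1; exact: measurable_levset.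
  apply: ler_powR; first by rewrite ler1n.
  have n0 : 0 <= n%:R * (p - 1) by rewrite mulr_ge0.
  have : n%:R * (p - 1) * (s - eps) <= n%:R * (p - 1) * (eps * K%:R).
    by apply: ler_wpM2l => //; apply: le_trans sK; rewrite gerBl.
  by lra.
have hb : 0 <= th j.+1 by rewrite thE powR_ge0.
have hch := le_trans (Lq_sum_chebyshev mu n p1 hb) hS.
set U := \bigcup_(_ in _) _ in hch.
have mU : measurable U by apply: measurable_countable_bigcup => l; exact: measurable_cube.
have sub : levset mu n K th j `<=` U.
  move=> x [l /= lj xl]; exists l => //=.
  by have := @lev_gt _ _ mu n K th l; rewrite lj; exact.
have muU : fine (mu (levset mu n K th j)) <= fine (mu U).
  rewrite -lee_fin -!mfin//; last exact: measurable_levset.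
  by rewrite le_measure ?inE//; exact: measurable_levset.
move: hch; rewrite (mfin _ mU) -EFinM lee_fin thE -powRrM => hch.
have -> : 2 `^ (- (n%:R * eps * j%:R) * (p - 1)) =
    2 `^ (n%:R * eps * (p - 1)) * 2 `^ (- (n%:R * eps * j.+1%:R) * (p - 1)) :> R.
  by rewrite -powR2D -natr1; congr (_ `^ _); ring.
have -> : 2 `^ (n%:R * ((p - 1) * (eps - s))) =
    2 `^ (n%:R * eps * (p - 1)) * 2 `^ (- (n%:R * ((p - 1) * s))) :> R.
  by rewrite -powR2D; congr (_ `^ _); ring.
rewrite mulrCA ler_pM2l ?powR_gt0//.
by apply: le_trans hch; rewrite mulrC ler_wpM2l ?powR_ge0.
Qed.

Lemma delta_bound : exists C delta : R, [/\ 0 <= C, 0 < delta & forall n,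
  (Lq_sum p mu n <= (2 `^ (- (n%:R * ((p - 1) * s))))%:E)%E ->
  (\int[@leb R d]_x (`|hks (prodm mu nu) (@addX R d) (@dc R k) (dt (4 ^- n)) x| `^ p)%:E
   <= (C * 2 `^ (- (n%:R * delta)))%:E)%E].
Proof.
have [C C0 hC] := piece_bound s0 k0 sk hdec p1.
have p10 : 0 < p - 1 by rewrite subr_gt0.
have p0 : 0 < p by exact: lt_trans p1.
(* Half of the gap is kept as the rate [delta]. The other half pays for the thresholds: [eps] is
   chosen so that the loss [(p - 1) * eps] equals [delta]. *)
pose delta := ((p - 1) * s - expo d sigma p) / 2.
have delta0 : 0 < delta by rewrite divr_gt0// subr_gt0.
pose eps := delta / (p - 1).
have eps0 : 0 < eps by rewrite divr_gt0.
(* Enough levels for the last threshold to fall below [2^(-n s)], in a number independent of [n]. *)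
pose K := Num.bound `|s / eps|.
have sK : s <= eps * K%:R.
  rewrite mulrC -ler_pdivrMr//; apply: le_trans (ler_norm _) _.
  exact: (ltW (archi_boundP (normr_ge0 _))).
exists (K.+1%:R `^ p * (K.+1%:R * C)), delta; split => //.
  by rewrite mulr_ge0 ?powR_ge0// mulr_ge0.
move=> n hS; pose th i : R := 2 `^ (- (n%:R * eps * i%:R)).
have th0 : th 0 = 1 by rewrite /th mulr0 oppr0 powRr0.
have thp i : 0 < th i by rewrite powR_gt0.
have t0 (q : 'I_k * bool) : 0 < dt (4 ^- n) q :> R.
  by apply: dt_gt0; rewrite invr_gt0 exprn_gt0.
pose h (j : 'I_K.+1) := hks (prodm (restr_lev mu n K th j) nu) (@addX R d) (@dc R k) (dt (4 ^- n)).
have mh j : measurable_fun setT (h j).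
  by apply: measurable_hks => //; [exact: prod_finite|exact: measurable_addX].
have mhp j : measurable_fun setT (fun x => (`|h j x| `^ p)%:E).
  apply/measurable_EFinP; apply: (measurableT_comp (measurable_powR p)).
  exact: measurableT_comp.
apply: (@le_trans _ _ (\int[@leb R d]_x ((K.+1%:R `^ p)%:E * \sum_j (`|h j x| `^ p)%:E))%E).
  apply: ge0_le_integral => //.
  - apply/measurable_EFinP; apply: (measurableT_comp (measurable_powR p)).
    apply: measurableT_comp => //.
    by apply: measurable_hks => //; [exact: prod_finite|exact: measurable_addX].
  - by apply: measurable_funeM; apply: emeasurable_sum.
  move=> x _; rewrite (hks_levsets mu n K th nu _ _ t0) sumEFin -EFinM lee_fin.
  by have := powR_sum_le (fun j => h j x) p0; rewrite card_ord.
rewrite ge0_integralZl; last 4 first.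
- by [].
- exact: emeasurable_sum.
- by move=> x _; apply: sume_ge0 => j _; rewrite lee_fin powR_ge0.
- by rewrite lee_fin powR_ge0.
rewrite ge0_integral_sum//.
rewrite -mulrA EFinM; apply: lee_wpmul2l; first by rewrite lee_fin powR_ge0.
apply: (@le_trans _ _ (\sum_(j < K.+1) (C * 2 `^ (- (n%:R * delta)))%:E)%E); last first.
  by rewrite sumEFin lee_fin sumr_const card_ord -[leLHS]mulr_natl mulrA.
apply: lee_sum => j _.
have hj := hC n (restr_lev mu n K th j) (th j) (thp j)
  (fun l => restr_lev_cube _ _ _ _ th0 (ltW (thp j))).
apply: (le_trans hj).
rewrite lee_fin -!mulrA ler_wpM2l// mulrA.
have := level_mass (fun=> erefl) (ltW eps0) sK (ltn_ord j : (j <= K)%N) hS => hm.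
have -> : 2 `^ (- (n%:R * delta)) =
    2 `^ (n%:R * ((p - 1) * (eps - s))) * 2 `^ (n%:R * expo d sigma p) :> R.
  rewrite -powR2D; congr (_ `^ _).
  have -> : (p - 1) * (eps - s) = delta - (p - 1) * s.
    by rewrite /eps; field; rewrite gt_eqF.
  by rewrite /delta; field.
by rewrite ler_wpM2r ?powR_ge0.
Qed.

End delta.

(** * Almost everywhere convergence under an L^p majorant *)

Section geometric_domination.
Variables (R : realType) (y : nat -> R) (w q : R).
Hypotheses (q0 : 0 < q) (q1 : q < 1) (yq : forall j, `|y j| <= w * q ^+ j).

Let w0 : 0 <= w.
Proof. by have := le_trans (normr_ge0 _) (yq 0); rewrite expr0 mulr1. Qed.

Lemma normr_series_geometric N : `|series y N| <= w / (1 - q).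
Proof.
rewrite /series/= (le_trans (ler_norm_sum _ _ _))//.
apply: (@le_trans _ _ (\sum_(0 <= j < N) w * q ^+ j)); first exact: ler_sum.
rewrite -[X in X <= _]/(series (geometric w q) N) geometric_seriesE ?lt_eqF//.
rewrite /= mulrAC ler_piMr//; last by rewrite gerBl exprn_ge0// ltW.
by rewrite divr_ge0// subr_ge0 ltW.
Qed.

Lemma is_cvg_series_geometric : cvgn (series y).
Proof.
apply: normed_cvg; apply: (@series_le_cvg _ _ (geometric w q)) => //.
- by move=> n /=.
- by move=> n; rewrite /geometric/= mulr_ge0// exprn_ge0// ltW.
- by apply: is_cvg_geometric_series; rewrite ger0_norm// ltW.
Qed.

End geometric_domination.

Section Lp_series.
Context dT (T : measurableType dT) (R : realType) (m : {measure set T -> \bar R}).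
Variables (y : nat -> T -> R) (p r C : R).
Hypotheses (my : forall j, measurable_fun setT (y j)) (p0 : 0 < p)
  (r0 : 0 < r) (r1 : r < 1)
  (hy : forall j, (\int[m]_x (`|y j x| `^ p)%:E <= (C * r ^+ j)%:E)%E).

(* With [om = sqrt r] the weighted series [\sum_j om^-j |y_j|^p] still has a
   finite integral, and where it is finite [|y_j|] is geometrically small. *)
Lemma Lp_series_bound : exists W : T -> \bar R, [/\ measurable_fun setT W,
  (forall x, 0 <= W x)%E, (\int[m]_x W x < +oo)%E,
  (forall x N, ((`|series (y ^~ x) N| `^ p)%:E <= W x)%E) &
  (forall x, (W x < +oo)%E -> cvgn (series (y ^~ x)))].
Proof.
pose om := Num.sqrt r; pose q := om `^ p^-1.
have om0 : 0 < om by rewrite sqrtr_gt0.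
have om2 : om ^+ 2 = r by rewrite sqr_sqrtr// ltW.
have om1 : om < 1.
  by rewrite -(@ltr_pXn2r _ 2)// ?nnegrE ?ltW// om2 expr1n.
have q0 : 0 < q by rewrite powR_gt0.
have pV0 : 0 < p^-1 by rewrite invr_gt0.
have q1 : q < 1.
  have -> : 1 = 1 `^ p^-1 :> R by rewrite powR1.
  by apply: gt0_ltr_powR; rewrite ?nnegrE ?ltW.
have C0 : 0 <= C.
  have := hy 0; rewrite expr0 mulr1 -lee_fin; apply: le_trans.
  by apply: integral_ge0 => x _; rewrite lee_fin powR_ge0.
pose u j x : \bar R := ((om ^- j) * `|y j x| `^ p)%:E.
have u0 j x : (0 <= u j x)%E.
  by rewrite lee_fin mulr_ge0 ?powR_ge0// invr_ge0 exprn_ge0// ltW.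
have myp j : measurable_fun setT (fun x => `|y j x| `^ p).
  by apply: (measurableT_comp (measurable_powR p)); exact: measurableT_comp.
have mu j : measurable_fun setT (u j).
  by apply/measurable_EFinP; exact: measurable_funM.
(* The p-th power of the geometric sum in [q], which turns a bound on the terms into one on the
   partial sums. *)
pose c : R := ((1 - q)^-1) `^ p.
have c0 : 0 < c by rewrite powR_gt0// invr_gt0 subr_gt0.
pose W0 x := (\sum_(j <oo) u j x)%E.
have W00 x : (0 <= W0 x)%E by apply: nneseries_ge0.
have mW0 : measurable_fun setT W0 by apply: ge0_emeasurable_sum.
pose W x := (c%:E * W0 x)%E.
have key x : (W0 x < +oo)%E -> forall j, `|y j x| <= (fine (W0 x)) `^ p^-1 * q ^+ j.
  move=> Wx j; have W0E : (fine (W0 x))%:E = W0 x by rewrite fineK// ge0_fin_numE.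
  have h : om ^- j * `|y j x| `^ p <= fine (W0 x).
    rewrite -lee_fin W0E -/(u j x).
    apply: le_trans (nneseries_lim_ge j.+1 (fun i _ _ => u0 i x)).
    by rewrite big_nat_recr//= leeDr// sume_ge0.
  have pn : p != 0 by rewrite gt_eqF.
  rewrite -[leLHS](powRr1 (normr_ge0 _)) -(divff pn) powRrM.
  have -> : q ^+ j = (om ^+ j) `^ p^-1.
    by rewrite -powR_mulrn ?ltW// /q -powRrM mulrC powRrM powR_mulrn// ltW.
  rewrite -powRM ?fine_ge0 ?exprn_ge0 ?(ltW om0)//.
  apply: ge0_ler_powR; rewrite ?nnegrE ?powR_ge0 ?mulr_ge0 ?fine_ge0 ?exprn_ge0 ?(ltW om0) ?(ltW pV0)//.
  by rewrite mulrC -ler_pdivrMl ?exprn_gt0.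
exists W; split.
- exact: measurable_funeM.
- by move=> x; rewrite mule_ge0// lee_fin ltW.
- rewrite ge0_integralZl//; last by rewrite lee_fin ltW.
  apply: lte_mul_pinfty; rewrite ?lee_fin ?(ltW c0)//.
  rewrite integral_nneseries//.
  apply: (@le_lt_trans _ _ (\sum_(j <oo) (geometric C om j)%:E)%E).
    apply: lee_nneseries => [j _ _|j _]; first by apply: integral_ge0.
    rewrite /u; under eq_integral do rewrite EFinM.
    rewrite ge0_integralZl; last 4 first.
    + by [].
    + exact/measurable_EFinP.
    + by move=> x _; rewrite lee_fin powR_ge0.
    + by rewrite lee_fin invr_ge0 exprn_ge0// ltW.
    apply: (@le_trans _ _ ((om ^- j)%:E * (C * r ^+ j)%:E)%E).
      by apply: lee_wpmul2l; rewrite ?lee_fin ?invr_ge0 ?exprn_ge0// ltW.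
    (* As [r] is the square of [om], the weight [om^-j] leaves [C om^j], which is still summable. *)
    rewrite -EFinM lee_fin /geometric/= -om2 -exprM mulnC exprM expr2 mulrCA.
    by rewrite mulKf// expf_neq0// gt_eqF.
  have g0 j : 0 <= geometric C om j by rewrite /geometric/= mulr_ge0// exprn_ge0// ltW.
  apply: (@le_lt_trans _ _ (C / (1 - om))%:E); last by rewrite ltry.
  apply: lime_le; first by apply: is_cvg_nneseries => j _ _; rewrite lee_fin.
  apply: nearW => N; rewrite sumEFin lee_fin; apply: le_trans (ler_norm _) _.
  by apply: (@normr_series_geometric _ (geometric C om)) => // j; rewrite ger0_norm.
- move=> x N; have [Wx|] := ltP (W0 x) +oo%E; last first.
    by rewrite leye_eq /W => /eqP ->; rewrite gt0_muley ?lte_fin// leey.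
  rewrite /W -(@fineK _ (W0 x)); last by rewrite ge0_fin_numE.
  rewrite -EFinM lee_fin.
  apply: (@le_trans _ _ ((fine (W0 x) `^ p^-1 / (1 - q)) `^ p)).
    apply: ge0_ler_powR; rewrite ?nnegrE ?(ltW p0)//.
      by rewrite mulr_ge0 ?powR_ge0// invr_ge0 subr_ge0 ltW.
    exact: normr_series_geometric (key x Wx) N.
  rewrite powRM ?powR_ge0 ?invr_ge0 ?subr_ge0 ?(ltW q1)// -powRrM mulVf ?gt_eqF//.
  by rewrite powRr1 ?fine_ge0// mulrC.
- move=> x; rewrite /W => Wx; apply: (is_cvg_series_geometric q0 q1 (key x _)).
  move: Wx; case: (W0 x) => [w _|+|//]; first by rewrite ltry.
  by rewrite gt0_muley ?lte_fin// ltxx.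
Qed.

End Lp_series.

(** * Identification of the limit *)

Section approximate_identity.
Context (R : realType) (d : nat) dT (T : measurableType dT)
  (m : {sigma_finite_measure set T -> \bar R}) (X : T -> 'rV[R]_d).
Hypotheses (mfin : (m setT < +oo)%E) (mX : measurable_fun setT X).
Let V := 'rV[R]_d.
Variables (phi : V -> R) (Lf : R).
Hypotheses (mphi : measurable_fun setT phi) (phi1 : forall x, `|phi x| <= 1)
  (Lf0 : 0 <= Lf) (phiL : forall x y, `|phi x - phi y| <= Lf * `|x - y|).

Let integrable_gk t (w : V) : 0 < t ->
  (@leb R d).-integrable setT (fun x => (gk t (x - w))%:E).
Proof.
move=> t0; apply/integrableP; split.
  by apply/measurable_EFinP; apply: measurable_gk; exact: measurable_rVB.
under eq_integral do rewrite gee0_abs ?lee_fin ?gk_ge0//.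
by rewrite integral_gk// ltry.
Qed.

Let integrable_phi_gk t (w : V) : 0 < t ->
  (@leb R d).-integrable setT (fun x => (phi x * gk t (x - w))%:E).
Proof.
move=> t0; apply: (le_integrable measurableT _ _ (integrable_gk w t0)).
  apply/measurable_EFinP/measurable_funM => //.
  by apply: measurable_gk; exact: measurable_rVB.
by move=> x _; rewrite lee_fin normrM ler_piMl.
Qed.

(** The Gaussian has mass 1, so the error averages [phi x - phi w], at most [Lf * |x - w|]; the
    first moment is bounded by [norm_gk_le]. *)
Lemma approx_gk t (w : V) : 0 < t ->
  `|\int[@leb R d]_x (phi x * gk t (x - w)) - phi w| <=
  Lf * (Num.sqrt (2 * t) * Num.sqrt 2 ^+ d).
Proof.
move=> t0; have t20 : 0 < 2 * t by rewrite mulr_gt0.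
set c := Num.sqrt (2 * t) * _.
have c0 : 0 <= c by rewrite mulr_ge0 ?exprn_ge0 ?sqrtr_ge0.
have E : \int[@leb R d]_x (gk t (x - w)) = 1.
  by apply: EFin_inj; rewrite (EFin_Rintegral measurableT (integrable_gk w t0)) integral_gk.
have -> : \int[@leb R d]_x (phi x * gk t (x - w)) - phi w =
    \int[@leb R d]_x (phi x * gk t (x - w) - phi w * gk t (x - w)).
  rewrite RintegralB//; [|exact: integrable_phi_gk|exact: integrableRZl (integrable_gk w t0)].
  by rewrite RintegralZl ?E ?mulr1//; exact: integrable_gk.
have ib : (@leb R d).-integrable setT
    (fun x => (phi x * gk t (x - w) - phi w * gk t (x - w))%:E).
  under eq_fun do rewrite EFinB.
  apply: integrableB => //; first exact: integrable_phi_gk.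
  exact: integrableRZl (integrable_gk w t0).
apply: le_trans (le_normr_Rintegral measurableT ib) _.
have E2 : \int[@leb R d]_x (gk (2 * t) (x - w)) = 1.
  by apply: EFin_inj; rewrite (EFin_Rintegral measurableT (integrable_gk w t20)) integral_gk.
have -> : Lf * c = \int[@leb R d]_x (Lf * c * gk (2 * t) (x - w)).
  by rewrite RintegralZl ?E2 ?mulr1//; exact: integrable_gk.
apply: le_Rintegral => //.
- exact: (integrable_norm ib).
- exact: integrableRZl (integrable_gk w t20).
move=> x _; rewrite -mulrBl normrM (ger0_norm (gk_ge0 _ _)).
apply: (@le_trans _ _ (Lf * `|x - w| * gk t (x - w))).
  by rewrite ler_wpM2r ?gk_ge0.
by rewrite -!mulrA ler_wpM2l// [leRHS]mulrA norm_gk_le.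
Qed.

Let mgk2 t : measurable_fun setT (fun z : V * T => gk t (z.1 - X z.2)).
Proof.
by apply: measurable_gk; apply: measurable_rVB => //; exact: (measurableT_comp mX).
Qed.

Let integrable_phi_gk2 t : 0 < t ->
  (@leb R d \x m)%E.-integrable setT (fun z : V * T => (phi z.1 * gk t (z.1 - X z.2))%:E).
Proof.
move=> t0; apply/integrable12ltyP.
  apply/measurable_EFinP/measurable_funM; last exact: mgk2.
  exact: (measurableT_comp mphi).
apply: (@le_lt_trans _ _ (\int[@leb R d]_x (hk m X t x)%:E)%E); last first.
  by rewrite integral_hk.
apply: ge0_le_integral => //.
- by move=> x _; apply: integral_ge0.
- apply: (measurable_fun_fubini_tonelli_F
    (fun z : V * T => `|(phi z.1 * gk t (z.1 - X z.2))%:E|%E)) => //.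
  apply: measurableT_comp => //.
  apply/measurable_EFinP/measurable_funM; last exact: mgk2.
  exact: (measurableT_comp mphi).
- by apply/measurable_EFinP; exact: measurable_hk.
move=> x _; rewrite hkE//; apply: ge0_le_integral => //=.
- apply/measurable_EFinP; apply: measurableT_comp => //; apply: measurable_funM => //.
  by apply: measurable_gk; apply: measurable_rVB.
- by apply/measurable_EFinP; apply: measurable_gk; apply: measurable_rVB.
by move=> o _; rewrite lee_fin normrM (ger0_norm (gk_ge0 _ _)) ler_piMl ?gk_ge0.
Qed.

Let integrable_phi_hk t : 0 < t ->
  (@leb R d).-integrable setT (fun x => (phi x * hk m X t x)%:E).
Proof.
move=> t0; apply: (@le_integrable _ _ _ _ _ _ _ (fun x => (hk m X t x)%:E)) => //.
- by apply/measurable_EFinP/measurable_funM => //; exact: measurable_hk.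
- by move=> x _; rewrite lee_fin normrM (ger0_norm (hk_ge0 _ _ _ _)) ler_piMl ?hk_ge0.
apply/integrableP; split; first by apply/measurable_EFinP; exact: measurable_hk.
under eq_integral do rewrite gee0_abs ?lee_fin ?hk_ge0//.
by rewrite integral_hk.
Qed.

Let mphiX : measurable_fun setT (fun o => phi (X o)).
Proof. exact: (measurableT_comp mphi). Qed.

Let iphiX : m.-integrable setT (fun o => (phi (X o))%:E).
Proof. exact: (integrable_bounded mfin mphiX (fun o => phi1 _)). Qed.

Lemma approx_hk t : 0 < t ->
  `|\int[@leb R d]_x (phi x * hk m X t x) - \int[m]_o phi (X o)| <=
  Lf * (Num.sqrt (2 * t) * Num.sqrt 2 ^+ d) * fine (m setT).
Proof.
move=> t0; pose G o := \int[@leb R d]_x (phi x * gk t (x - X o)).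
have GE o : (\int[@leb R d]_x (phi x * gk t (x - X o))%:E = (G o)%:E)%E.
  by rewrite (EFin_Rintegral measurableT (integrable_phi_gk (X o) t0)).
have iG : m.-integrable setT (EFin \o G).
  apply: (integrable_bounded mfin (C := 1 + Lf * (Num.sqrt (2 * t) * Num.sqrt 2 ^+ d))).
    apply/measurable_EFinP; have := measurable_fubini_G (integrable_phi_gk2 t0).
    by apply: eq_measurable_fun => o _; rewrite /= -GE.
  move=> o; rewrite -[G o](subrK (phi (X o))) addrC.
  by rewrite (le_trans (ler_normD _ _))// lerD// approx_gk.
have -> : \int[@leb R d]_x (phi x * hk m X t x) = \int[m]_o G o.
  apply: EFin_inj.
  rewrite (EFin_Rintegral measurableT (integrable_phi_hk t0)) (EFin_Rintegral measurableT iG).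
  under [RHS]eq_integral do rewrite -GE.
  have <- := Fubini (integrable_phi_gk2 t0); apply: eq_integral => x _ /=.
  under [RHS]eq_integral do rewrite EFinM.
  rewrite integralZl//; first by rewrite EFinM hkE.
  apply: (@integrable_bounded _ _ _ m mfin _ ((Num.sqrt (2 * pi * t))^-1 ^+ d)).
    by apply: measurable_gk; apply: measurable_rVB.
  by move=> o; exact: gk_norm_le.
rewrite -RintegralB//.
have mG : measurable_fun setT G by apply/measurable_EFinP; exact: measurable_int iG.
apply: normr_Rintegral_le => //; first exact: measurable_funB.
by move=> o; exact: approx_gk.
Qed.

(** The signed kernels still form an approximate identity: their coefficients sum to 1, and all
    variances are at most [k 4^-n], so the error is of order [2^-n]. *)
Lemma cvg_kernel_hks k : (0 < k)%N ->
  \int[@leb R d]_x (phi x * hks m X (@kc R k) (kt (4 ^- n)) x) @[n --> \oo] -->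
  \int[m]_o phi (X o).
Proof.
move=> k0; have t0 n (j : 'I_k) : 0 < kt (4 ^- n) j :> R.
  by apply: kt_gt0; rewrite invr_gt0 exprn_gt0.
(* [binomial_tail] at [y = 1], where the power vanishes because [k > 0]. *)
have sum1 : \sum_(j < k) kc R j = 1.
  have := binomial_tail k (1 : R); rewrite subrr expr0n (gtn_eqF k0) subr0 => <-.
  by apply: eq_bigr => j _; rewrite expr1n mulr1.
pose S := \sum_(j < k) `|kc R j|.
pose B := S * (Lf * (Num.sqrt (2 * k%:R) * Num.sqrt 2 ^+ d) * fine (m setT)).
have bound n : `|\int[@leb R d]_x (phi x * hks m X (@kc R k) (kt (4 ^- n)) x) -
    \int[m]_o phi (X o)| <= B * 2 ^- n.
  have -> : \int[@leb R d]_x (phi x * hks m X (@kc R k) (kt (4 ^- n)) x) =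
      \sum_(j < k) kc R j * \int[@leb R d]_x (phi x * hk m X (kt (4 ^- n) j) x).
    have ii (j : 'I_k) : (@leb R d).-integrable setT (EFin \o
        (fun x => kc R j * (phi x * hk m X (kt (4 ^- n) j) x))).
      by apply: integrableRZl => //; exact: integrable_phi_hk.
    transitivity (\int[@leb R d]_x \sum_(j < k) kc R j * (phi x * hk m X (kt (4 ^- n) j) x)).
      apply: eq_Rintegral => x _; rewrite /hks mulr_sumr.
      by apply: eq_bigr => j _; rewrite mulrCA.
    rewrite /Rintegral; under eq_integral do rewrite -sumEFin.
    rewrite integral_sum//.
    under eq_bigr do rewrite -(EFin_Rintegral measurableT (ii _)).
    rewrite sumEFin/=; apply: eq_bigr => j _; rewrite RintegralZl//.
    exact: integrable_phi_hk.
  have -> : \int[m]_o phi (X o) = \sum_(j < k) kc R j * \int[m]_o phi (X o).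
    by rewrite -mulr_suml sum1 mul1r.
  rewrite -sumrB.
  rewrite (le_trans (ler_norm_sum _ _ _))//.
  have -> : B * 2 ^- n = S * (Lf * (Num.sqrt (2 * k%:R) * 2 ^- n * Num.sqrt 2 ^+ d) *
      fine (m setT)) by rewrite /B; ring.
  rewrite mulr_suml; apply: ler_sum => j _; rewrite -mulrBr normrM ler_wpM2l//.
  apply: (le_trans (approx_hk (t0 n j))).
  rewrite ler_wpM2r ?fine_ge0// ler_wpM2l// ler_wpM2r ?exprn_ge0 ?sqrtr_ge0//.
  have -> : 2 ^- n = Num.sqrt (4 ^- n) :> R.
    have -> : 4 ^- n = (2 ^- n) ^+ 2 :> R by rewrite exprVn -exprM mulnC exprM expr2 -natrM.
    by rewrite sqrtr_sqr ger0_norm// invr_ge0 exprn_ge0.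
  rewrite -sqrtrM ?mulr_ge0// ler_wsqrtr// /kt -mulrA ler_pM2l//.
  by rewrite ler_wpM2r ?invr_ge0 ?exprn_ge0// ler_nat.
apply/subr_cvg0; apply: norm_cvg0.
apply: (@squeeze_cvgr _ _ _ _ (cst 0) (fun n => B * 2 ^- n)).
- by apply: nearW => n; rewrite normr_ge0/=; exact: bound.
- exact: cvg_cst.
- have := @cvg_geometric R B 2^-1; rewrite ger0_norm// => /(_ _).
  under [X in _ -> X @ _ --> _]eq_fun do rewrite -exprVn.
  by apply; rewrite invf_lt1// ltr1n.
Qed.

End approximate_identity.

(** * Lipschitz cutoffs of open sets *)

Section cutoff.
Context (R : realType) (d : nat).
Let V := 'rV[R]_d.

(** The function [min(1, K dist(x, ~ S))]; having 1 in the set keeps the infimum meaningful when [S]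
    is the whole space. *)
Definition cut (S : set V) (K : R) (x : V) : R :=
  inf [set r | r = 1 \/ exists2 y, ~ S y & r = K * `|x - y|].

Section lipschitz.
Variables (S : set V) (K : R).
Hypothesis K0 : 0 <= K.

Let lb x : has_lbound [set r | r = 1 \/ exists2 y, ~ S y & r = K * `|x - y|].
Proof. by exists 0 => r /= [->//|[y _ ->]]; rewrite mulr_ge0. Qed.

Let ne x : [set r | r = 1 \/ exists2 y, ~ S y & r = K * `|x - y|] !=set0.
Proof. by exists 1; left. Qed.

Lemma cut_ge0 x : 0 <= cut S K x.
Proof. by apply: lb_le_inf => // r /= [->//|[y _ ->]]; rewrite mulr_ge0. Qed.

Lemma cut_le1 x : cut S K x <= 1.
Proof. by apply: ge_inf => //; left. Qed.

Lemma cut_out x : ~ S x -> cut S K x = 0.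
Proof.
move=> Sx; apply/eqP; rewrite eq_le cut_ge0 andbT; apply: ge_inf => //.
by right; exists x => //; rewrite subrr normr0 mulr0.
Qed.

Lemma cut_eq1 x : (forall y, ~ S y -> 1 <= K * `|x - y|) -> cut S K x = 1.
Proof.
move=> h; apply/eqP; rewrite eq_le cut_le1/=.
by apply: lb_le_inf => // r /= [->//|[y Sy ->]]; exact: h.
Qed.

Let cut_le x y : cut S K x - cut S K y <= K * `|x - y|.
Proof.
rewrite lerBlDr addrC -lerBlDr; apply: lb_le_inf => // r /= [->|[z Sz ->]].
  by rewrite lerBlDr (le_trans (cut_le1 x))// lerDl mulr_ge0.
rewrite lerBlDr -mulrDr; apply: (@le_trans _ _ (K * `|x - z|)).
  by apply: ge_inf => //; right; exists z.
by rewrite ler_wpM2l// [leRHS]addrC ler_distD.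
Qed.

Lemma cut_lipschitz x y : `|cut S K x - cut S K y| <= K * `|x - y|.
Proof. by rewrite ler_norml cut_le andbT lerNl opprB distrC cut_le. Qed.

Lemma continuous_cut : continuous (cut S K).
Proof.
move=> x; have FF : Filter (nbhs x) := nbhs_filter x.
apply/cvgrPdist_le => e e0.
have K1 : 0 < K + 1 by rewrite ltr_wpDl.
near=> y; apply: (le_trans (cut_lipschitz x y)).
have : `|x - y| < e / (K + 1).
  by near: y; apply: cvgr_dist_lt; rewrite ?divr_gt0.
rewrite ltr_pdivlMr// => /ltW; apply: le_trans.
by rewrite mulrC ler_wpM2l// lerDl.
Unshelve. all: by end_near. Qed.

Lemma measurable_cut : measurable_fun setT (cut S K).
Proof.
apply: (measurability _ (RGenOpens.measurableE R)) => _ [_ [a [b ->]] <-].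
rewrite setTI; apply: sub_sigma_algebra; apply: open_comp.
  by move=> x _; exact: continuous_cut.
exact: interval_open.
Qed.

End lipschitz.

Variable U : set V.
Hypothesis oU : open U.

(** Bounding the set gives the cutoffs bounded support, on which constants are integrable. *)
Definition trunc (k : nat) : set V := U `&` [set x | `|x| < k%:R].

(** At a point of [U] the cutoff is eventually 1: a point outside [trunc k] lies either outside [U],
    at distance at least some [e > 0] from [x], or beyond radius [k], at distance at least 1. *)
Lemma cvg_cut x : cut (trunc k) k%:R x @[k --> \oo] --> (\1_U x : R).
Proof.
have [Ux|Ux] := pselect (U x); last first.
  rewrite indicE memNset//; apply: cvg_near_cst; apply: nearW => k.
  by rewrite cut_out// => -[].
rewrite indicE mem_set//; apply: cvg_near_cst.
have /nbhs_ballP[e /= e0 eU] : nbhs x U by apply: open_nbhs_nbhs.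
near=> k.
have k1 : e^-1 <= k%:R.
  apply: le_trans (ltW (archi_boundP (ltW _))) _; first by rewrite invr_gt0.
  by rewrite ler_nat; near: k; exact: nbhs_infty_ge.
have k2 : `|x| + 1 <= k%:R.
  apply: le_trans (ltW (archi_boundP _)) _; first by rewrite addr_ge0.
  by rewrite ler_nat; near: k; exact: nbhs_infty_ge.
apply/eqP; rewrite cut_eq1// => y Sy.
have [Uy|Uy] := pselect (U y).
  have yk : k%:R <= `|y| by rewrite leNgt; apply/negP => yk; apply: Sy.
  have : 1 <= `|x - y|.
    have := ler_distD x y 0; rewrite !subr0 distrC.
    lra.
  have : 1 <= k%:R :> R by apply: le_trans k2; rewrite lerDr.
  move=> h1 h2; rewrite -[leLHS]mulr1; exact: ler_pM.
have : e <= `|x - y|.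
  rewrite leNgt; apply/negP => xy; apply: Uy; apply: eU.
  by rewrite -ball_normE.
move=> h; apply: (@le_trans _ _ (e^-1 * e)); first by rewrite mulVf// gt_eqF.
by apply: ler_pM => //; rewrite ?invr_ge0 ltW.
Unshelve. all: by end_near. Qed.

End cutoff.

(** * From open sets to Borel sets *)

Section density_measure.
Context dT (T : measurableType dT) (R : realType) (m : {measure set T -> \bar R}).
Variable f : T -> R.

(** Measurability and positivity are arguments so that the measure structure can be attached to the
    term itself. *)
Definition mdens & measurable_fun setT f & (forall x, 0 <= f x) :=
  fun A : set T => (\int[m]_(x in A) (f x)%:E)%E.

Hypotheses (mf : measurable_fun setT f) (f0 : forall x, 0 <= f x).
Let dens := mdens mf f0.

Let dens0 : dens set0 = 0%E. Proof. by rewrite /dens /mdens integral_set0. Qed.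

Let dens_ge0 A : (0 <= dens A)%E.
Proof. by apply: integral_ge0 => x _; rewrite lee_fin. Qed.

Let dens_additive : semi_sigma_additive dens.
Proof.
move=> /= A mA tA mUA; rewrite /dens /mdens ge0_integral_bigcup//.
- apply: is_cvg_ereal_nneg_natsum_cond => n _ _.
  by apply: integral_ge0 => x _; rewrite lee_fin.
- by apply/measurable_EFinP; exact: measurable_funTS.
- by move=> x _; rewrite lee_fin.
Qed.

HB.instance Definition _ := isMeasure.Build _ _ _ (mdens mf f0) dens0 dens_ge0 dens_additive.

End density_measure.

Section signed_density.
Context (R : realType) (d : nat).
Let V := 'rV[R]_d.
Variables (m : {measure set V -> \bar R}) (f : V -> R).
Hypotheses (intf : (@leb R d).-integrable setT (EFin \o f))
  (fU : forall U, open U -> m U = (\int[@leb R d]_(x in U) (f x)%:E)%E).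

Let mf : measurable_fun setT f.
Proof. by apply/measurable_EFinP; exact: measurable_int intf. Qed.

Let fp x := Num.max 0 (f x).
Let fn x := Num.max 0 (- f x).

Let mfp : measurable_fun setT fp. Proof. exact: measurable_maxr. Qed.
Let mfn : measurable_fun setT fn.
Proof. by apply: measurable_maxr => //; exact: measurableT_comp. Qed.
Let fp0 x : 0 <= fp x. Proof. by rewrite /fp le_max lexx. Qed.
Let fn0 x : 0 <= fn x. Proof. by rewrite /fn le_max lexx. Qed.
Let fpn x : fp x - fn x = f x.
Proof.
rewrite /fp /fn; have [h|h] := leP 0 (f x).
  by rewrite max_l ?subr0// oppr_le0.
by rewrite max_r ?sub0r ?opprK// oppr_ge0 ltW.
Qed.
Let ifp : (@leb R d).-integrable setT (EFin \o fp).
Proof.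
apply: (le_integrable measurableT _ _ intf); first exact/measurable_EFinP.
move=> x _; rewrite lee_fin /fp; have [h|h] := leP 0 (f x) => //.
by rewrite normr0.
Qed.
Let ifn : (@leb R d).-integrable setT (EFin \o fn).
Proof.
apply: (le_integrable measurableT _ _ intf); first exact/measurable_EFinP.
move=> x _; rewrite lee_fin /fn; have [h|h] := leP 0 (- f x) => //.
  by rewrite normrN.
by rewrite normr0.
Qed.

(** As a limit of signed kernels, [f] need not be known to be nonnegative. Moving its negative part
    to the other side, [Mp = m + Mn], keeps every term a positive measure. *)
Lemma open_density_nonneg A : measurable A ->
  m A = (\int[@leb R d]_(x in A) (Num.max 0 (f x))%:E)%E.
Proof.
move=> mA.
pose Mp : {measure set V -> \bar R} := mdens (@leb R d) mfp fp0.
pose Mn : {measure set V -> \bar R} := mdens (@leb R d) mfn fn0.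
have fin (g : V -> R) B : (@leb R d).-integrable setT (EFin \o g) -> measurable B ->
    (\int[@leb R d]_(x in B) (g x)%:E)%E \is a fin_num.
  by move=> ig mB; apply: integrable_fin_num => //; exact: integrableS ig.
(* Both sides agree on the open sets, a pi-system. *)
have MpE B : measurable B -> Mp B = measure_add m Mn B.
  move=> mB; apply: (measure_unique (@open V) (fun=> setT)) => //.
  - by move=> X Y; exact: openI.
  - by move=> _; exact: openT.
  - by rewrite bigcup_const//; exists 0%N.
  - move=> U oU; have mU : measurable U by exact: sub_sigma_algebra.
    rewrite -[RHS]/(measure_add m Mn U) measure_addE fU//.
    transitivity ((\int[@leb R d]_(x in U) (fp x)%:E - \int[@leb R d]_(x in U) (fn x)%:E) +
        \int[@leb R d]_(x in U) (fn x)%:E)%E; first by rewrite subeK// fin.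
    congr (_ + _)%E; rewrite -integralB_EFin//.
    + by apply: eq_integral => x _; rewrite -EFinB fpn.
    + exact: integrableS ifp.
    + exact: integrableS ifn.
  - by move=> _; rewrite -ge0_fin_numE//; exact: fin.
(* [Mp] vanishes on [N], which carries [Mn]: by [MpE], [Mn] vanishes. *)
pose N := [set x | f x < 0].
have mN : measurable N.
  rewrite (_ : N = f @^-1` `]-oo, 0[%classic); last first.
    by apply/seteqP; split => x; rewrite /N/= in_itv.
  by rewrite -[X in measurable X]setTI; apply: mf => //; exact: measurable_itv.
have MpN : Mp N = 0%E.
  apply: integral0_eq => x; rewrite /N/= => fx; rewrite /fp.
  by rewrite max_l// ltW.
have MnN : Mn N = 0%E.
  by have := MpE N mN; rewrite MpN measure_addE => /esym/eqP; rewrite padde_eq0// => /andP[_ /eqP].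
have MnA : Mn A = 0%E.
  apply/eqP; rewrite eq_le measure_ge0 andbT -MnN.
  apply: (@le_trans _ _ (Mn setT)); first by rewrite le_measure ?inE.
  rewrite /Mn/= /mdens [leRHS]integral_mkcond; apply: ge0_le_integral => //.
  - by move=> x _; rewrite lee_fin.
  - exact/measurable_EFinP.
  - apply/(measurable_restrictT _ _).1 => //.
    by apply/measurable_EFinP; exact: measurable_funTS.
  - move=> x _; rewrite patchE; case: ifPn => // xN; rewrite lee_fin /fn.
    rewrite max_l// oppr_le0 leNgt; apply: contra xN => fx; rewrite inE; exact: fx.
by have := MpE A mA; rewrite measure_addE MnA adde0 => <-.
Qed.

End signed_density.

(** * Passage to the limit *)

Section summable_increments.
Context (R : realType) (d k : nat).
Let V := 'rV[R]_d.
Variables (mu nu : probability V R) (p r C : R) (n0 : nat).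
Hypotheses (k0 : (0 < k)%N) (p1 : 1 < p) (r0 : 0 < r) (r1 : r < 1) (C0 : 0 <= C).

Let P : {sigma_finite_measure set (V * V)%type -> \bar R} := prodm mu nu.
Let F n (x : V) : R := hks P (@addX R d) (@kc R k) (kt (4 ^- n)) x.

Hypothesis hD : forall j, (\int[@leb R d]_x
  (`|hks P (@addX R d) (@dc R k) (dt (4 ^- (n0 + j))) x| `^ p)%:E <= (C * r ^+ j)%:E)%E.

Let Pfin : (P setT < +oo)%E. Proof. exact: prod_finite. Qed.
Let mX : measurable_fun setT (@addX R d). Proof. exact: measurable_addX. Qed.
Let p0 : 0 < p. Proof. exact: lt_trans p1. Qed.

Let t0 n (j : 'I_k) : 0 < kt (4 ^- n) j :> R.
Proof. by apply: kt_gt0; rewrite invr_gt0 exprn_gt0. Qed.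

Let mF n : measurable_fun setT (F n).
Proof. exact: measurable_hks. Qed.

Let S1 := \sum_(j < k) `|kc R j|.

Let F_L1 n : (\int[@leb R d]_x `|F n x|%:E <= (S1 * fine (mu setT))%:E)%E.
Proof. exact: integral_abs_hks_le. Qed.

Let FS n x : F n.+1 x - F n x = hks P (@addX R d) (@dc R k) (dt (4 ^- n)) x.
Proof.
rewrite /hks (sum_dc k (fun t => hk P (@addX R d) t x)) /F /hks.
by have -> : 4 ^- n.+1 = 4 ^- n / 4 :> R by rewrite exprS invfM mulrC.
Qed.

Let F_bounded n : exists2 M, 0 <= M & forall x, `|F n x| <= M.
Proof.
exists (\sum_(j < k) `|kc R j| * ((Num.sqrt (2 * pi * kt (4 ^- n) j))^-1 ^+ d * fine (P setT))).
  by apply: sumr_ge0 => j _; rewrite !mulr_ge0 ?fine_ge0// exprn_ge0.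
move=> x; rewrite (le_trans (ler_norm_sum _ _ _))//; apply: ler_sum => j _.
rewrite normrM ler_wpM2l//; apply: normr_Rintegral_le => //.
  by apply: measurable_gk; exact: measurable_rVB.
by move=> o; exact: gk_norm_le.
Qed.

(** A bounded integrable function is in L^p. The bound may depend on [n]: it serves only for the
    starting index [n0]. *)
Let F_Lp n : exists2 M, 0 <= M & (\int[@leb R d]_x (`|F n x| `^ p)%:E <= M%:E)%E.
Proof.
have [M M0 hM] := F_bounded n.
exists (M `^ (p - 1) * (S1 * fine (mu setT))).
  by rewrite !mulr_ge0 ?powR_ge0 ?fine_ge0//; apply: sumr_ge0.
rewrite EFinM; apply: (@le_trans _ _ ((M `^ (p - 1))%:E * \int[@leb R d]_x `|F n x|%:E)%E).
  rewrite -ge0_integralZl; last 4 first.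
  - by [].
  - by apply/measurable_EFinP; exact: measurableT_comp.
  - by move=> x _; rewrite lee_fin.
  - by rewrite lee_fin powR_ge0.
  apply: ge0_le_integral => //.
  - apply/measurable_EFinP; apply: (measurableT_comp (measurable_powR p)).
    exact: measurableT_comp.
  - by apply: measurable_funeM; apply/measurable_EFinP; exact: measurableT_comp.
  move=> x _; rewrite -EFinM lee_fin -(@mulr_powRB1 _ `|F n x| p)// mulrC.
  by rewrite ler_wpM2r// ge0_ler_powR ?nnegrE ?subr_ge0 ?(ltW p1).
by apply: lee_wpmul2l; [rewrite lee_fin powR_ge0|exact: F_L1].
Qed.

Let y j (x : V) : R := if j is i.+1 then F (n0 + i).+1 x - F (n0 + i) x else F n0 x.

Let seriesy x N : series (y ^~ x) N.+1 = F (n0 + N) x.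
Proof.
elim: N => [|N IH]; first by rewrite /series/= big_nat1/= addn0.
by rewrite seriesSr IH /= addrC subrK addnS.
Qed.

Let my j : measurable_fun setT (y j).
Proof. by case: j => [|j] /=; [exact: mF|apply: measurable_funB; exact: mF]. Qed.

Let hy : exists C', forall j, (\int[@leb R d]_x (`|y j x| `^ p)%:E <= (C' * r ^+ j)%:E)%E.
Proof.
have [M M0 hM] := F_Lp n0.
(* The term 0 of [y] is [F n0] itself, so the increments are shifted by one index; [C / r]
   compensates for the shift. *)
exists (M + C / r) => -[|j].
  by rewrite expr0 mulr1 (le_trans hM)// lee_fin lerDl divr_ge0// ltW.
under eq_integral do rewrite /= FS.
apply: le_trans (hD j) _; rewrite lee_fin.
have rn : r != 0 by rewrite gt_eqF.
have -> : (M + C / r) * r ^+ j.+1 = M * r ^+ j.+1 + C * r ^+ j by rewrite exprS; field.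
by rewrite lerDr mulr_ge0// exprn_ge0// ltW.
Qed.

Lemma Lp_density_of_increments : ac_Lp_density p (convolution mu nu).
Proof.
have [C' hC'] := hy.
have [W [mW W0 Wfin WF Wcvg]] := Lp_series_bound my p0 r0 r1 hC'.
(* The upper limit is defined and measurable everywhere; it is the limit wherever [W] is finite,
   hence almost everywhere. *)
pose f x : R := fine (limn_esup (fun N => (F (n0 + N) x)%:E)).
have mf : measurable_fun setT f.
  apply: measurableT_comp => //; apply: measurable_fun_limn_esup => N.
  exact/measurable_EFinP.
have cvgF x : (W x < +oo)%E -> F (n0 + N) x @[N --> \oo] --> f x.
  move=> /Wcvg /cvg_ex[l hl].
  have hF : F (n0 + N) x @[N --> \oo] --> l.
    by under eq_fun do rewrite -seriesy; move: hl; rewrite -(cvg_shiftS (series (y ^~ x))).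
  suff -> : f x = l by [].
  have hE : (F (n0 + N) x)%:E @[N --> \oo] --> l%:E.
    by apply: cvg_EFin; [exact: nearW|exact: hF].
  by rewrite /f is_cvg_limn_esupE ?(cvg_lim _ hE)//; apply/cvg_ex; exists l%:E.
have FW x N : ((`|F (n0 + N) x| `^ p)%:E <= W x)%E by rewrite -seriesy.
have fW x : (W x < +oo)%E -> ((`|f x| `^ p)%:E <= W x)%E.
  move=> Wx; have WE : (fine (W x))%:E = W x by rewrite fineK// ge0_fin_numE.
  have fW0 : 0 <= fine (W x) by rewrite fine_ge0.
  have h N : `|F (n0 + N) x| <= fine (W x) `^ p^-1.
    have pn : p != 0 by rewrite gt_eqF.
    rewrite -[leLHS](powRr1 (normr_ge0 _)) -(divff pn) powRrM.
    apply: ge0_ler_powR; rewrite ?nnegrE ?powR_ge0 ?invr_ge0 ?(ltW p0)//.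
    by rewrite -lee_fin WE FW.
  have : `|f x| <= fine (W x) `^ p^-1.
    have hn : `|F (n0 + N) x| @[N --> \oo] --> `|f x| by apply: cvg_norm; exact: cvgF.
    have <- := cvg_lim (@Rhausdorff R) hn.
    by apply: limr_le; [apply/cvg_ex; eexists; exact: hn|exact: nearW].
  move=> hf; rewrite -WE lee_fin.
  apply: (@le_trans _ _ ((fine (W x) `^ p^-1) `^ p)).
    by apply: ge0_ler_powR; rewrite ?nnegrE ?powR_ge0 ?(ltW p0).
  by rewrite -powRrM mulVf ?gt_eqF// powRr1.
have iW : (@leb R d).-integrable setT W.
  apply/integrableP; split => //.
  by under eq_integral do rewrite gee0_abs//.
have Wae : {ae @leb R d, forall x, (W x < +oo)%E}.
  have := integrable_ae measurableT iW; apply: filterS => x /(_ I).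
  by rewrite ge0_fin_numE.
pose B := S1 * fine (mu setT).
have maF N : measurable_fun setT (fun x => `|F (n0 + N) x|%:E).
  by apply/measurable_EFinP; exact: measurableT_comp.
(* The majorant [W] controls only [|f|^p]; integrability of [f] comes from the uniform L^1 bound
   [F_L1] and Fatou's lemma. *)
have intf : (@leb R d).-integrable setT (EFin \o f).
  apply/integrableP; split; first exact/measurable_EFinP.
  apply: (@le_lt_trans _ _ B%:E); last by rewrite ltry.
  apply: (@le_trans _ _ (\int[@leb R d]_x limn_einf (fun N => `|F (n0 + N) x|%:E))%E).
    apply: ae_ge0_le_integral => //.
    - by apply: measurableT_comp => //; exact/measurable_EFinP.
    - move=> x _; rewrite limn_einf_lim; apply: lime_ge; first exact: is_cvg_einfs.
      by apply: nearW => N; apply: le_ereal_inf_tmp => _ /= [j _ <-]; rewrite lee_fin.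
    - rewrite (_ : (fun x => _) =
          (fun x => - limn_esup (fun N => - `|F (n0 + N) x|%:E))%E); last first.
        by apply/funext => x; rewrite limn_esupN oppeK.
      apply: measurableT_comp => //; apply: measurable_fun_limn_esup => N.
      exact: measurableT_comp.
    - apply: filterS Wae => x Wx _; rewrite /= le_eqVlt; apply/orP; left.
      have hn : (`|F (n0 + N) x|%:E @[N --> \oo] --> `|f x|%:E)%E.
        by apply: cvg_EFin; [exact: nearW|apply: cvg_norm; exact: cvgF].
      by rewrite is_cvg_limn_einfE ?(cvg_lim _ hn)//; apply/cvg_ex; exists `|f x|%:E.
  apply: (@le_trans _ _ (limn_einf (fun N => \int[@leb R d]_x `|F (n0 + N) x|%:E)%E)).
    by apply: fatou => // N x _; rewrite lee_fin.
  rewrite limn_einf_lim; apply: lime_le; first exact: is_cvg_einfs.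
  apply: nearW => N; apply: (@le_trans _ _ (\int[@leb R d]_x `|F (n0 + N) x|%:E)%E) => //.
  by apply: ereal_inf_lbound; exists N => /=.
have intF N : (@leb R d).-integrable setT (EFin \o F (n0 + N)).
  apply/integrableP; split; first exact/measurable_EFinP.
  exact: le_lt_trans (F_L1 _) (ltry _).
have stepA (U : set V) (j : nat) : open U ->
    let phi := cut (trunc U j) j%:R in
    (\int[@leb R d]_x (phi x * f x)%:E = \int[P]_o (phi (addX o))%:E)%E.
  move=> oU phi; have j0 : 0 <= j%:R :> R by [].
  have mphi : measurable_fun setT phi by exact: measurable_cut.
  have phi01 x : 0 <= phi x <= 1 by rewrite cut_ge0//= cut_le1.
  have phi1 x : `|phi x| <= 1 by case/andP: (phi01 x) => h1 h2; rewrite ger0_norm.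
  have phiL x z : `|phi x - phi z| <= j%:R * `|x - z| by exact: cut_lipschitz.
  (* A majorant for dominated convergence: [|F| <= 1 + |F|^p], and the 1 is only needed on the box
     that contains the support of [phi]. *)
  pose g (x : V) := ((\1_(@box R d j) x)%:E + W x)%E.
  have ig : (@leb R d).-integrable setT g.
    apply: integrableD => //; apply/integrableP; split.
      by apply/measurable_EFinP; apply: measurable_indic; exact: measurable_box.
    under eq_integral do rewrite gee0_abs ?lee_fin//.
    rewrite integral_indic//; last exact: measurable_box.
    by rewrite setIT -/(leb _) leb_box ltry.
  have phibox x : ~ box j x -> phi x = 0.
    move=> bx; apply: cut_out => // -[_ /= xj]; apply: bx => i.
    have : `|x 0 i| < j%:R.
      apply: le_lt_trans xj; rewrite -[`|x|]/(mx_norm x) mx_normrE.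
      exact: (le_bigmax _ (fun ij : 'I_1 * 'I_d => `|x ij.1 ij.2|) (0, i)).
    by rewrite ltr_norml in_itv/= => /andP[/ltW -> ->].
  have mphiF N : measurable_fun setT (fun x => (phi x * F (n0 + N) x)%:E).
    by apply/measurable_EFinP; exact: measurable_funM.
  have h1 : (\int[@leb R d]_x (phi x * F (n0 + N) x)%:E @[N --> \oo] -->
      \int[@leb R d]_x (phi x * f x)%:E)%E.
    have [||||_ _ //] := @dominated_convergence _ _ _ (@leb R d) setT measurableT
      (fun N x => (phi x * F (n0 + N) x)%:E) (fun x => (phi x * f x)%:E) g mphiF.
    - by apply/measurable_EFinP; exact: measurable_funM.
    - apply: filterS Wae => x Wx _; apply: cvg_EFin; first exact: nearW.
      by apply: cvgMr; exact: cvgF.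
    - exact: ig.
    - apply: aeW => x N _; rewrite /g indicE.
      have [/set_mem bx|/negP bx] := boolP (x \in box j); last first.
        rewrite phibox; last by move=> h; apply: bx; exact/mem_set.
        by rewrite mul0r abse0 adde_ge0// lee_fin.
      apply: le_trans (leeD2l 1 (FW x N)); rewrite -EFinD lee_fin normrM.
      apply: (@le_trans _ _ `|F (n0 + N) x|); first by rewrite ler_piMl.
      have [h|h] := leP `|F (n0 + N) x| 1.
        by rewrite (le_trans h)// lerDl powR_ge0.
      rewrite (@le_trans _ _ (`|F (n0 + N) x| `^ p))// ?lerDr//.
      by rewrite -[leLHS]powRr1// ler_powR// ltW.
  have h2 : (\int[@leb R d]_x (phi x * F (n0 + N) x)%:E @[N --> \oo] -->
      (\int[P]_o phi (addX o))%:E)%E.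
    apply: cvg_EFin.
      apply: nearW => N; apply: integrable_fin_num => //.
      apply: (le_integrable measurableT _ _ (intF N)) => //.
      by move=> x _; rewrite lee_fin normrM ler_piMl.
    have := cvg_kernel_hks Pfin mX mphi phi1 j0 phiL k0.
    exact: (cvg_comp _ _ (cvg_addnl n0)).
  rewrite (cvg_unique _ h1 h2)// EFin_Rintegral//.
  by apply: (integrable_bounded Pfin _ (fun o => phi1 _)); exact: measurableT_comp.
(* The cutoffs now tend to the indicator of [U], under the majorant [|f|] on one side and the
   constant 1, integrable for the finite measure [P], on the other. *)
have fU U : open U -> convolution mu nu U = (\int[@leb R d]_(x in U) (f x)%:E)%E.
  move=> oU; have mU : measurable U by exact: sub_sigma_algebra.
  pose phi j := cut (trunc U j) j%:R : V -> R.
  have j0 j : 0 <= j%:R :> R by [].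
  have mphi j : measurable_fun setT (phi j) by exact: measurable_cut.
  have phi1 j x : `|phi j x| <= 1 by rewrite ger0_norm ?cut_ge0// cut_le1.
  have h1 : (\int[@leb R d]_x (phi j x * f x)%:E @[j --> \oo] -->
      \int[@leb R d]_x (\1_U x * f x)%:E)%E.
    have [|||||_ _ //] := @dominated_convergence _ _ _ (@leb R d) setT measurableT
      (fun j x => (phi j x * f x)%:E) (fun x => (\1_U x * f x)%:E)
      (fun x => `|f x|%:E).
    - by move=> j; apply/measurable_EFinP; exact: measurable_funM.
    - by apply/measurable_EFinP; apply: measurable_funM => //; exact: measurable_indic.
    - apply: aeW => x _; apply: cvg_EFin; first exact: nearW.
      by apply: cvgMl; exact: cvg_cut.
    - exact: integrable_abse intf.
    - by apply: aeW => x j _; rewrite lee_fin normrM ler_piMl.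
  have h2 : (\int[P]_o (phi j (addX o))%:E @[j --> \oo] -->
      \int[P]_o (\1_U (addX o))%:E)%E.
    have [|||||_ _ //] := @dominated_convergence _ _ _ P setT measurableT
      (fun j o => (phi j (addX o))%:E) (fun o => (\1_U (addX o))%:E)
      (fun=> 1%E).
    - by move=> j; apply/measurable_EFinP; exact: measurableT_comp.
    - by apply/measurable_EFinP; apply: measurableT_comp => //; exact: measurable_indic.
    - apply: aeW => x _; apply: cvg_EFin; first exact: nearW.
      exact: cvg_cut.
    - apply: (@integrable_bounded _ _ _ P Pfin (cst 1) 1) => //.
      by move=> o; rewrite normr1.
    - by apply: aeW => x j _; rewrite lee_fin.
  have hj j : (\int[@leb R d]_x (phi j x * f x)%:E = \int[P]_o (phi j (addX o))%:E)%E.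
    exact: stepA.
  rewrite (eq_cvg _ _ hj) in h1.
  have E := cvg_unique _ h1 h2.
  have -> : (\int[@leb R d]_(x in U) (f x)%:E = \int[@leb R d]_x (\1_U x * f x)%:E)%E.
    rewrite integral_mkcond; apply: eq_integral => x _.
    by rewrite patchE indicE; case: (x \in U); rewrite ?mul1r ?mul0r.
  rewrite E// -[LHS]/(P (@addX R d @^-1` U)).
  have mXU : measurable (@addX R d @^-1` U) by rewrite -[X in measurable X]setTI; exact: mX.
  by rewrite -[X in P X]setIT -integral_indic.
have dens A : measurable A -> convolution mu nu A =
    (\int[@leb R d]_(x in A) (Num.max 0 (f x))%:E)%E.
  pose m : {measure set V -> \bar R} := convolution mu nu.
  exact: (@open_density_nonneg R d m f intf fU A).
have mfp : measurable_fun setT (fun x => Num.max 0 (f x)) by exact: measurable_maxr.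
have fp0 x : 0 <= Num.max 0 (f x) by rewrite le_max lexx.
split.
  apply/null_content_dominatesP => A mA A0.
  rewrite dens//; apply: null_set_integral => //.
  by apply/measurable_EFinP; exact: measurable_funTS.
exists (fun x => Num.max 0 (f x)); split => //.
apply/andP; split; rewrite inE/= ?inE//=.
rewrite /finite_norm unlock /= poweR_lty//.
apply: le_lt_trans Wfin; apply: ae_ge0_le_integral => //.
  apply/measurable_EFinP.
  by apply: (measurableT_comp (measurable_powR p)); exact: measurableT_comp.
apply: filterS Wae => x Wx _; apply: le_trans (fW x Wx).
rewrite lee_fin; apply: ge0_ler_powR; rewrite ?nnegrE ?(ltW p0)//.
by rewrite ger0_norm// ge_max normr_ge0 ler_norm.
Qed.

End summable_increments.

(** * From dimensions to exponents *)

Lemma lt_limn_einf (R : realType) (u : (\bar R)^nat) (a : \bar R) :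
  (a < limn_einf u)%E -> exists n0, forall n, (n0 <= n)%N -> (a < u n)%E.
Proof.
rewrite limn_einf_lim (cvg_lim _ (@cvg_einfs_sup _ u))// => /ereal_sup_gt[_ [n0 _ <-]] h.
exists n0 => n n0n; apply: lt_le_trans h _.
by apply: ereal_inf_lbound; exists n.
Qed.

Lemma lt_fin_between (R : realType) (a : R) (b : \bar R) :
  (a%:E < b)%E -> exists2 s : R, a < s & (s%:E < b)%E.
Proof.
case: b => [b||//]; last by exists (a + 1); rewrite ?ltry// ltrDl.
by rewrite lte_fin => ab; exists ((a + b) / 2); rewrite ?lte_fin; [lra|lra].
Qed.

Section exponents.
Context (R : realType) (d : nat).
Variables (p : R) (mu nu : probability 'rV[R]_d R).
Hypothesis p1 : 1 < p.

Lemma Lq_sum_le (s : R) (n : nat) : (0 < n)%N ->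
  (s%:E < log2e (Lq_sum p mu n) * ((1 - p) * n%:R)^-1%:E)%E ->
  (Lq_sum p mu n <= (2 `^ (- (n%:R * ((p - 1) * s))))%:E)%E.
Proof.
move=> n0.
have : (0 <= Lq_sum p mu n)%E by apply: esum_ge0 => I _; exact: poweR_ge0.
have l2 : 0 < ln 2 :> R by rewrite ln_gt0// ltr1n.
have nR : 0 < n%:R :> R by rewrite ltr0n.
have a0 : 0 < (p - 1) * n%:R by rewrite mulr_gt0// subr_gt0.
have -> : ((1 - p) * n%:R)^-1 = - ((p - 1) * n%:R)^-1.
  by rewrite -invrN; congr (_^-1); ring.
case: (Lq_sum p mu n) => [x| |//]; last first.
  (* An infinite sum would make the ratio [-oo], the factor [1 - p] being negative. *)
  move=> _; rewrite /log2e/= gt0_mulye ?lte_fin ?invr_gt0//.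
  by rewrite lt0_mulye// lte_fin oppr_lt0 invr_gt0.
rewrite !lee_fin le_eqVlt => /predU1P[<- _|x0]; first exact: powR_ge0.
rewrite /log2e/= leNgt x0/= -!EFinM lte_fin mulrN => h.
rewrite /powR (gt_eqF (@ltr0n R 2)) -[leLHS]lnK// ler_expR.
have : s * ((p - 1) * n%:R) * ln 2 < - ln x; last by lra.
rewrite -ltr_pdivlMr// -ltr_pdivlMr// mulNr mulNr.
exact: h.
Qed.

Lemma gap_density (sigma s : R) : 0 <= sigma -> fourier_decay nu sigma ->
  expo d sigma p < (p - 1) * s -> (s%:E < Lq_dim p mu)%E ->
  ac_Lp_density p (convolution mu nu).
Proof.
move=> s0 hdec gap /lt_limn_einf[n0 hn0].
pose k := (Num.bound sigma).+1.
have sk : sigma <= k%:R.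
  by rewrite ltW// (lt_trans (archi_boundP s0))// ltr_nat.
have [C [delta [C0 delta0 hC]]] := delta_bound mu s0 (ltn0Sn _) sk hdec p1 gap.
(* Starting at [n0.+1] excludes the index 0, at which the ratio defining the dimension carries no
   information. *)
apply: (@Lp_density_of_increments R d k mu nu p (2 `^ (- delta)) C n0.+1) => //.
  by rewrite /powR pnatr_eq0/= expR_lt1 mulNr oppr_lt0 mulr_gt0// ln_gt0// ltr1n.
move=> j; apply: le_trans (hC _ _) _.
  by apply: Lq_sum_le => //; apply: hn0; rewrite ltnW// leq_addr.
rewrite lee_fin ler_wpM2l// -powR_mulrn ?powR_ge0// -powRrM.
rewrite ler_powR// ?ler1n// mulNr lerN2 mulrC ler_pM2r//.
by rewrite ler_nat leq_addl.
Qed.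

(** A decay exponent [sigma] is picked below the Fourier dimension, still above the left-hand side
    of the hypothesis; solving for the dimension of [mu] gives
    [expo d sigma p / (p - 1) < Lq_dim p mu] in both ranges of [p]. *)
Lemma dim_density :
  (p <= 2 -> (d%:R%:E - Lq_dim p mu < fourier_dim nu)%E) ->
  (2 < p -> ((p - 1)%:E * (d%:R%:E - Lq_dim p mu) < fourier_dim nu)%E) ->
  ac_Lp_density p (convolution mu nu).
Proof.
have q0 : 0 < p - 1 by rewrite subr_gt0.
move=> h1 h2.
suff [sigma [s0 hdec] gap] : exists2 sigma, 0 <= sigma /\ fourier_decay nu sigma &
    ((expo d sigma p / (p - 1))%:E < Lq_dim p mu)%E.
  have [s gs sD] := lt_fin_between gap.
  by apply: gap_density s0 hdec _ sD; rewrite mulrC -ltr_pdivrMr.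
have [p2|p2] := leP p 2.
  have /ereal_sup_gt[_ [sigma hs <-] b] := h1 p2; exists sigma => //.
  rewrite /expo p2 mulrAC divff ?gt_eqF// mul1r.
  move: b; case: (Lq_dim p mu) => [D| |]//=; last by rewrite ltry.
  by rewrite -EFinB !lte_fin; lra.
have /ereal_sup_gt[_ [sigma hs <-] b] := h2 p2; exists sigma => //.
rewrite /expo leNgt p2/=; move: b; case: (Lq_dim p mu) => [D| |]//=.
- by rewrite -EFinB -EFinM !lte_fin ltr_pdivrMr// => ?; lra.
- by rewrite ltry.
- by rewrite gt0_muley ?lte_fin.
Qed.

End exponents.

Theorem theorem4p4 (R : realType) (d : nat) (p : R)
    (mu nu : probability 'rV[R]_d R) :
  1 < p -> compact (supp mu) ->
  ((p <= 2 -> (d%:R%:E - Lq_dim p mu < fourier_dim nu)%E) ->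
   (2 < p -> ((p - 1)%:E * (d%:R%:E - Lq_dim p mu) < fourier_dim nu)%E) ->
   ac_Lp_density p (convolution mu nu)) /\
  (Lq_dim p mu = d%:R%:E -> (0 < fourier_dim nu)%E ->
   ac_Lp_density p (convolution mu nu)).
Proof.
move=> p1 _; split; first exact: dim_density.
by move=> DE F0; apply: dim_density => // _; rewrite DE subee// mule0.
Qed.
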